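(* Let $\epsilon>0$. There exists a deterministic algorithm which, given an arbitrary $n$ by $n$ bipartite graph $\mathbb{G}$, outputs a $(1+\epsilon)^n$-approximation of $\operatorname{Perm}(\mathbb{G})$, i.e. a value $\hat Z$ with $$(1+\epsilon)^{-n}\operatorname{Perm}(\mathbb{G})\le \hat Z\le (1+\epsilon)^{n}\operatorname{Perm}(\mathbb{G}),$$ and which runs in time $\exp\big(O(\epsilon^{-1/2}n^{2/3}\log^3 n)\big)$.
   Context: An $n$ by $n$ bipartite graph $\mathbb{G}$ is a simple undirected bipartite graph with node set $V=V_1\cup V_2$ (disjoint parts), $|V_1|=|V_2|=n$, each edge joining a node of $V_1$ to a node of $V_2$. $\operatorname{Perm}(\mathbb{G})$ is the permanent $\sum_{\sigma}\prod_{i=1}^n a_{i,\sigma(i)}$ ($\sigma$ ranging over all permutations of $\{1,\dots,n\}$) of the $0,1$ matrix $(a_{ij})$ with rows indexed by $V_1$ and columns by $V_2$, where $a_{ij}=1$ exactly when the $i$-th node of $V_1$ and the $j$-th node of $V_2$ are adjacent; equivalently it is the number of perfect matchings of $\mathbb{G}$. The running time bound is asymptotic as $n\to\infty$, with $\epsilon$ a fixed constant; the constant implied in $O(\cdot)$ is absolute. *)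

(* Defs.v *)
From HB Require Import structures.
From mathcomp Require Import all_boot all_order all_fingroup all_algebra.

Set Implicit Arguments.
Unset Strict Implicit.
Unset Printing Implicit Defensive.

(* The two parts are the two summands; each part is numbered from 0 to n - 1,
   which fixes the labelling in which a graph is handed to an algorithm.
   Symmetry and the absence of edges inside a part make [adj] irreflexive. *)
Record bigraph (n : nat) := Bigraph {
  adj :> rel ('I_n + 'I_n)%type;
  adj_sym : symmetric adj;
  adj_left : forall i j : 'I_n, ~~ adj (inl i) (inl j);
  adj_right : forall i j : 'I_n, ~~ adj (inr i) (inr j)
}.

Definition biadjacency (n : nat) (G : bigraph n) : 'M[nat]_n :=
  \matrix_(i, j) nat_of_bool (G (inl i) (inr j)).

Definition permanent (R : comPzSemiRingType) (n : nat) (A : 'M[R]_n) : R :=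
  (\sum_(s : 'S_n) \prod_(i < n) A i (s i))%R.

Definition Perm (n : nat) (G : bigraph n) : nat := permanent (biadjacency G).

(* Model of computation: a deterministic random access machine on natural
   numbers, with structured control flow.  It has registers, addressed directly,
   and a memory [ram], addressed through registers.  Every instruction and every test
   costs 1.  The only arithmetic is addition and truncated subtraction, so that
   the bit length of a stored number grows by at most 1 per step (above that of
   the input and of the constants of the program); hence unit cost is
   polynomially related to logarithmic cost and to Turing machine time. *)
Inductive prog : Type :=
| Const of nat & nat          (* Const x c  :  x := c             *)
| Add of nat & nat & nat      (* Add x y z  :  x := y + z         *)
| Sub of nat & nat & nat      (* Sub x y z  :  x := max(y - z, 0) *)
| Read of nat & nat           (* Read x y   :  x := ram[y]        *)
| Write of nat & nat          (* Write x y  :  ram[x] := y        *)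
| Seq of prog & prog
| If of nat & prog & prog     (* the test is: register is nonzero *)
| While of nat & prog.

Record state := State { reg : nat -> nat; ram : nat -> nat }.

Definition upd (f : nat -> nat) (a v : nat) : nat -> nat :=
  fun b => if b == a then v else f b.

Definition set_reg (s : state) (x v : nat) : state :=
  State (upd (reg s) x v) (ram s).

Definition set_ram (s : state) (a v : nat) : state :=
  State (reg s) (upd (ram s) a v).

(* [exec p s t s'] : started in s, the program p halts after exactly t steps,
   in the state s'. *)
Inductive exec : prog -> state -> nat -> state -> Prop :=
| ExecConst x c s :
    exec (Const x c) s 1 (set_reg s x c)
| ExecAdd x y z s :
    exec (Add x y z) s 1 (set_reg s x (reg s y + reg s z))
| ExecSub x y z s :
    exec (Sub x y z) s 1 (set_reg s x (reg s y - reg s z))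
| ExecRead x y s :
    exec (Read x y) s 1 (set_reg s x (ram s (reg s y)))
| ExecWrite x y s :
    exec (Write x y) s 1 (set_ram s (reg s x) (reg s y))
| ExecSeq p q s t s' u s'' :
    exec p s t s' -> exec q s' u s'' -> exec (Seq p q) s (t + u) s''
| ExecIfTrue x p q s t s' :
    reg s x != 0 -> exec p s t s' -> exec (If x p q) s t.+1 s'
| ExecIfFalse x p q s t s' :
    reg s x = 0 -> exec q s t s' -> exec (If x p q) s t.+1 s'
| ExecWhileTrue x p s t s' u s'' :
    reg s x != 0 -> exec p s t s' -> exec (While x p) s' u s'' ->
    exec (While x p) s (t + u).+1 s''
| ExecWhileFalse x p s :
    reg s x = 0 -> exec (While x p) s 1 s.

Lemma exec_det p s t s' :
  exec p s t s' -> forall u s'', exec p s u s'' -> t = u /\ s' = s''.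
Proof.
elim=> {p s t s'}; intros; match goal with
  H : exec _ _ ?u ?r |- _ = ?u /\ _ = ?r => inversion H; subst end;
  try by match goal with nz : is_true (?a != 0), z : ?a = 0 |- _ =>
    rewrite z in nz end.
all: repeat match goal with
  IH : forall u r, exec ?p ?s u r -> _, H : exec ?p ?s _ _ |- _ =>
    case: (IH _ _ H) => ? ?; subst; clear IH end.
all: by split.
Qed.

(* Register 0 holds n and the first n * n memory cells hold the biadjacency
   matrix, row by row; all other registers and memory cells hold 0. *)
Definition input_state (n : nat) (G : bigraph n) : state :=
  State (upd (fun=> 0) 0 n)
        (nth 0 [seq biadjacency G i j | i <- enum 'I_n, j <- enum 'I_n]).

Lemma ram_input_state (n : nat) (G : bigraph n) (i j : 'I_n) :
  ram (input_state G) (i * n + j) = biadjacency G i j.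
Proof.
rewrite /input_state /=.
have H (s : seq 'I_n) (k : nat) : k < size s ->
    nth 0 [seq biadjacency G x y | x <- s, y <- enum 'I_n] (k * n + j)
    = biadjacency G (nth i s k) j.
  elim: s k => [//|x s IH] [|k] /= ks.
    rewrite mul0n add0n nth_cat size_map size_enum_ord ltn_ord.
    by rewrite (nth_map i) ?size_enum_ord // nth_ord_enum.
  rewrite nth_cat size_map size_enum_ord mulSn -addnA ltnNge leq_addr /=.
  by rewrite addKn; exact: IH.
by rewrite H ?size_enum_ord // nth_ord_enum.
Qed.

(* [runs A G t Z] : on input G, the algorithm A halts after exactly t steps and
   outputs the rational number Z, as a numerator in register 0 and a nonzero
   denominator in register 1. *)
Definition runs (A : prog) (n : nat) (G : bigraph n) (t : nat) (Z : rat) : Prop :=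
  exists s : state,
    [/\ exec A (input_state G) t s,
        reg s 1 != 0
      & Z = ((reg s 0)%:R / (reg s 1)%:R)%R].

(* Main.v *)
From mathcomp Require Import all_boot all_order all_fingroup all_algebra.
From mathcomp Require Import reals sequences exp.
From mathcomp Require Import zify ring lra.
Require Import Defs.

(** Give a column v the weight y_v > 0 and let Z(y) be the sum over all (partial)
    matchings of the product of (1 + sum_(v ~ u) y_v) / D over the unmatched rows u
    and of 1 / y_v over the unmatched columns v, where D = q^2.  Perfect matchings
    contribute Perm(G), so Perm(G) <= Z(y).  Conversely some y has
    Z(y) <= exp(O(n / q)) (Perm(G) + tiny): starting from the weights 1 / D and theta
    (tiny) for the columns, the columns are treated one by one, and raising the row
    weights next to a column until its free part is no more than its matched part
    over q costs a factor exp(2 / q), by the log-submodularity of the matching sums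
    in the rows.

    Z is a posynomial, hence convex in log y, so a local search over a geometric
    grid of weights finds a near minimum in polynomially many steps.  The values of
    Z needed on the way are products of ratios Z(S - x) / Z(S), which are computed
    by the recursion 1 / (w_x + sum_y ...) along self-avoiding paths.  A row weight
    is at least 1 / D times the sum of its children, so truncation errors shrink by
    D / (D + 1) on every second level: logarithmic depth suffices, and the total
    time is exp(O(log^2 n)) for fixed epsilon.

    The search is written in a small language of bounded loops over arrays, compiled
    to the register machine; truncating all loops and multiplications at one bound
    X = 2^(O(log^2 n)) makes the cost analysis independent of the values computed. *)

Set Implicit Arguments.
Unset Strict Implicit.
Unset Printing Implicit Defensive.

Import Order.TTheory GRing.Theory Num.Theory.
Local Open Scope ring_scope.

(** * Matching sums *)

(** The choice D = q^2 reconciles two demands on one column. Let rho be the ratio of its matched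
    part to its free part. Raising the adjacent row weights by h costs up to exp(h rho), which
    forces h to be of order 1 / (rho q); the column then has weight about 1 / (D h), which must come
    down to rho / q. Both are possible exactly at D = q^2. With q a fixed multiple of E >= 1 / ln(1
    + epsilon), the loss over all columns fits into (1 + epsilon)^n, while D does not grow with n,
    so the contraction of the recursion is a constant.

    The additive error left by theta is harmless because Perm(G) is an integer: if it is at least 1
    the error is relatively tiny, and if it is 0 the estimate falls below 1/2 and is rounded to 0.

    The computation uses exact integers. Clearing denominators level by level makes the bit lengths
    quasipolynomial, which is why multiplication must handle numbers up to 2^X and not just X.

    The exponent of the quasipolynomial depends on epsilon, whereas the claimed constant is
    absolute; the dependence is moved into the threshold on n. *)

Lemma setD1C (T : finType) (S : {set T}) (x y : T) : S :\ x :\ y = S :\ y :\ x.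
Proof. by rewrite !setDDl setUC. Qed.

Lemma big_setD1E (T : finType) (R : nmodType) (S : {set T}) (x : T) (P : pred T)
    (F : T -> R) :
  x \in S ->
  \sum_(y in S | P y) F y = (if P x then F x else 0) + \sum_(y in S :\ x | P y) F y.
Proof.
move=> xS; rewrite big_mkcondr [X in _ = _ + X]big_mkcondr (big_setD1 x) //=.
Qed.

Section MonomerDimer.
Variables (T : finType) (R : comNzRingType) (e : rel T).

(** The recursion removes picked vertices, so it is structural only in a bound [k]; any [k] at least
    [#|S|] gives the same value. *)
Fixpoint md_fuel (w : T -> R) (k : nat) (S : {set T}) : R :=
  if k is k'.+1 then
    if [pick x in S] is Some x then
      w x * md_fuel w k' (S :\ x) +
      \sum_(y in S :\ x | e x y) md_fuel w k' (S :\ x :\ y)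
    else 1
  else 1.

(* The sum over the matchings of the graph induced on S of the product of the
   weights of the unmatched vertices. *)
Definition md (w : T -> R) (S : {set T}) : R := md_fuel w #|S| S.

Lemma md_fuelE w k (S : {set T}) : (#|S| <= k)%N -> md_fuel w k S = md w S.
Proof.
rewrite /md; elim: k {-2}k (leqnn k) S => [|K IH] k kK S Sk.
  by move: kK Sk; rewrite leqn0 => /eqP->; rewrite leqn0 => /eqP->.
case: k kK Sk => [|k] kK Sk; first by move: Sk; rewrite leqn0 => /eqP->.
case E: #|S| => [|s] /=.
  by case: pickP => // x; rewrite (cards0_eq E) inE.
case: pickP => // x xS.
have c1 : #|S :\ x| = s by move: (cardsD1 x S); rewrite xS E => -[->].
have c2 y : (#|S :\ x :\ y| <= s)%N.
  by rewrite -c1; apply/subset_leq_card/subsetDl.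
have kK' : (k <= K)%N by [].
have sk : (s <= k)%N by rewrite -ltnS -E.
rewrite IH ?c1 //; congr (_ + _); apply: eq_bigr => y _.
rewrite IH ?(leq_trans (c2 y)) //.
by rewrite [RHS]IH // (leq_trans sk).
Qed.

Lemma md0 w : md w set0 = 1.
Proof. by rewrite /md cards0. Qed.

Hypothesis e_sym : symmetric e.

(** The definition expands only at the picked vertex; the point is that any vertex will do.
    Expanding at [a] and then at [b] yields [G a b], sorted by the fate of the pair: both free,
    matched together, one of them matched elsewhere, both matched elsewhere. This is symmetric in
    [a] and [b] once the double sum is exchanged. *)
Lemma md_rec w (S : {set T}) x : x \in S ->
  md w S = w x * md w (S :\ x) + \sum_(y in S :\ x | e x y) md w (S :\ x :\ y).
Proof.
have [k] := ubnP #|S|; elim: k S x => // k IH S x Sk xS.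
have IH' (A : {set T}) a b : a \in S -> A \subset S :\ a -> b \in A ->
    md w A = w b * md w (A :\ b) + \sum_(y in A :\ b | e b y) md w (A :\ b :\ y).
  move=> aS AS bA; apply: IH => //; apply: leq_ltn_trans (subset_leq_card AS) _.
  by move: Sk; rewrite (cardsD1 a S) aS.
have [m mS E] : exists2 m, m \in S & md w S =
    w m * md w (S :\ m) + \sum_(y in S :\ m | e m y) md w (S :\ m :\ y).
  rewrite /md; case: {2}#|S| (erefl #|S|) => [|s] Es.
    by rewrite (cards0_eq Es) inE in xS.
  rewrite Es /=; case: pickP => [m mS|/(_ x)]; last by rewrite xS.
  exists m => //.
  have c1 : #|S :\ m| = s by move: (cardsD1 m S); rewrite mS Es => -[->].
  rewrite !md_fuelE ?c1 //; congr (_ + _); apply: eq_bigr => y _.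
  by rewrite md_fuelE // -c1; apply/subset_leq_card/subsetDl.
rewrite E; have [<-//|mx] := eqVneq m x.
pose G a b := w a * w b * md w (S :\ a :\ b) + (if e a b then md w (S :\ a :\ b) else 0)
  + w a * \sum_(y in S :\ a :\ b | e b y) md w (S :\ a :\ b :\ y)
  + w b * \sum_(y in S :\ a :\ b | e a y) md w (S :\ a :\ b :\ y)
  + \sum_(y in S :\ a :\ b | e a y)
      \sum_(z in S :\ a :\ b | (z != y) && e b z) md w (S :\ a :\ b :\ y :\ z).
have expand a b : a \in S -> b \in S -> a != b ->
    w a * md w (S :\ a) + \sum_(y in S :\ a | e a y) md w (S :\ a :\ y) = G a b.
  move=> aS bS ab.
  have bSa : b \in S :\ a by rewrite !inE eq_sym ab.
  rewrite (IH' _ a b) // (big_setD1E _ _ bSa).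
  have -> : \sum_(y in S :\ a :\ b | e a y) md w (S :\ a :\ y) =
     w b * \sum_(y in S :\ a :\ b | e a y) md w (S :\ a :\ b :\ y) +
     \sum_(y in S :\ a :\ b | e a y)
      \sum_(z in S :\ a :\ b | (z != y) && e b z) md w (S :\ a :\ b :\ y :\ z).
    rewrite big_distrr -big_split /=; apply: eq_bigr => y /andP[ySab _].
    rewrite (IH' _ a b) ?subsetDl //; last first.
      by case/setD1P: ySab => yb _; rewrite in_setD1 eq_sym yb.
    rewrite (setD1C (S :\ a) y b); congr (_ + _).
    by apply: eq_bigl => z; rewrite in_setD1 -andbA andbCA.
  by rewrite /G mulrDr !mulrA !addrA; congr (_ + _ + _); rewrite addrAC.
rewrite (expand m x) // (expand x m) // 1?eq_sym // /G (setD1C S x m) (e_sym x m).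
rewrite (exchange_big_dep (fun z => (z \in S :\ m :\ x) && e x z)) /=; last first.
  by move=> y z /andP[_ _] /andP[-> /andP[_ ->]].
set A := \sum_(_ in _ | _) _; set B := \sum_(_ in _ | _) _.
set U := \sum_(_ | _) _; set V := \sum_(_ in _ | _) _.
have -> : U = V.
  apply: eq_bigr => z /andP[zS ez].
  rewrite big_mkcond [RHS]big_mkcond /=; apply: eq_bigr => y _.
  rewrite zS ez eq_sym (setD1C (S :\ m :\ x) z y) !andbT.
  by case: (y \in _); case: (e m y); case: (_ == _).
by congr (_ + _); rewrite [w m * w x]mulrC addrAC.
Qed.

End MonomerDimer.

(** * Positivity, monotonicity and log-modularity of matching sums *)

Section MonomerDimerOrder.
Variables (T : finType) (R : numDomainType) (e : rel T).
Hypothesis e_sym : symmetric e.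
Implicit Types (S A : {set T}) (w : T -> R).

Lemma md_setU1 w S x : x \notin S ->
  md e w (x |: S) = w x * md e w S + \sum_(y in S | e x y) md e w (S :\ y).
Proof. by move=> xS; rewrite (md_rec e_sym _ (setU11 x S)) setU1K. Qed.

Lemma md_setU2 w S x y : x \notin y |: S -> y \notin S ->
  md e w (x |: (y |: S)) = w x * md e w (y |: S) +
    (if e x y then md e w S else 0) +
    \sum_(z in S | e x z) md e w (y |: (S :\ z)).
Proof.
move=> xS yS; rewrite md_setU1 // (big_setD1E _ _ (setU11 y S)) setU1K // addrA.
congr (_ + _); apply: eq_bigr => z /andP[zS _].
congr md; apply/setP => t; rewrite !inE; case: (eqVneq t y) => //= ->.
by rewrite andbT; apply: contraNneq yS => ->.
Qed.

Lemma set_card_ind (P : {set T} -> Prop) :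
  P set0 ->
  (forall S x, x \in S -> (forall A, (#|A| < #|S|)%N -> P A) -> P S) ->
  forall S, P S.
Proof.
move=> P0 PS S; have [k] := ubnP #|S|; elim: k S => // k IH S Sk.
have [->//|[x xS]] := set_0Vmem S; apply: (PS _ x) => // A AS.
by apply: IH; apply: leq_trans AS _.
Qed.

Lemma cardsD1_lt S x : x \in S -> (#|S :\ x| < #|S|)%N.
Proof. by move=> xS; rewrite (cardsD1 x S) xS. Qed.

Lemma cardsD2_lt S x y : x \in S -> (#|S :\ x :\ y| < #|S|)%N.
Proof.
by move=> /cardsD1_lt; apply: leq_ltn_trans; apply/subset_leq_card/subsetDl.
Qed.

Lemma md_ge0 w S : (forall x, 0 <= w x) -> 0 <= md e w S.
Proof.
move=> w0; elim/set_card_ind: S => [|S x xS IH]; first by rewrite md0.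
rewrite (md_rec e_sym _ xS) addr_ge0 ?mulr_ge0 ?IH ?cardsD1_lt //.
by rewrite sumr_ge0 // => y _; rewrite IH ?cardsD2_lt.
Qed.

Lemma md_gt0 w S : (forall x, 0 < w x) -> 0 < md e w S.
Proof.
move=> w0; elim/set_card_ind: S => [|S x xS IH]; first by rewrite md0.
rewrite (md_rec e_sym _ xS) ltr_wpDr ?mulr_gt0 ?IH ?cardsD1_lt //.
by rewrite sumr_ge0 // => y _; rewrite ltW ?IH ?cardsD2_lt.
Qed.

Lemma md_le w w' S : (forall x, 0 <= w x) -> (forall x, w x <= w' x) ->
  md e w S <= md e w' S.
Proof.
move=> w0 ww; elim/set_card_ind: S => [|S x xS IH]; first by rewrite !md0.
rewrite !(md_rec e_sym _ xS) lerD //.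
  by rewrite ler_pM ?md_ge0 ?IH ?cardsD1_lt.
by apply: ler_sum => y _; rewrite IH ?cardsD2_lt.
Qed.

Lemma eq_in_md w w' S : {in S, w =1 w'} -> md e w S = md e w' S.
Proof.
elim/set_card_ind: S => [|S x xS IH] ww; first by rewrite !md0.
have ww1 A : A \subset S -> {in A, w =1 w'} by move=> /subsetP AS y /AS /ww.
rewrite !(md_rec e_sym _ xS) ww // IH ?cardsD1_lt //; last first.
  by apply: ww1; apply: subsetDl.
congr (_ + _); apply: eq_bigr => y _; apply: IH; first exact: cardsD2_lt.
by apply: ww1; apply: subset_trans (subsetDl _ _) (subsetDl _ _).
Qed.

Variable side : pred T.
Hypothesis e_side : forall x y, e x y -> side x != side y.

(** Vertices on the same side compete, vertices on opposite sides help each other. Both inequalities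
    are proved by one induction: expanding at [a] leads to its neighbours [y], which lie on the
    other side, so each inequality for [a], [b] rests on the opposite one for [y], [b] in [S :\ y].
    For opposite sides the edge between [a] and [b], if present, only adds to the larger member. *)
Lemma md_log_modular w S (a b : T) : (forall x, 0 <= w x) ->
  a \notin b |: S -> b \notin S ->
  if side a == side b
  then md e w S * md e w (a |: (b |: S)) <= md e w (a |: S) * md e w (b |: S)
  else md e w (a |: S) * md e w (b |: S) <= md e w S * md e w (a |: (b |: S)).
Proof.
move=> w0; have [k] := ubnP #|S|; elim: k S a b => // k IH S a b Sk abS bS.
have aS : a \notin S by apply: contra abS => aS; rewrite inE aS orbT.
have step y : y \in S -> if side y == side b
  then md e w (S :\ y) * md e w (b |: S) <= md e w S * md e w (b |: (S :\ y))
  else md e w S * md e w (b |: (S :\ y)) <= md e w (S :\ y) * md e w (b |: S).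
  move=> yS; have := IH (S :\ y) b y.
  rewrite setD1K // (eq_sym (side b)) [md e w (b |: S :\ y) * _]mulrC; apply => //.
  - by rewrite (leq_trans (cardsD1_lt yS)) // -ltnS.
  - by rewrite setD11.
case: eqP => ab; rewrite md_setU2 // (md_setU1 _ aS).
  have -> : e a b = false by apply/negP => /e_side; rewrite ab eqxx.
  rewrite addr0 mulrDr mulrDl mulrCA mulrA lerD2l mulr_sumr mulr_suml.
  apply: ler_sum => y /andP[yS /e_side]; rewrite ab eq_sym => /negPf ay.
  by have := step _ yS; rewrite ay.
rewrite mulrDl !mulrDr [X in X + _ <= _]mulrAC [md e w S * (w a * _)]mulrCA.
rewrite [w a * _ * _]mulrAC mulrA lerD //.
  rewrite [w a * _ * _]mulrAC ler_wpDr //.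
  by case: ifP => _; rewrite ?mulr0 // mulr_ge0 ?md_ge0.
rewrite mulr_sumr mulr_suml; apply: ler_sum => y /andP[yS /e_side ay].
have := step _ yS; suff -> : side y == side b by [].
by move: ay ab; case: (side a); case: (side b); case: (side y).
Qed.

End MonomerDimerOrder.

(** * Capacity of the column weights *)

Section Capacity.
Variables (T : finType) (R : realType) (e : rel T) (side : pred T).
Hypothesis e_sym : symmetric e.
Hypothesis e_side : forall x y, e x y -> side x != side y.
Implicit Types (S A : {set T}) (w y : T -> R).

Definition raise w (h : R) A x := if x \in A then w x + h else w x.

Lemma raise_ge0 w h A : 0 <= h -> (forall x, 0 < w x) -> forall x, 0 < raise w h A x.
Proof. by move=> h0 w0 x; rewrite /raise; case: ifP; rewrite ?ltr_wpDr. Qed.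

Lemma md_raise1 w h S u : u \in S ->
  md e (raise w h [set u]) S = md e w S + h * md e w (S :\ u).
Proof.
move=> uS; rewrite !(md_rec e_sym _ uS) /raise set11 mulrDl.
have eqw A : u \notin A ->
    md e (fun x => if x \in [set u] then w x + h else w x) A = md e w A.
  move=> uA; apply: (eq_in_md e_sym) => x xA; rewrite inE.
  by case: eqP => // xu; rewrite -xu xA in uA.
rewrite eqw ?setD11 // addrAC; congr (_ + _ + _).
by apply: eq_bigr => y _; rewrite eqw // !inE eqxx andbF.
Qed.

Lemma md_setD2_le w S u t : (forall x, 0 < w x) -> side u -> side t -> u != t ->
  u \in S -> t \in S ->
  md e w (S :\ t :\ u) * md e w S <= md e w (S :\ t) * md e w (S :\ u).
Proof.
move=> w0 su st ut uS tS.
have := @md_log_modular _ _ e e_sym side e_side w (S :\ t :\ u) t u.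
rewrite su st eqxx setD1K ?inE ?ut // setD1K // (setD1C S t u).
rewrite setD1K ?inE 1?eq_sym ?ut // [md e w (S :\ u) * _]mulrC; apply.
- by move=> x; apply: ltW.
- by rewrite eqxx.
- by rewrite eqxx.
Qed.

(** In other terms, the ratio of [md e w (S :\ t)] to [md e w S] does not grow. For [t] distinct
    from [u] this is log-submodularity; for [t = u] the numerator does not see the raised weight. *)
Lemma md_raise1_ratio w h S u t : 0 <= h -> (forall x, 0 < w x) ->
  side u -> side t -> u \in S -> t \in S ->
  md e (raise w h [set u]) (S :\ t) * md e w S <=
  md e w (S :\ t) * md e (raise w h [set u]) S.
Proof.
move=> h0 w0 su st uS tS; rewrite (md_raise1 _ _ uS) mulrDr.
have mge A : 0 <= md e w A by apply: md_ge0 => // x; apply: ltW.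
have [<-|ut] := eqVneq u t.
  rewrite (_ : md e (raise _ _ _) _ = md e w (S :\ u)).
    by rewrite lerDl !mulr_ge0.
  apply: eq_in_md => // x; rewrite /raise !inE; by case: eqP.
rewrite md_raise1 ?inE ?ut // mulrDl lerD2l -mulrA [leRHS]mulrCA ler_wpM2l //.
exact: md_setD2_le.
Qed.

Lemma raiseU1 w h u A : u \notin A -> raise w h (u |: A) =1 raise (raise w h A) h [set u].
Proof.
by move=> uA x; rewrite /raise !inE; case: eqP => // ->; rewrite (negPf uA).
Qed.

(** The weights are raised one vertex at a time. By the first claim the ratio at the vertex raised
    last is at most its value for the original weights, so this step costs at most 1 + h r with the
    original ratio r, and 1 + h r <= exp(h r). The first claim is thus needed to carry the second
    through the induction. *)
Lemma md_raise w h A S : 0 <= h -> (forall x, 0 < w x) ->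
  A \subset S -> {in A, forall x, side x} ->
  (forall t, side t -> t \in S ->
     md e (raise w h A) (S :\ t) * md e w S <= md e w (S :\ t) * md e (raise w h A) S)
  /\ md e (raise w h A) S <=
     expR (h * ((\sum_(u in A) md e w (S :\ u)) / md e w S)) * md e w S.
Proof.
move=> h0 w0; elim/set_card_ind: A => [|A u uA IH] AS sA.
  have E V : md e (raise w h set0) V = md e w V.
    by apply: eq_in_md => // x _; rewrite /raise inE.
  by rewrite big_set0 mul0r mulr0 expR0 mul1r !E; split=> // t _ _; rewrite E.
have {}IH := IH _ (cardsD1_lt uA).
have [|x /setD1P[_ /sA]|C1 C2] // := IH; first by apply: subset_trans (subsetDl _ _) AS.
set w' := raise w h (A :\ u) in C1 C2 *.
have w'0 : forall x, 0 < w' x by apply: raise_ge0.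
have uS : u \in S by apply: (subsetP AS).
have E V : md e (raise w h A) V = md e (raise w' h [set u]) V.
  by apply: eq_in_md => // x _; rewrite -{1}(setD1K uA) raiseU1 ?setD11.
have p V : 0 < md e w V by apply: md_gt0.
have p' V : 0 < md e w' V by apply: md_gt0.
split=> [t st tS|].
  have D1 := C1 t st tS.
  have D2 := md_raise1_ratio h0 w'0 (sA _ uA) st uS tS.
  rewrite !E -(ler_pM2r (p' S)) mulrAC.
  apply: le_trans (_ : md e w' (S :\ t) * md e (raise w' h [set u]) S * md e w S <= _).
    by rewrite ler_wpM2r // ltW.
  rewrite mulrAC [X in _ <= X]mulrAC ler_wpM2r //.
  by apply: md_ge0 => // x; apply: ltW; apply: raise_ge0.
have D1 := C1 u (sA _ uA) uS.
rewrite E md_raise1 // (big_setD1 u) //= mulrDl mulrDr expRD.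
set r := md e w (S :\ u) / md e w S.
set F := expR (h * ((\sum_(_ in _) _) / _)) in C2 *.
apply: le_trans (_ : (1 + h * r) * md e w' S <= _).
  rewrite mulrDl mul1r lerD2l -mulrA ler_wpM2l // /r mulrAC ler_pdivlMr //.
rewrite -mulrA ler_pM ?expR_ge1Dx //; last exact: ltW.
by rewrite addr_ge0 // mulr_ge0 // divr_ge0 // ltW.
Qed.

Variables (D theta : R).
Hypotheses (D0 : 0 < D) (theta0 : 0 < theta).

(** Interpolates between the starting weights ([A] empty) and the final ones: columns in [A] have
    been treated, the others still have weight [theta]. The rows already use all [y v], and
    untreated columns have [y v = 1]. *)
Definition mixed_weight y A x :=
  if side x then (1 + \sum_(v | e x v) y v) / D
  else if x \in A then (y x)^-1 else theta.

Lemma mixed_weight_gt0 y A : (forall v, 1 <= y v) -> forall x, 0 < mixed_weight y A x.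
Proof.
move=> y1 x; rewrite /mixed_weight; case: ifP => _.
  rewrite divr_gt0 // ltr_wpDr // sumr_ge0 // => v _.
  exact: le_trans ler01 (y1 v).
by case: ifP => // _; rewrite invr_gt0 (lt_le_trans ltr01).
Qed.

(* Raising the row weights next to the column [v] by [h] multiplies the part
   with [v] free by at most [expR (h * rho)], where [rho] is the ratio of the
   parts with [v] matched and with [v] free, and does not increase [rho]. *)
Lemma md_column_step y A (q : R) v : 1 <= q -> D = q ^+ 2 ->
  ~~ side v -> v \notin A -> y v = 1 ->
  (forall x, 1 <= y x <= 1 + theta^-1) ->
  exists z, [/\ forall x, 1 <= z x <= 1 + theta^-1,
    forall x, x != v -> z x = y x &
    md e (mixed_weight z (v |: A)) setT <=
      expR (2 / q) * md e (mixed_weight y A) setT].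
Proof.
move=> q1 Dq sv vA yv yb.
have q0 : 0 < q := lt_le_trans ltr01 q1.
set w := mixed_weight y A.
have w0 : forall x, 0 < w x.
  by apply: mixed_weight_gt0 => x; case/andP: (yb x).
pose S := [set: T] :\ v; pose N := [set u | e v u].
have NS : N \subset S.
  apply/subsetP => u; rewrite !inE andbT => /e_side.
  by apply: contraTneq => ->; rewrite eqxx.
have sN : {in N, forall x, side x}.
  by move=> u; rewrite inE => /e_side; rewrite (negPf sv); case: (side u).
pose B := md e w S; pose Q := \sum_(u in N) md e w (S :\ u).
have B0 : 0 < B by apply: md_gt0.
have Q0 : 0 <= Q by apply: sumr_ge0 => u _; apply: md_ge0 => // x; apply: ltW.
pose rho := Q / B.
have rho0 : 0 <= rho by rewrite divr_ge0 // ltW.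
have QE : Q = rho * B by rewrite /rho divfK // gt_eqF.
(* The natural choice is h = 1 / (rho q): then D h = q / rho, since D = q^2. If rho is so small that
   this would push y beyond 1 + 1 / theta, h is capped at 1 / (D theta), and the new column weight
   is at most [theta] anyway. *)
have key : exists h, [/\ 0 <= h, D * h <= theta^-1, h * rho <= q^-1 &
    (1 + D * h)^-1 <= theta \/ (1 + D * h)^-1 <= rho / q].
  have [le|lt] := leP (rho * q) (D * theta).
    exists (D * theta)^-1; split.
    - by rewrite invr_ge0 mulr_ge0 // ltW.
    - by rewrite invfM mulrA divff ?mul1r // gt_eqF.
    - by rewrite mulrC ler_pdivrMr ?mulr_gt0 // mulrC ler_pdivlMr.
    - left; rewrite invfM mulrA divff ?gt_eqF // mul1r.
      rewrite -[leRHS]invrK lef_pV2 ?posrE ?invr_gt0 ?lerDr ?ltr01 //.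
      by rewrite addr_gt0 // invr_gt0.
  have rq : 0 < rho * q by apply: le_lt_trans lt; rewrite mulr_ge0 // ltW.
  have r0 : 0 < rho by rewrite -(pmulr_lgt0 _ q0).
  exists (rho * q)^-1; split.
  - by rewrite invr_ge0 ltW.
  - rewrite ler_pdivrMr // ler_pdivlMl // mulrC ltW //.
  - by rewrite invfM mulrC mulrA divff ?mul1r // gt_eqF.
  - right; have -> : rho / q = (D * (rho * q)^-1)^-1.
      by rewrite Dq; field; rewrite !gt_eqF.
    have : 0 < D / (rho * q) by rewrite divr_gt0.
    by move=> H; rewrite lef_pV2 ?posrE ?lerDr ?addr_gt0.
case: key => h [h0 hth hrho hg].
pose z x := if x == v then 1 + D * h else y x.
exists z; split.
- move=> x; rewrite /z; case: eqP => _ //.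
  by rewrite lerDl mulr_ge0 ?(ltW D0) //= lerD2l.
- by move=> x /negPf xv; rewrite /z xv.
have zE x : x != v -> mixed_weight z (v |: A) x = raise w h N x.
  move=> xv; rewrite /raise /w /mixed_weight !inE (negPf xv) /= e_sym /z (negPf xv).
  case: ifP => sx; last first.
    by rewrite (_ : e x v = false) //; apply/negP => /e_side; rewrite sx (negPf sv).
  case: ifP => exv; last first.
    congr ((1 + _) / D); apply: eq_bigr => u exu; case: eqP => // uv.
    by rewrite uv exv in exu.
  rewrite !(bigD1 v exv) /= eqxx yv.
  rewrite (eq_bigr y) => [|u /andP[_ /negPf->] //].
  by field; rewrite gt_eqF.
have zv : mixed_weight z (v |: A) v = (1 + D * h)^-1.
  by rewrite /mixed_weight (negPf sv) setU11 /z eqxx.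
have wv : w v = theta by rewrite /w /mixed_weight (negPf sv) (negPf vA).
have expand w1 : md e w1 setT = w1 v * md e w1 S + \sum_(u in N) md e w1 (S :\ u).
  rewrite (md_rec e_sym _ (in_setT v)); congr (_ + _); apply: eq_bigl => u.
  rewrite !inE andbT; case: eqP => // ->; symmetry; apply/negP => /e_side.
  by rewrite eqxx.
rewrite !expand zv wv -/B -/Q.
have E (V : {set T}) : V \subset S -> md e (mixed_weight z (v |: A)) V = md e (raise w h N) V.
  move=> /subsetP VS; apply: eq_in_md => // x /VS xS; apply: zE.
  by move: xS; rewrite !inE andbT.
rewrite E // [X in _ + X <= _](eq_bigr (fun u => md e (raise w h N) (S :\ u))); last first.
  by move=> u _; rewrite E // subsetDl.
have [C1 C2] := md_raise h0 w0 NS sN.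
set B' := md e (raise w h N) S in C1 C2 *; set Q' := \sum_(_ in _) _.
have eh : B' <= expR (q^-1) * B.
  by apply: le_trans C2 _; rewrite ler_pM2r // ler_expR.
have Q'le : Q' <= rho * B'.
  rewrite /rho mulrAC ler_pdivlMr // /Q' /Q !mulr_suml ler_sum // => u uN.
  by apply: C1; [apply: sN | apply: (subsetP NS)].
have Q'le2 : Q' <= expR q^-1 * Q.
  by apply: le_trans Q'le _; rewrite QE mulrCA ler_wpM2l.
have g0 : 0 < (1 + D * h)^-1.
  by rewrite invr_gt0 ltr_wpDr ?mulr_ge0 // ltW.
have le1 : (1 + D * h)^-1 * B' + Q' <= expR q^-1 * ((1 + D * h)^-1 * B + Q).
  by rewrite mulrDr lerD // mulrCA ler_pM2l.
have -> : 2 / q = q^-1 + q^-1 by field; rewrite gt_eqF.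
apply: le_trans le1 _; rewrite expRD -mulrA ler_pM2l ?expR_gt0 //.
(* One factor exp(1 / q) has been spent on raising the rows. In the capped case the column weight
   has not increased; otherwise the free part is at most Q / q, and 1 + 1 / q <= exp(1 / q) is the
   second factor. *)
case: hg => hg.
  apply: le_trans (_ : theta * B + Q <= _); first by rewrite lerD2r ler_pM2r.
  rewrite ler_peMl // ?addr_ge0 ?mulr_ge0 ?(ltW theta0) ?(ltW B0) //.
  by rewrite -expR0 ler_expR invr_ge0 ltW.
apply: le_trans (_ : rho / q * B + Q <= _); first by rewrite lerD2r ler_pM2r.
have -> : rho / q * B + Q = (1 + q^-1) * Q by rewrite QE; ring.
apply: le_trans (_ : expR q^-1 * Q <= _); first by rewrite ler_wpM2r ?expR_ge1Dx.
by rewrite ler_pM2l ?expR_gt0 // lerDr mulr_ge0 // ltW.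
Qed.

Lemma md_capacity (q : R) A : 1 <= q -> D = q ^+ 2 ->
  {in A, forall x, ~~ side x} ->
  exists y, [/\ forall x, 1 <= y x <= 1 + theta^-1,
    forall x, x \notin A -> y x = 1 &
    md e (mixed_weight y A) setT <=
      expR (2 / q) ^+ #|A| * md e (mixed_weight (fun=> 1) set0) setT].
Proof.
move=> q1 Dq; elim/set_card_ind: A => [_|A v vA IH sA].
  exists (fun=> 1); split => // [_|]; first by rewrite lexx lerDl invr_ge0 ltW.
  by rewrite cards0 expr0 mul1r.
have [|y [yb y1 yle]] := IH _ (cardsD1_lt vA).
  by move=> x /setD1P[_ /sA].
have [z [zb zy zle]] := md_column_step q1 Dq (sA _ vA) (negbT (setD11 v A))
  (y1 _ (negbT (setD11 v A))) yb.
exists z; split => // [x xA|].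
  have xv : x != v by apply: contraNneq xA => ->.
  by rewrite zy // y1 // inE (negPf xA) andbF.
rewrite setD1K // in zle; apply: le_trans zle _.
by rewrite (cardsD1 v A) vA exprS -mulrA ler_pM2l ?expR_gt0.
Qed.

End Capacity.

(** * Perfect matchings and the permanent *)

Section PerfectMatchings.
Variables (T : finType) (R : realDomainType) (e : rel T) (side : pred T).
Hypothesis e_sym : symmetric e.
Hypothesis e_side : forall x y, e x y -> side x != side y.
Implicit Types (S A : {set T}) (w f : T -> R).

(** Each expanded vertex is either free, with weight at most [a], or matched in at most [N] ways. *)
Lemma md_le_exp w S (a : R) N : 1 <= a -> (forall x, 0 <= w x <= a) ->
  (#|S| <= N)%N -> md e w S <= (a + N%:R) ^+ #|S|.
Proof.
move=> a1 wb; have aN : 1 <= a + N%:R by rewrite ler_wpDr.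
have w0 x : 0 <= w x by case/andP: (wb x).
elim/set_card_ind: S => [|S x xS IH] SN; first by rewrite md0 cards0 expr0.
have c1 := cardsD1 x S; rewrite xS add1n in c1.
rewrite (md_rec e_sym _ xS) c1 exprS mulrDl; apply: lerD.
  apply: ler_pM => //; [exact: md_ge0|by case/andP: (wb x)|].
  by apply: IH; rewrite ?c1 // (leq_trans _ SN) // c1.
have le1 y : y \in S :\ x -> md e w (S :\ x :\ y) <= (a + N%:R) ^+ #|S :\ x|.
  move=> yS; apply: le_trans (IH _ _ _) _; first exact: cardsD2_lt.
    by apply: leq_trans SN; apply: ltnW; apply: cardsD2_lt.
  by rewrite ler_weXn2l // ltnW // cardsD1_lt.
apply: le_trans (_ : \sum_(y in S :\ x) (a + N%:R) ^+ #|S :\ x| <= _).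
  rewrite big_mkcondr /=; apply: ler_sum => y yS; case: ifP => _; first exact: le1.
  by rewrite exprn_ge0 // (le_trans ler01).
rewrite sumr_const -[_ *+ #|_|]mulr_natl ler_wpM2r ?exprn_ge0 ?(le_trans ler01) // ler_nat.
by apply: leq_trans SN; rewrite c1.
Qed.

Definition side_weight f (a : R) x := if side x then f x else a.

(** The sum is a polynomial in [a] with nonnegative coefficients: its constant term is the value at
    0, and for a <= 1 the other terms are at most a times their value at 1. This separates the
    matchings covering all columns from the rest. *)
Lemma md_side_weight f a S : (forall x, 0 <= f x) -> 0 <= a <= 1 ->
  md e (side_weight f a) S <=
  md e (side_weight f 0) S + a * md e (side_weight f 1) S.
Proof.
move=> f0 /andP[a0 a1].
have w0 b : 0 <= b -> forall x, 0 <= side_weight f b x.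
  by move=> b0 x; rewrite /side_weight; case: ifP.
elim/set_card_ind: S => [|S x0 x0S IH]; first by rewrite !md0 mulr1 lerDl.
have [v /andP[vS sv]|no] := pickP [pred v | (v \in S) && ~~ side v]; last first.
  rewrite (@eq_in_md _ _ _ e_sym _ (side_weight f 0)) => [|x xS].
    by rewrite lerDl mulr_ge0 // md_ge0 //; apply: w0.
  by have := no x; rewrite /= xS /side_weight => /negbFE ->.
rewrite !(md_rec e_sym _ vS) /side_weight (negPf sv) -!/(side_weight _ _).
rewrite mul0r add0r mul1r mulrDr addrCA lerD //.
  by rewrite ler_wpM2l // md_le //; [apply: w0|move=> x; rewrite /side_weight; case: ifP].
rewrite mulr_sumr -big_split ler_sum // => y _; exact/IH/cardsD2_lt.
Qed.

Lemma card_sideD1 (s : bool) S x : x \in S -> 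
  #|[set y in S | side y == s]| = ((side x == s) + #|[set y in S :\ x | side y == s]|)%N.
Proof.
move=> xS; rewrite (cardsD1 x) !inE xS /=; congr (_ + #|pred_of_set _|)%N.
by apply/setP => z; rewrite !inE andbA.
Qed.

(** With column weights 0 every column must be matched. If there are no more rows than columns, this
    uses up all rows, so row weights never enter; with strictly fewer rows it is impossible, which
    is [zero]. *)
Lemma md_perfect f S :
  (#|[set y in S | side y == true]| <= #|[set y in S | side y == false]|)%N ->
  md e (side_weight f 0) S = md e (fun=> 0) S.
Proof.
have zero S' : (#|[set y in S' | side y == true]| < #|[set y in S' | side y == false]|)%N ->
    md e (side_weight f 0) S' = 0.
  elim/set_card_ind: S' => [|S' x _ IH] lt.
    by move: lt; rewrite [X in (_ < X)%N]eq_card0 // => y; rewrite !inE.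
  have /set0Pn[v /[!inE] /andP[vS /eqP sv]] : [set y in S' | side y == false] != set0.
    by rewrite -card_gt0 (leq_trans _ lt).
  rewrite (md_rec e_sym _ vS) /side_weight sv mul0r add0r big1 // => u /andP[uS evu].
  apply: IH; first exact: cardsD2_lt.
  have := lt; rewrite !(card_sideD1 _ vS) !(card_sideD1 _ uS) sv.
  by have := e_side evu; rewrite sv; case: (side u).
elim/set_card_ind: S => [|S x _ IH] le; first by rewrite !md0.
have [S0|[v /andP[vS sv]]] : S = set0 \/ exists v, (v \in S) && (side v == false).
- have [v vP|no] := pickP [pred v | (v \in S) && (side v == false)].
    by right; exists v.
  left; have c0 : #|[set y in S | side y == false]| = 0%N.
    by apply: eq_card0 => v; rewrite inE; apply: no.
  apply/setP => z; rewrite inE; apply/negP => zS; move: le; rewrite c0 leqn0 cards_eq0.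
  move=> /eqP/setP/(_ z); have := no z; rewrite /= !inE zS /=.
  by case: (side z).
- by rewrite S0 !md0.
move/eqP in sv; rewrite !(md_rec e_sym _ vS) /side_weight sv !mul0r; congr (_ + _).
apply: eq_bigr => u /andP[uS evu]; apply: IH; first exact: cardsD2_lt.
have := le; rewrite !(card_sideD1 _ vS) !(card_sideD1 _ uS) sv.
by have := e_side evu; rewrite sv; case: (side u).
Qed.

End PerfectMatchings.

(** * The input graph on 2n numbered vertices and its permanent *)

Section Bigraph.
Variables (n : nat) (G : bigraph n).

(* The vertices 0, ..., n - 1 are the rows and n, ..., 2n - 1 the columns. *)
Definition gside (x : 'I_(n + n)) : bool := (x < n)%N.

Definition gedge (x y : 'I_(n + n)) : bool :=
  match split x, split y with
  | inl i, inr j | inr j, inl i => G (inl i) (inr j)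
  | _, _ => false
  end.

Lemma gedge_sym : symmetric gedge.
Proof. by move=> x y; rewrite /gedge; case: (split x); case: (split y). Qed.

Lemma split_lshift (i : 'I_n) : split (lshift n i) = inl i.
Proof. exact: (unsplitK (inl i : 'I_n + 'I_n)). Qed.

Lemma split_rshift (i : 'I_n) : split (rshift n i) = inr i.
Proof. exact: (unsplitK (inr i : 'I_n + 'I_n)). Qed.

Lemma gside_lshift (i : 'I_n) : gside (lshift n i) = true.
Proof. by rewrite /gside /= ltn_ord. Qed.

Lemma gside_rshift (i : 'I_n) : gside (rshift n i) = false.
Proof. by rewrite /gside /= ltnNge leq_addr. Qed.

Lemma gedge_side x y : gedge x y -> gside x != gside y.
Proof.
rewrite /gedge -(splitK x) -(splitK y); case: (split x) => i; case: (split y) => j /=;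
  by rewrite ?split_lshift ?split_rshift ?gside_lshift ?gside_rshift.
Qed.

Variable R : realDomainType.

(** What remains when the rows 0, 1, ..., [size c - 1] have been matched, in this order, to the
    columns listed in [c]. *)
Definition unused (c : seq 'I_n) : {set 'I_(n + n)} :=
  [set x | match split x with inl i => (size c <= i)%N | inr j => j \notin c end].

(** Expansion of the permanent along the next row against expansion of the matching sum at that row:
    the permutations extending [c] are partitioned by the column [j] given to row [size c], and each
    class is the statement for [rcons c j]. *)
Lemma md_unused (c : seq 'I_n) : uniq c -> (size c <= n)%N ->
  \sum_(s : 'S_n | [forall i : 'I_n, (i < size c)%N ==> (s i == nth (s i) c i)])
     \prod_(i < n | (size c <= i)%N) (biadjacency G i (s i))%:R
  = md gedge (fun=> 0) (unused c) :> R.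
Proof.
move Ek : (n - size c)%N => k; elim: k c Ek => [|k IH] c Ek uc cn.
  have {}cn : size c = n by apply/eqP; rewrite eqn_leq cn -subn_eq0 Ek.
  have inj : injective (fun i : 'I_n => nth i c i).
    move=> i j; rewrite (set_nth_default i j) ?cn // => /eqP.
    by rewrite nth_uniq ?cn // => /eqP/val_inj.
  have -> : unused c = set0.
    apply/setP => x; rewrite !inE; case: (split x) => i.
      by rewrite cn leqNgt ltn_ord.
    have := uniq_min_size uc (s2 := enum 'I_n); rewrite cn size_enum_ord leqnn.
    by case=> // [j _|_ /(_ i)]; rewrite ?mem_enum // => ->.
  rewrite md0 (bigD1 (perm inj)) /=; last first.
    by apply/forallP => i; apply/implyP => ic; rewrite permE; apply/eqP/set_nth_default.
  rewrite [X in _ + X]big1 => [|s /andP[/forallP sP]].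
    by rewrite addr0 big1 // => i; rewrite cn leqNgt ltn_ord.
  case/eqP; apply/permP => i; rewrite permE; have := sP i; rewrite cn ltn_ord.
  by move=> /eqP->; apply: set_nth_default; rewrite cn.
have cn' : (size c < n)%N by lia.
pose x0 := Ordinal cn'.
have xU : lshift n x0 \in unused c by rewrite inE split_lshift.
rewrite (md_rec gedge_sym _ xU) mul0r add0r.
pose P s := [forall i : 'I_n, (i < size c)%N ==> (s i == nth (s i) c i)].
have notc (s : 'S_n) : P s -> s x0 \notin c.
  move=> /forallP sP; apply/negP => /(nthP x0)[i ic E].
  have iN := ltn_trans ic cn'.
  have := sP (Ordinal iN); rewrite /= ic => /eqP.
  rewrite (set_nth_default x0) // E => /perm_inj/(congr1 val) /= Ei.
  by rewrite -Ei ltnn in ic.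
rewrite (partition_big (fun s : 'S_n => s x0) (fun j => j \notin c)) //=.
transitivity (\sum_(j | j \notin c) (biadjacency G x0 j)%:R *
   md gedge (fun=> 0 : R) (unused (rcons c j))).
  apply: eq_bigr => j jc; rewrite -IH ?size_rcons ?rcons_uniq ?jc //; last by lia.
  rewrite mulr_sumr; apply: eq_big => s.
    rewrite -/(P s); apply/andP/forallP => [[/forallP sP /eqP sj] i|sP].
      rewrite ltnS leq_eqVlt nth_rcons; apply/implyP => /predU1P[ic|ic].
        by rewrite ic ltnn eqxx -sj; apply/eqP; congr (s _); apply: val_inj.
      by rewrite ic; have := sP i; rewrite ic.
    split; last by have := sP x0; rewrite /= ltnS leqnn nth_rcons ltnn eqxx.
    apply/forallP => i; apply/implyP => ic; have := sP i.
    by rewrite ltnS (ltnW ic) nth_rcons ic.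
  case/andP => _ /eqP sj; rewrite (bigD1 x0) //= sj; congr (_ * _).
  by apply: eq_bigl => i; rewrite ltn_neqAle andbC eq_sym.
rewrite big_mkcond [RHS]big_split_ord /= [X in _ = X + _]big1 ?add0r; last first.
  by move=> i /andP[_]; rewrite /gedge !split_lshift.
rewrite [RHS]big_mkcond; apply: eq_bigr => j _.
have -> : rshift n j \in unused c :\ lshift n x0 = (j \notin c).
  by rewrite !inE split_rshift eq_rlshift.
rewrite /gedge split_lshift split_rshift mxE; case: (j \notin c) => //=.
case: (G _ _) => /=; last by rewrite mul0r.
rewrite mul1r; congr md; apply/setP => x; rewrite !inE -(splitK x).
case: (split x) => i /=; rewrite ?split_lshift ?split_rshift ?eq_lrshift ?eq_rlshift /=.
  by rewrite eq_lshift size_rcons ltn_neqAle eq_sym.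
by rewrite eq_rshift mem_rcons inE negb_or.
Qed.

Lemma md_Perm : md gedge (fun=> 0) [set: 'I_(n + n)] = (Perm G)%:R :> R.
Proof.
have -> : [set: 'I_(n + n)] = unused [::].
  by apply/setP => x; rewrite !inE; case: (split x).
rewrite -md_unused // /Perm /permanent natr_sum; apply: eq_big => [s|s _].
  by apply/forallP.
by rewrite natr_prod.
Qed.

End Bigraph.

(** * Posynomials *)

Section Posynomials.
Variables (T : finType) (R : realType).
Implicit Types (F : (T -> R) -> R) (t : T -> R) (m : R * (T -> R)).

Definition monomial m t : R := m.1 * expR (\sum_v m.2 v * t v).

(** The variables are logarithms of the usual ones. The bound [d] on the exponents controls second
    derivatives along coordinate directions. *)
Definition posynomial (d : R) F :=
  exists2 s : seq (R * (T -> R)),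
    (forall m, List.In m s -> 0 <= m.1 /\ forall v, `|m.2 v| <= d) &
    forall t, F t = \sum_(m <- s) monomial m t.

Lemma posynomial_le d d' F : d <= d' -> posynomial d F -> posynomial d' F.
Proof.
move=> dd [s sP FE]; exists s => // m /sP[m0 md]; split=> // v.
exact: le_trans (md v) dd.
Qed.

Lemma eq_posynomial d F F' : F =1 F' -> posynomial d F -> posynomial d F'.
Proof. by move=> FF [s sP FE]; exists s => // t; rewrite -FF. Qed.

Lemma posynomialD d F F' : posynomial d F -> posynomial d F' ->
  posynomial d (fun t => F t + F' t).
Proof.
move=> [s sP FE] [s' sP' FE']; exists (s ++ s') => [m|t]; last first.
  by rewrite FE FE' big_cat.
by move=> /List.in_app_iff[/sP|/sP'].
Qed.

Lemma posynomial_const (c : R) : 0 <= c -> posynomial 0 (fun=> c).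
Proof.
move=> c0; exists [:: (c, fun=> 0)] => [m [<-|//]|t].
  by split=> // v; rewrite normr0.
by rewrite big_seq1 /monomial big1 ?expR0 ?mulr1 // => v _; rewrite mul0r.
Qed.

Lemma posynomial_exp v (b : R) : `|b| <= 1 -> posynomial 1 (fun t => expR (b * t v)).
Proof.
move=> b1; exists [:: (1, fun u => if u == v then b else 0)] => [m [<-|//]|t].
  by split=> // u /=; case: ifP => //; rewrite normr0.
rewrite big_seq1 /monomial /= mul1r (bigD1 v) //= eqxx big1 ?addr0 // => u /negPf->.
by rewrite mul0r.
Qed.

Lemma posynomial_sum d (I : finType) (P : pred I) (F : I -> (T -> R) -> R) :
  0 <= d -> (forall i, P i -> posynomial d (F i)) ->
  posynomial d (fun t => \sum_(i | P i) F i t).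
Proof.
move=> d0 FP; apply: (@eq_posynomial _ (fun t =>
    (\big[(fun f g t => f t + g t)/fun=> 0]_(i | P i) F i) t)) => [t|].
  by elim/big_rec2: _ => // i f y _ ->.
elim/big_ind: _ => // [|f g]; last exact: posynomialD.
exact: posynomial_le d0 (posynomial_const _).
Qed.

Lemma posynomialM d d' F F' : posynomial d F -> posynomial d' F' ->
  posynomial (d + d') (fun t => F t * F' t).
Proof.
move=> [s sP FE] [s' sP' FE'].
pose mulm m m' := (m.1 * m'.1, fun v => m.2 v + m'.2 v).
exists (flatten [seq [seq mulm m m' | m' <- s'] | m <- s]) => [m|t].
  elim: s {FE} sP => //= m0 s IH sP /List.in_app_iff[|/IH]; last first.
    by apply=> m1 ?; apply: sP; right.
  move=> /List.in_map_iff[m1 [<- /sP' [c1 d1]]].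
  have [|c0 d0] := sP m0; first by left.
  split=> [|v] /=; first exact: mulr_ge0.
  by apply: le_trans (ler_normD _ _) _; apply: lerD.
rewrite FE FE' big_flatten big_map mulr_suml; apply: eq_bigr => m _.
rewrite mulr_sumr big_map; apply: eq_bigr => m' _.
rewrite /monomial /= mulrACA -expRD -big_split; congr (_ * expR _).
by apply: eq_bigr => v _; rewrite mulrDl.
Qed.

Lemma posynomial_md (e : rel T) (w : (T -> R) -> T -> R) (S : {set T}) :
  symmetric e -> (forall x, posynomial 1 (w^~ x)) ->
  posynomial #|S|%:R (fun t => md e (w t) S).
Proof.
move=> e_sym wP; elim/set_card_ind: S => [|S x xS IH].
  rewrite cards0; apply: eq_posynomial (posynomial_const ler01) => t.
  by rewrite md0.
apply: (@eq_posynomial _ (fun t => w t x * md e (w t) (S :\ x) +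
    \sum_(y in S :\ x | e x y) md e (w t) (S :\ x :\ y))) => [t|].
  by rewrite (md_rec e_sym _ xS).
apply: posynomialD.
  rewrite (cardsD1 x S) xS natrD; apply: posynomialM; first exact: wP.
  exact/IH/cardsD1_lt.
apply: posynomial_sum => [|y _]; first by rewrite ler0n.
by apply: posynomial_le (IH _ (cardsD2_lt _ xS)); rewrite ler_nat ltnW ?cardsD2_lt.
Qed.

Definition shift t v (h : R) u := if u == v then t u + h else t u.

(** Multiply by 1 - x and use 1 - x <= exp(- x). *)
Lemma expR_le1Dx2 (x : R) : x <= 1 / 2 -> expR x <= 1 + x + 2 * x ^+ 2.
Proof.
move=> x2; rewrite -(ler_pM2r (_ : 0 < 1 - x)); last lra.
have -> : (1 + x + 2 * x ^+ 2) * (1 - x) = 1 + x ^+ 2 * (1 - 2 * x) by ring.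
apply: le_trans (_ : expR x * expR (- x) <= _).
  by rewrite ler_wpM2l ?expR_ge0 ?expR_ge1Dx.
by rewrite expRxMexpNx_1 lerDl mulr_ge0 ?sqr_ge0 //; lra.
Qed.

Lemma monomial_shift m t v h : m.1 >= 0 -> m.2 v * h <= 1 / 2 ->
  monomial m (shift t v h) <=
  monomial m t * (1 + m.2 v * h + 2 * (m.2 v * h) ^+ 2).
Proof.
move=> m0 mh; rewrite /monomial -mulrA ler_wpM2l //.
have -> : \sum_u m.2 u * shift t v h u = \sum_u m.2 u * t u + m.2 v * h.
  rewrite (bigD1 v) //= [in RHS](bigD1 v) //= /shift eqxx mulrDr addrAC; congr (_ + _ + _).
  by apply: eq_bigr => u /negPf->.
by rewrite expRD ler_wpM2l ?expR_ge0 // expR_le1Dx2.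
Qed.

Lemma monomial_tangent m t t' : m.1 >= 0 ->
  monomial m t * (1 + \sum_v m.2 v * (t' v - t v)) <= monomial m t'.
Proof.
move=> m0; rewrite /monomial -mulrA ler_wpM2l //.
have -> : \sum_v m.2 v * t' v = \sum_v m.2 v * t v + \sum_v m.2 v * (t' v - t v).
  by rewrite -big_split; apply: eq_bigr => v _ /=; ring.
by rewrite expRD ler_wpM2l ?expR_ge0 ?expR_ge1Dx.
Qed.

(** By convexity [F t'] lies above the tangent at [t], so only the slopes towards [t'] matter. A
    step [delta] towards [t'] in coordinate [v] lowers [F] by at most the factor 1 - eta, and the
    second-order error of the step is at most 2 (delta d)^2 F; dividing by [delta] bounds the
    descent rate in that coordinate. At most [#|C|] coordinates move, each by at most [L]. *)
Lemma posynomial_local_min d F t t' (C : {set T}) (delta eta L : R) :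
  posynomial d F -> 0 <= d -> 0 <= eta -> 0 < delta -> d * delta <= 1 / 2 ->
  (forall v, v \notin C -> t' v = t v) ->
  (forall v, `|t' v - t v| <= L) ->
  (forall v, t v < t' v -> (1 - eta) * F t <= F (shift t v delta)) ->
  (forall v, t' v < t v -> (1 - eta) * F t <= F (shift t v (- delta))) ->
  F t * (1 - #|C|%:R * L * (eta / delta + 2 * delta * d ^+ 2)) <= F t'.
Proof.
move=> [s sP FE] d0 eta0 delta0 dd tC tL up down.
(* the gradient of F in the logarithmic coordinates *)
pose g v := \sum_(m <- s) monomial m t * m.2 v.
have sum_le (f1 f2 : R * (T -> R) -> R) :
    (forall m, 0 <= m.1 -> (forall v, `|m.2 v| <= d) -> f1 m <= f2 m) ->
    \sum_(m <- s) f1 m <= \sum_(m <- s) f2 m.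
  move=> H; elim: s sP {FE g} => [|m s' IH] sP'; first by rewrite !big_nil.
  rewrite !big_cons lerD //; last by apply: IH => m' ?; apply: sP'; right.
  by have [|m0 md] := sP' m; [left|apply: H].
have tangent : F t + \sum_v g v * (t' v - t v) <= F t'.
  rewrite !FE; under [X in _ + X]eq_bigr do rewrite mulr_suml.
  rewrite exchange_big -big_split /=; apply: sum_le => m m0 _.
  apply: le_trans (monomial_tangent _ _ m0).
  rewrite mulrDr mulr1 mulr_sumr le_eqVlt; apply/predU1P; left; congr (_ + _).
  by apply: eq_bigr => v _; rewrite mulrA.
have F0 : 0 <= F t.
  apply: le_trans (_ : \sum_(m <- s) 0 <= _); first by rewrite big1.
  by rewrite FE; apply: sum_le => m m0 _; rewrite mulr_ge0 ?expR_ge0.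
have slope v h : `|h| = delta ->
    F (shift t v h) <= F t + h * g v + 2 * (delta * d) ^+ 2 * F t.
  move=> hd; rewrite !FE /g !mulr_sumr -!big_split /=; apply: sum_le => m m0 md.
  have le : m.2 v * h <= 1 / 2.
    apply: le_trans (ler_norm _) _; rewrite normrM hd.
    by apply: le_trans dd; rewrite ler_wpM2r ?md // ltW.
  apply: le_trans (monomial_shift _ _ le) _ => //.
  have -> : 1 + m.2 v * h + 2 * (m.2 v * h) ^+ 2 =
     1 + m.2 v * h + 2 * (`|m.2 v| * delta) ^+ 2.
    by rewrite -hd -normrM real_normK ?num_real.
  rewrite !mulrDr mulr1 [h * (_ * _)]mulrCA [m.2 v * h]mulrC lerD2l mulrC ler_wpM2r //.
    by rewrite mulr_ge0 ?expR_ge0.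
  rewrite ler_pM2l // lerXn2r ?nnegrE ?mulr_ge0 ?(ltW delta0) //.
  by rewrite mulrC ler_wpM2l // ltW.
set K := eta / delta + _.
(* Only one sign of the derivative is bounded, depending on the side on which [t' v] lies; a steep
   slope in the other direction would only raise [F t']. *)
have step v : - (L * K * F t) <= g v * (t' v - t v).
  have dK : delta * K = eta + 2 * (delta * d) ^+ 2.
    by rewrite /K; field; rewrite gt_eqF.
  have K0 : 0 <= K by rewrite addr_ge0 ?divr_ge0 ?mulr_ge0 ?exprn_ge0 // ltW.
  have KF : 0 <= K * F t by rewrite mulr_ge0.
  have L0 : 0 <= L := le_trans (normr_ge0 _) (tL v).
  have := tL v; rewrite ler_norml => /andP[Ll Lu].
  have [lt|gt|->] := ltgtP (t v) (t' v); last first.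
  - by rewrite subrr mulr0 oppr_le0 -mulrA mulr_ge0.
  - have := le_trans (down v gt) (slope v (- delta) _).
    rewrite normrN gtr0_norm // => /(_ erefl) le.
    have gK : g v <= K * F t.
      by rewrite -(ler_pM2l delta0) [leRHS]mulrA dK; lra.
    apply: le_trans (_ : K * F t * (t' v - t v) <= _).
      by rewrite -mulrA [L * _]mulrC -mulrN ler_wpM2l.
    by rewrite ler_wnM2r // subr_le0 ltW.
  - have := le_trans (up v lt) (slope v delta _).
    rewrite gtr0_norm // => /(_ erefl) le.
    have gK : - (K * F t) <= g v.
      by rewrite -(ler_pM2l delta0) mulrN [in leLHS]mulrA dK; lra.
    apply: le_trans (_ : - (K * F t) * (t' v - t v) <= _).
      by rewrite mulNr lerN2 -mulrA [L * _]mulrC ler_wpM2l.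
    by rewrite ler_wpM2r // subr_ge0 ltW.
apply: le_trans tangent; rewrite mulrBr mulr1 lerD2l.
rewrite (bigID (fun v => v \in C)) /= [X in _ + X]big1 => [|v vC]; last first.
  by rewrite tC // subrr mulr0.
rewrite addr0; apply: le_trans (_ : \sum_(v in C) - (L * K * F t) <= _); last first.
  by apply: ler_sum => v _; apply: step.
by rewrite sumr_const mulNrn lerN2 -mulr_natl le_eqVlt; apply/predU1P; left; ring.
Qed.

End Posynomials.

(** * Truncated trees *)

Section Tree.
Variables (R : realFieldType).
Implicit Types x a b c : R.

Definition near x a b := a <= (1 + x) * b /\ b <= (1 + x) * a.

Lemma near_le x x' a b : 0 <= a -> 0 <= b -> x <= x' -> near x a b -> near x' a b.
Proof.
by move=> a0 b0 xx [ab ba]; split; [apply: le_trans ab _|apply: le_trans ba _];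
  rewrite ler_wpM2r // lerD2l.
Qed.

Lemma nearV x a b : 0 < a -> 0 < b -> near x a b -> near x a^-1 b^-1.
Proof. by move=> a0 b0 [ab ba]; split; rewrite ler_pdivlMr // mulrC ler_pdivrMr. Qed.

Lemma near_sum (I : finType) (P : pred I) (F F' : I -> R) x :
  (forall i, P i -> near x (F i) (F' i)) ->
  near x (\sum_(i | P i) F i) (\sum_(i | P i) F' i).
Proof.
by move=> H; split; rewrite mulr_sumr; apply: ler_sum => i /H[].
Qed.

Lemma near_prod (s : seq nat) (F F' : nat -> R) x : 0 <= x ->
  (forall i, i \in s -> [/\ 0 <= F i, 0 <= F' i & near x (F i) (F' i)]) ->
  \prod_(i <- s) F i <= (1 + x) ^+ size s * \prod_(i <- s) F' i /\
  \prod_(i <- s) F' i <= (1 + x) ^+ size s * \prod_(i <- s) F i.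
Proof.
move=> x0; have x1 : 0 <= 1 + x by rewrite addr_ge0.
elim: s => [|i s IH] H; first by rewrite !big_nil mul1r.
have [|l1 l2] := IH; first by move=> j js; apply: H; rewrite inE js orbT.
have [p p' [n1 n2]] := H i (mem_head _ _).
have pr0 G : (forall j, j \in s -> 0 <= G j) -> 0 <= \prod_(j <- s) G j.
  by move=> G0; rewrite big_seq prodr_ge0.
have [q q'] : 0 <= \prod_(j <- s) F j /\ 0 <= \prod_(j <- s) F' j.
  by split; apply: pr0 => j js; have [] := H j; rewrite ?inE ?js ?orbT.
by rewrite !big_cons /= exprS; split; rewrite [leRHS]mulrACA; apply: ler_pM.
Qed.

(** The term [w] is exact and makes up at least the fraction 1 / (D + 1) of the total, so it dilutes
    the error of the other term. *)
Lemma near_row x w a b D : 0 < w -> 0 < D -> 0 <= a <= D * w -> 0 <= b <= D * w ->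
  0 <= x -> near x a b -> near (x * (D / (D + 1))) (w + a) (w + b).
Proof.
move=> w0 D0 /andP[a0 aD] /andP[b0 bD] x0 [ab ba].
have key c : 0 <= c -> c <= D * w -> w + (1 + x) * c <= (1 + x * (D / (D + 1))) * (w + c).
  move=> c0 cD; rewrite -subr_ge0.
  have -> : (1 + x * (D / (D + 1))) * (w + c) - (w + (1 + x) * c)
      = x * (D * w - c) / (D + 1) by field; rewrite gt_eqF // ltr_wpDr.
  by rewrite divr_ge0 ?mulr_ge0 ?subr_ge0 // addr_ge0 ?ltW.
by split; [apply: le_trans (key _ b0 bD)|apply: le_trans (key _ a0 aD)]; rewrite lerD2l.
Qed.

Lemma near_col x w a b : 0 <= w -> 0 <= x -> near x a b -> near x (w + a) (w + b).
Proof.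
move=> w0 x0 [ab ba]; split; rewrite mulrDr lerD // ler_peMl // lerDl //.
Qed.

Variables (T : finType) (e : rel T) (side : pred T) (w : T -> R).
Hypothesis e_sym : symmetric e.
Hypothesis e_side : forall u v, e u v -> side u != side v.
Hypothesis w0 : forall u, 0 < w u.
Implicit Type S : {set T}.

Definition rho (S : {set T}) (u : T) := md e w (S :\ u) / md e w S.

Fixpoint tree h (S : {set T}) (u : T) : R :=
  (w u + if h is h'.+1 then \sum_(v in S :\ u | e u v) tree h' (S :\ u) v else 0)^-1.

Let mdp S : 0 < md e w S. Proof. exact: md_gt0. Qed.

Lemma rho_gt0 S u : 0 < rho S u. Proof. exact: divr_gt0. Qed.

Lemma rhoE S u : u \in S ->
  rho S u = (w u + \sum_(v in S :\ u | e u v) rho (S :\ u) v)^-1.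
Proof.
move=> uS; rewrite /rho -mulr_suml (md_rec e_sym _ uS) -[RHS]mulr1.
rewrite -[X in _ = _ * X](divff (lt0r_neq0 (mdp (S :\ u)))) mulrCA -invfM mulrDl.
by rewrite divfK ?gt_eqF // mulrDl.
Qed.

Lemma tree_gt0 h S u : 0 < tree h S u.
Proof.
elim: h S u => [|h IH] S u /=; first by rewrite addr0 invr_gt0.
by rewrite invr_gt0 ltr_wpDr // sumr_ge0 // => v _; apply: ltW.
Qed.

Lemma tree_le h S u : tree h S u <= (w u)^-1.
Proof.
case: h => [|h] /=; first by rewrite addr0.
have s0 : 0 <= \sum_(v in S :\ u | e u v) tree h (S :\ u) v.
  by apply: sumr_ge0 => v _; apply/ltW/tree_gt0.
by rewrite lef_pV2 ?posrE ?lerDl // ltr_wpDr.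
Qed.

Lemma rho_le S u : u \in S -> rho S u <= (w u)^-1.
Proof.
move=> uS; rewrite rhoE //.
have s0 : 0 <= \sum_(v in S :\ u | e u v) rho (S :\ u) v.
  by apply: sumr_ge0 => v _; apply/ltW/rho_gt0.
by rewrite lef_pV2 ?posrE ?lerDl // ltr_wpDr.
Qed.

Variable D : R.
Hypothesis D1 : 1 <= D.
Hypothesis w_row : forall u, side u -> \sum_(v | e u v) (w v)^-1 <= D * w u.

(** The base value is the error of dropping all children at once. Sides alternate along a path, and
    only row levels contract. *)
Fixpoint tree_err h (s : bool) : R :=
  if h is h'.+1 then tree_err h' (~~ s) * (if s then D / (D + 1) else 1)
  else #|T|%:R * D.

Let D0 : 0 < D. Proof. exact: lt_le_trans ltr01 D1. Qed.

Lemma tree_err_ge0 h s : 0 <= tree_err h s.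
Proof.
elim: h s => [|h IH] s /=; first by rewrite mulr_ge0 // ltW.
by rewrite mulr_ge0 //; case: s; rewrite // divr_ge0 ?addr_ge0 // ltW.
Qed.

Lemma tree_err_double m s : tree_err m.*2 s = #|T|%:R * D * (D / (D + 1)) ^+ m.
Proof.
elim: m => [|m IH]; first by rewrite expr0 mulr1.
by rewrite doubleS /= negbK IH exprSr; case: (s); rewrite !mulrA ?mulr1 // mul1r mulr1.
Qed.

Lemma sum_neighbours_le u S (F : T -> R) : side u ->
  (forall v, v \in S -> 0 <= F v <= (w v)^-1) ->
  0 <= \sum_(v in S | e u v) F v <= D * w u.
Proof.
move=> su FP; apply/andP; split; first by apply: sumr_ge0 => v /andP[/FP/andP[]].
apply: le_trans (w_row su); rewrite [leRHS](bigID (mem S)) /=.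
rewrite [X in _ <= X + _](eq_bigl (fun v => (v \in S) && e u v)); last first.
  by move=> v; rewrite andbC.
rewrite ler_wpDr ?ler_sum // => [|v /andP[/FP/andP[]] //].
by apply: sumr_ge0 => v _; rewrite invr_ge0 ltW.
Qed.

(** The row condition gives 1 <= D w_u w_v for an edge, which is symmetric; hence columns too
    satisfy the bound, which the base of the recursion needs at either side. *)
Lemma w_edge u v : e u v -> (w u)^-1 <= D * w v.
Proof.
move=> euv; have euv' : e v u by rewrite e_sym.
have [su|su] := boolP (side u); last first.
  have sv : side v by have := e_side euv; rewrite (negPf su); case: (side v).
  apply: le_trans (w_row sv); rewrite (bigD1 u) //= lerDl sumr_ge0 // => z _.
  by rewrite invr_ge0 ltW.
have le : (w v)^-1 <= D * w u.
  apply: le_trans (w_row su); rewrite (bigD1 v) //= lerDl sumr_ge0 // => z _.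
  by rewrite invr_ge0 ltW.
move: le; rewrite -(ler_pM2r (w0 v)) mulVf ?gt_eqF // => le.
by rewrite -(ler_pM2r (w0 u)) mulVf ?gt_eqF // mulrAC.
Qed.

(** Taking inverses and sums preserves relative errors, and adding [w u] dilutes them at rows. At
    depth 0 the omitted sum has at most [#|T|] terms, each at most [D * w u]. *)
Lemma tree_near h S u : u \in S -> near (tree_err h (side u)) (tree h S u) (rho S u).
Proof.
elim: h S u => [|h IH] S u uS.
  have sl : \sum_(v in S :\ u | e u v) rho (S :\ u) v <= #|T|%:R * D * w u.
    apply: le_trans (_ : \sum_(v : T) D * w u <= _); last first.
      by rewrite sumr_const -[leLHS]mulr_natl mulrA.
    rewrite big_mkcond; apply: ler_sum => v _; case: ifP => [/andP[vS euv]|_].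
      apply: le_trans (rho_le vS) _; apply: w_edge; by rewrite e_sym.
    by rewrite mulr_ge0 // ltW.
  have s0 : 0 <= \sum_(v in S :\ u | e u v) rho (S :\ u) v.
    by apply: sumr_ge0 => v _; apply/ltW/rho_gt0.
  rewrite rhoE //= addr0; apply: nearV => //; first by rewrite ltr_wpDr.
  split; last by rewrite mulrDl mul1r lerD2l.
  apply: le_trans (_ : w u + \sum_(v in S :\ u | e u v) rho (S :\ u) v <= _).
    by rewrite lerDl.
  apply: ler_peMl; first by rewrite addr_ge0 // ltW.
  by rewrite lerDl mulr_ge0 // ltW.
rewrite rhoE //=.
have tr0 : 0 <= \sum_(v in S :\ u | e u v) tree h (S :\ u) v.
  by apply: sumr_ge0 => v _; apply/ltW/tree_gt0.
have rh0 : 0 <= \sum_(v in S :\ u | e u v) rho (S :\ u) v.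
  by apply: sumr_ge0 => v _; apply/ltW/rho_gt0.
apply: nearV; [by rewrite ltr_wpDr|by rewrite ltr_wpDr|].
have sn : near (tree_err h (~~ side u)) (\sum_(v in S :\ u | e u v) tree h (S :\ u) v)
    (\sum_(v in S :\ u | e u v) rho (S :\ u) v).
  apply: near_sum => v /andP[vS euv].
  have -> : ~~ side u = side v.
    by have := e_side euv; case: (side u); case: (side v).
  exact: IH.
move: sn; case su: (side u) => sn; last first.
  rewrite mulr1; apply: near_col => //; first exact: ltW.
  exact: tree_err_ge0.
apply: near_row => //.
- by apply: sum_neighbours_le => // v vS; rewrite ltW ?tree_gt0 ?tree_le.
- by apply: sum_neighbours_le => // v vS; rewrite ltW ?rho_gt0 ?rho_le.
- exact: tree_err_ge0.
Qed.

End Tree.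

(** * Matching sums as telescoping products of ratios *)

Section TreeProduct.
Variables (R : realFieldType) (M : nat) (e : rel 'I_M) (w : 'I_M -> R).
Hypothesis e_sym : symmetric e.
Hypothesis w0 : forall u, 0 < w u.

Definition from (k : nat) : {set 'I_M} := [set y : 'I_M | (k <= y)%N].

Lemma fromD1 (i : 'I_M) : from i :\ i = from i.+1.
Proof. by apply/setP => y; rewrite !inE ltn_neqAle eq_sym. Qed.

Lemma md_prod_rho : md e w setT = \prod_(i < M) (rho e w (from i) i)^-1.
Proof.
have gt0 S : md e w S != 0 by rewrite gt_eqF ?md_gt0.
have -> : [set: 'I_M] = from 0 by apply/setP => y; rewrite !inE.
have E : from M = set0 by apply/setP => y; rewrite !inE leqNgt ltn_ord.
rewrite (eq_bigr (fun i : 'I_M => md e w (from i) / md e w (from i.+1))) => [|i _].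
  rewrite -(big_mkord xpredT (fun i => md e w (from i) / md e w (from i.+1))).
  suff H k : \prod_(0 <= i < k) (md e w (from i) / md e w (from i.+1))
      = md e w (from 0) / md e w (from k) by rewrite H E md0 divr1.
  elim: k => [|k IH]; first by rewrite big_nil divff.
  by rewrite big_nat_recr //= IH mulrA divfK.
by rewrite /rho fromD1 invfM invrK mulrC.
Qed.

Definition tree_md h := \prod_(i < M) (tree e w h (from i) i)^-1.

End TreeProduct.

Lemma tree_md_near (R : realFieldType) M (e : rel 'I_M) (side : pred 'I_M)
    (w : 'I_M -> R) D m x :
  symmetric e -> (forall u v, e u v -> side u != side v) ->
  (forall u, 0 < w u) -> 1 <= D ->
  (forall u, side u -> \sum_(v | e u v) (w v)^-1 <= D * w u) ->
  M%:R * D * (D / (D + 1)) ^+ m <= x ->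
  tree_md e w m.*2 <= (1 + x) ^+ M * md e w setT /\
  md e w setT <= (1 + x) ^+ M * tree_md e w m.*2.
Proof.
move=> e_sym e_side w0 D1 w_row xle; rewrite md_prod_rho // /tree_md.
have x0 : 0 <= x.
  have D0 : 0 <= D by apply: le_trans D1.
  by apply: le_trans xle; rewrite !mulr_ge0 ?exprn_ge0 ?divr_ge0 // addr_ge0.
case: M e side w e_sym e_side w0 w_row xle => [|M] e side w e_sym e_side w0 w_row xle.
  by rewrite !big_ord0 mul1r.
pose F i := (tree e w m.*2 (from M.+1 i) (inord i))^-1.
pose F' i := (rho e w (from M.+1 i) (inord i))^-1.
have -> : \prod_(i < M.+1) (tree e w m.*2 (from M.+1 i) i)^-1 = \prod_(i <- iota 0 M.+1) F i.
  rewrite -[iota _ _]/(index_iota 0 M.+1) big_mkord.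
  by apply: eq_bigr => i _; rewrite /F inord_val.
have -> : \prod_(i < M.+1) (rho e w (from M.+1 i) i)^-1 = \prod_(i <- iota 0 M.+1) F' i.
  rewrite -[iota _ _]/(index_iota 0 M.+1) big_mkord.
  by apply: eq_bigr => i _; rewrite /F' inord_val.
suff H i : i \in iota 0 M.+1 -> [/\ 0 <= F i, 0 <= F' i & near x (F i) (F' i)].
  by have := near_prod x0 H; rewrite size_iota.
rewrite mem_iota => /andP[_ iM].
have t0 : 0 < tree e w m.*2 (from M.+1 i) (inord i) by apply: tree_gt0.
have r0 : 0 < rho e w (from M.+1 i) (inord i) by apply: rho_gt0.
split; rewrite ?invr_ge0 ?ltW //; apply: nearV => //.
have iF : inord i \in from M.+1 i by rewrite inE inordK.
apply: near_le (tree_near e_sym e_side w0 D1 w_row _ iF); [exact: ltW|exact: ltW|].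
by rewrite tree_err_double card_ord.
Qed.

Local Open Scope nat_scope.

(** * A language of bounded loops *)

(** Total correctness with a time budget. The postcondition is a predicate, so the rules below run a
    program symbolically by nesting. *)
Definition term (p : prog) (s : state) (T : nat) (Q : state -> Prop) :=
  exists s' t, [/\ exec p s t s', t <= T & Q s'].

Lemma term_le p s T T' (Q Q' : state -> Prop) :
  T <= T' -> (forall s', Q s' -> Q' s') -> term p s T Q -> term p s T' Q'.
Proof. by move=> TT QQ [s' [t [e tT q]]]; exists s', t; split; [|apply: leq_trans TT|apply: QQ]. Qed.

Lemma term_leT p s T T' Q : T <= T' -> term p s T Q -> term p s T' Q.
Proof. by move=> TT; apply: term_le TT _. Qed.

Lemma term_const x c s (Q : state -> Prop) :
  Q (set_reg s x c) -> term (Const x c) s 1 Q.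
Proof. by move=> q; exists (set_reg s x c), 1; split => //; constructor. Qed.

Lemma term_add x y z s (Q : state -> Prop) :
  Q (set_reg s x (reg s y + reg s z)) -> term (Add x y z) s 1 Q.
Proof. by move=> q; eexists _, 1; split; [constructor|by []|]. Qed.

Lemma term_sub x y z s (Q : state -> Prop) :
  Q (set_reg s x (reg s y - reg s z)) -> term (Sub x y z) s 1 Q.
Proof. by move=> q; eexists _, 1; split; [constructor|by []|]. Qed.

Lemma term_read x y s (Q : state -> Prop) :
  Q (set_reg s x (ram s (reg s y))) -> term (Read x y) s 1 Q.
Proof. by move=> q; eexists _, 1; split; [constructor|by []|]. Qed.

Lemma term_write x y s (Q : state -> Prop) :
  Q (set_ram s (reg s x) (reg s y)) -> term (Write x y) s 1 Q.
Proof. by move=> q; eexists _, 1; split; [constructor|by []|]. Qed.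

Lemma term_seq p q s T1 T2 (Q : state -> Prop) :
  term p s T1 (fun s' => term q s' T2 Q) -> term (Seq p q) s (T1 + T2) Q.
Proof.
move=> [s' [t [e tT [s'' [u [e' uT q2]]]]]]; exists s'', (t + u).
by split => //; [apply: ExecSeq e'|apply: leq_add].
Qed.

Lemma term_if x p q s T1 T2 (Q : state -> Prop) :
  (reg s x != 0 -> term p s T1 Q) -> (reg s x = 0 -> term q s T2 Q) ->
  term (If x p q) s (maxn T1 T2).+1 Q.
Proof.
move=> H1 H2; have [x0|x0] := eqVneq (reg s x) 0.
  have [s' [t [e tT q2]]] := H2 x0; exists s', t.+1; split=> //.
    exact: ExecIfFalse.
  by rewrite ltnS (leq_trans tT) ?leq_maxr.
have [s' [t [e tT q2]]] := H1 x0; exists s', t.+1; split=> //.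
  exact: ExecIfTrue.
by rewrite ltnS (leq_trans tT) ?leq_maxl.
Qed.

(** The index of the invariant is the number of rounds still to be run, which is what the counter
    register holds. *)
Lemma term_count (c : nat) p (I : nat -> state -> Prop) T k s :
  I k s ->
  (forall j s, I j s -> reg s c = j) ->
  (forall j s, I j.+1 s -> term p s T (I j)) ->
  term (While c p) s (k * T.+1).+1 (I 0).
Proof.
move=> + Ic Is; elim: k s => [|k IH] s Ik.
  by exists s, 1; split => //; apply: ExecWhileFalse; apply: Ic.
have [s' [t [e tT Ik']]] := Is _ _ Ik.
have [s'' [u [e' uT I0]]] := IH _ Ik'.
exists s'', (t + u).+1; split=> //; last by rewrite mulSn; lia.
by apply: ExecWhileTrue e e'; rewrite (Ic _ _ Ik).
Qed.

Fixpoint loop (S : Type) (F : nat -> S -> S) (i k : nat) (a : S) : S :=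
  if k is k'.+1 then loop F i.+1 k' (F i a) else a.

(* Variables are de Bruijn indices: the body of [Fold] sees the accumulator as
   [Var 0] and the counter as [Var 1], the body of [For] sees the counter as
   [Var 0], and the body of [App] sees nothing but its three arguments. *)
Inductive expr : Type :=
| Var of nat
| Num of nat
| Size
| Log
| Plus of expr & expr
| Minus of expr & expr
| Times of expr & expr
| Input of expr
| Get of nat & expr
| Cond of expr & expr & expr
| Fold of expr & expr & expr
| App of expr & expr & expr & expr.

Inductive stmt : Type :=
| Put of nat & expr & expr
| Then of stmt & stmt
| For of expr & stmt.

Section Semantics.
Variables (n l X : nat) (inp : nat -> nat).
Implicit Types (mem : nat -> nat -> nat) (env : seq nat).

(** Iterated from 1, it settles at the largest power of two not exceeding a positive [b]. *)
Definition double_upto b p := if p + p <= b then p + p else p.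

Definition strip (a : nat) (st : nat * nat) :=
  let p := iter X (double_upto st.1) 1 in
  if p <= st.1 then (st.1 - p, st.2 + a * p) else st.

(* Shift-and-add multiplication with all its loops run X times; it is exact
   as soon as b < 2 ^ X. *)
Definition mulX a b := (iter X (strip a) (b, 0)).2.

(* All loops are cut off after X rounds, so that the running time is bounded by a
   polynomial in X depending on the program text only. *)
Fixpoint eval env mem e {struct e} : nat :=
  match e with
  | Var k => nth 0 env k
  | Num c => c
  | Size => n
  | Log => l
  | Plus a b => eval env mem a + eval env mem b
  | Minus a b => eval env mem a - eval env mem b
  | Times a b => mulX (eval env mem a) (eval env mem b)
  | Input a => let i := eval env mem a in if i < n * n then inp i else 0
  | Get A a => mem (A %% 8) (eval env mem a)
  | Cond a b c => if eval env mem a != 0 then eval env mem b else eval env mem c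
  | Fold a b c => loop (fun i acc => eval [:: acc, i & env] mem c) 0
                    (minn (eval env mem a) X) (eval env mem b)
  | App a b c f => eval [:: eval env mem a; eval env mem b; eval env mem c] mem f
  end.

Definition put mem A i v : nat -> nat -> nat :=
  fun A' i' => if (A' == A %% 8) && (i' == i) then v else mem A' i'.

Fixpoint run env mem p {struct p} : nat -> nat -> nat :=
  match p with
  | Put A a b => put mem A (eval env mem a) (eval env mem b)
  | Then p q => run env (run env mem p) q
  | For a p => loop (fun i m => run (i :: env) m p) 0 (minn (eval env mem a) X) mem
  end.

(** Since [App] is compiled by inlining, the cost of its body is simply added; a conditional is
    charged for both branches. *)
Fixpoint ecost e : nat :=
  match e with
  | Var _ => 2
  | Num _ => 1
  | Size | Log => 2
  | Plus a b | Minus a b => ecost a + ecost b + 1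
  | Times a b => ecost a + ecost b + 20 * X.+1 * X.+1
  | Input a => ecost a + 4
  | Get _ a => ecost a + 7
  | Cond a b c => ecost a + (ecost b + ecost c) + 1
  | Fold a b c => ecost a + ecost b + X * (ecost c + 6) + 6
  | App a b c f => ecost a + ecost b + ecost c + ecost f + 2
  end.

Fixpoint scost p : nat :=
  match p with
  | Put _ a b => ecost a + ecost b + 7
  | Then p q => scost p + scost q
  | For a p => ecost a + X * (scost p + 4) + 4
  end.

End Semantics.

(** * Compilation to the register machine *)

Definition move_reg x y z := Seq (Const z 0) (Add x y z).

(** Registers d + 4 and d + 5 hold a power p of two and the multiple a p; they are doubled together
    while 2 p <= b. Register d + 6 counts X rounds, even when doubling has stopped. *)
Definition mul_inner d : prog :=
  Seq (Const (d + 4) 1) (Seq (move_reg (d + 5) d (d + 6))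
  (Seq (move_reg (d + 6) 3 (d + 7)) (While (d + 6)
    (Seq (Add (d + 7) (d + 4) (d + 4))
    (Seq (Sub (d + 8) (d + 7) (d + 1))
    (Seq (If (d + 8) (Const (d + 8) 0)
           (Seq (move_reg (d + 4) (d + 7) (d + 8)) (Add (d + 5) (d + 5) (d + 5))))
    (Seq (Const (d + 7) 1) (Sub (d + 6) (d + 6) (d + 7))))))))).

Definition comp_mul d : prog :=
  Seq (Const (d + 2) 0) (Seq (move_reg (d + 3) 3 (d + 4))
  (Seq (While (d + 3)
    (Seq (mul_inner d)
    (Seq (Sub (d + 7) (d + 4) (d + 1))
    (Seq (If (d + 7) (Const (d + 7) 0)
           (Seq (Sub (d + 1) (d + 1) (d + 4)) (Add (d + 2) (d + 2) (d + 5))))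
    (Seq (Const (d + 7) 1) (Sub (d + 3) (d + 3) (d + 7)))))))
  (move_reg d (d + 2) (d + 3)))).

(* Cell i of array A is stored at address n * n + 8 * i + A. *)
Definition comp_address A d t :=
  Seq (Add d d d) (Seq (Add d d d) (Seq (Add d d d)
    (Seq (Add d d 1) (Seq (Const t (A %% 8)) (Add d d t))))).

(* Registers 0 to 3 hold n, n * n, the logarithm of n and X.  The variables live in
   the registers [ctx], below d; the result is put in register d. *)
Fixpoint comp (ctx : seq nat) (d : nat) (e : expr) : prog :=
  match e with
  | Var k => if k < size ctx then move_reg d (nth 0 ctx k) d.+1 else Seq (Const d 0) (Const d 0)
  | Num c => Const d c
  | Size => move_reg d 0 d.+1
  | Log => move_reg d 2 d.+1
  | Plus a b => Seq (comp ctx d a) (Seq (comp ctx d.+1 b) (Add d d d.+1))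
  | Minus a b => Seq (comp ctx d a) (Seq (comp ctx d.+1 b) (Sub d d d.+1))
  | Times a b => Seq (comp ctx d a) (Seq (comp ctx d.+1 b) (comp_mul d))
  | Input a => Seq (comp ctx d a) (Seq (Sub d.+1 1 d) (If d.+1 (Read d d) (Const d 0)))
  | Get A a => Seq (comp ctx d a) (Seq (comp_address A d d.+1) (Read d d))
  | Cond a b c => Seq (comp ctx d a) (If d (comp ctx d b) (comp ctx d c))
  | Fold a b c =>
      Seq (comp ctx d a) (Seq (Sub d.+1 d 3) (Seq (Sub d d d.+1)
      (Seq (comp ctx d.+2 b) (Seq (Const d.+1 0)
      (Seq (While d (Seq (comp [:: d.+2, d.+1 & ctx] d.+3 c)
                    (Seq (move_reg d.+2 d.+3 d.+4)
                    (Seq (Const d.+4 1) (Seq (Add d.+1 d.+1 d.+4) (Sub d d d.+4))))))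
      (move_reg d d.+2 d.+1))))))
  | App a b c f =>
      Seq (comp ctx d a) (Seq (comp ctx d.+1 b) (Seq (comp ctx d.+2 c)
      (Seq (comp [:: d; d.+1; d.+2] d.+3 f) (move_reg d d.+3 d.+4))))
  end.

Fixpoint compile (ctx : seq nat) (d : nat) (p : stmt) : prog :=
  match p with
  | Put A a b => Seq (comp ctx d a) (Seq (comp_address A d d.+1)
                   (Seq (comp ctx d.+1 b) (Write d d.+1)))
  | Then p q => Seq (compile ctx d p) (compile ctx d q)
  | For a p =>
      Seq (comp ctx d a) (Seq (Sub d.+1 d 3) (Seq (Sub d d d.+1) (Seq (Const d.+1 0)
      (While d (Seq (compile (d.+1 :: ctx) d.+2 p)
               (Seq (Const d.+2 1) (Seq (Add d.+1 d.+1 d.+2) (Sub d d d.+2))))))))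
  end.

(** * Correctness and cost of compiled expressions *)

Definition agree d (s s' : state) :=
  ram s' = ram s /\ forall r, r < d -> reg s' r = reg s r.

Lemma agree_trans d d' s s' s'' : d <= d' ->
  agree d s s' -> agree d' s' s'' -> agree d s s''.
Proof.
move=> dd [m1 r1] [m2 r2]; split=> [|r rd]; first by rewrite m2.
by rewrite r2 ?r1 // (leq_trans rd).
Qed.

Lemma agree_set d s s' x v : d <= x -> agree d s s' -> agree d s (set_reg s' x v).
Proof.
move=> dx [m r]; split=> // y yd; rewrite /= /upd; case: eqP => [yx|_]; last exact: r.
by move: yd; rewrite yx ltnNge dx.
Qed.

Lemma reg_set s x v y : reg (set_reg s x v) y = if y == x then v else reg s y.
Proof. by []. Qed.

Lemma term_move x y z s (Q : state -> Prop) : y != z ->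
  Q (set_reg (set_reg s z 0) x (reg s y)) -> term (move_reg x y z) s 2 Q.
Proof.
move=> yz q; apply: (term_seq (T1 := 1)); apply: term_const; apply: term_add.
by rewrite !reg_set eqxx (negPf yz) addn0.
Qed.

Ltac decide_regs := cbn [reg ram set_reg set_ram]; rewrite /upd;
  repeat match goal with |- context [?a == ?b] =>
    first [ have -> : (a == b) = true by lia | have -> : (a == b) = false by lia ] end.

Ltac step := first [ eapply term_move; [lia|] | eapply term_seq
  | eapply term_const | eapply term_add | eapply term_sub | eapply term_read
  | eapply term_write ].

Ltac set_tac := repeat (apply: agree_set; first by lia).

Section Correctness.
Variables (n l X : nat) (inp : nat -> nat).

Record sim (s : state) (mem : nat -> nat -> nat) : Prop := Sim {
  sim_n : reg s 0 = n;
  sim_nn : reg s 1 = n * n;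
  sim_l : reg s 2 = l;
  sim_X : reg s 3 = X;
  sim_inp : forall k, k < n * n -> ram s k = inp k;
  sim_mem : forall A i, A < 8 -> ram s (n * n + 8 * i + A) = mem A i }.

Lemma agree_sim d s s' mem : 4 <= d -> agree d s s' -> sim s mem -> sim s' mem.
Proof.
move=> d4 [rm rg] [h0 h1 h2 h3 h4 h5].
by split; rewrite ?rm ?rg // (leq_trans _ d4).
Qed.

Lemma term_mul_inner d s a b : 4 <= d -> reg s 3 = X -> reg s d = a -> reg s (d + 1) = b ->
  term (mul_inner d) s (11 * X + 6)
    (fun s' => [/\ agree (d + 4) s s', reg s' (d + 4) = iter X (double_upto b) 1 &
       reg s' (d + 5) = a * iter X (double_upto b) 1]).
Proof.
move=> d4 rX ra rb.
pose I j s' := [/\ agree (d + 4) s s', reg s' (d + 6) = j,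
  reg s' (d + 5) = a * reg s' (d + 4) &
  iter j (double_upto b) (reg s' (d + 4)) = iter X (double_upto b) 1].
apply: (@term_leT _ _ (1 + (2 + (2 + (X * 11).+1)))); first by lia.
rewrite /mul_inner; step; step; step; step; step; step.
eapply (@term_le _ _ _ _ (I 0)); first exact: leqnn.
  by move=> s' [ag _ rc /= it]; rewrite -it.
apply: term_count.
- split; decide_regs => //; last by rewrite ra muln1.
  by set_tac.
- by move=> j s' [].
move=> j s' [ag rj rc it].
have [rm rg] := ag.
have rb' : reg s' (d + 1) = b by rewrite rg //; lia.
eapply term_leT; last first.
- step; step; step; step; step.
  eapply term_if; decide_regs => cond.
    do 4! step; split.
    + by set_tac.
    + by decide_regs; rewrite rj; lia.
    + by decide_regs.
    + decide_regs; rewrite -it iterSr /double_upto; case: ifP => //.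
      by move: cond; rewrite rb'; lia.
  do 6! step; split.
  + by set_tac.
  + by decide_regs; rewrite rj; lia.
  + by decide_regs; rewrite rc; lia.
  + decide_regs; rewrite -it iterSr /double_upto; case: ifP => //.
    by move: cond; rewrite rb'; lia.
- lia.
Qed.

Lemma term_mul d s a b : 4 <= d -> reg s 3 = X -> reg s d = a -> reg s (d + 1) = b ->
  term (comp_mul d) s (20 * X.+1 * X.+1)
    (fun s' => agree d s s' /\ reg s' d = mulX X a b).
Proof.
move=> d4 rX ra rb.
pose I j s' := [/\ agree d s s', reg s' (d + 3) = j, reg s' d = a &
  iter j (strip X a) (reg s' (d + 1), reg s' (d + 2)) = iter X (strip X a) (b, 0)].
apply: (@term_leT _ _ (1 + (2 + ((X * (11 * X + 6 + (1 + (3 + 2))).+1).+1 + 2)))); first by lia.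
rewrite /comp_mul; do 5! step.
eapply (@term_le _ _ _ _ (I 0)); first exact: leqnn.
  move=> s' [ag _ _ /= it]; step; split; first by set_tac.
  by decide_regs; rewrite /mulX -it.
apply: term_count.
- split; decide_regs => //; last by rewrite rb.
  by set_tac.
- by move=> j s' [].
move=> j s' [ag rj rA it]; have [rm rg] := ag.
step; apply: (term_le (leqnn _) _ (@term_mul_inner d s' a (reg s' (d + 1)) d4 _ rA erefl)); last first.
  by rewrite rg //; lia.
move=> s1 [ag1 rp rc]; have [rm1 rg1] := ag1.
have e1 : reg s1 (d + 1) = reg s' (d + 1) by rewrite rg1 //; lia.
have e2 : reg s1 (d + 2) = reg s' (d + 2) by rewrite rg1 //; lia.
have e3 : reg s1 (d + 3) = j.+1 by rewrite rg1 //; lia.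
have e0 : reg s1 d = a by rewrite rg1 //; lia.
have ag2 : agree d s s1 by apply: agree_trans ag ag1; lia.
set p := iter X (double_upto _) 1 in rp rc.
eapply term_leT; last first.
- do 3! step; eapply term_if; decide_regs => cond.
    do 4! step; split.
    + by set_tac.
    + by decide_regs; rewrite e3; lia.
    + by decide_regs.
    + decide_regs; rewrite -it iterSr; congr (iter j _ _); rewrite /strip /= -/p.
      by move: cond; rewrite e1 rp e2; case: ifP => //; lia.
  do 6! step; split.
  + by set_tac.
  + by decide_regs; rewrite e3; lia.
  + by decide_regs.
  + decide_regs; rewrite -it iterSr; congr (iter j _ _); rewrite /strip /= -/p.
    by move: cond; rewrite e1 rp e2 rc; case: ifP => //; lia.
- lia.
Qed.

Lemma term_address A d s : 4 <= d -> reg s 1 = n * n ->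
  term (comp_address A d d.+1) s 6
    (fun s' => agree d s s' /\ reg s' d = n * n + 8 * reg s d + A %% 8).
Proof.
move=> d4 r1; rewrite /comp_address; eapply term_leT; last first.
- do 11! step; split; first by set_tac.
  by decide_regs; rewrite r1; lia.
- lia.
Qed.

Lemma agree_map d s s' ctx : all (fun r => r < d) ctx -> agree d s s' ->
  [seq reg s' r | r <- ctx] = [seq reg s r | r <- ctx].
Proof. by move=> /allP cd [_ rg]; apply/eq_in_map => r /cd; apply: rg. Qed.

Lemma all_ltn_le d d' ctx : d <= d' -> all (fun r => r < d) ctx -> all (fun r => r < d') ctx.
Proof. by move=> dd; apply: sub_all => r /leq_trans; apply. Qed.

(** Memory and all registers below [d] survive, so the registers from [d] on serve as an evaluation
    stack. *)
Definition comp_correct e := forall ctx d s mem env, 4 <= d ->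
  all (fun r => r < d) ctx -> sim s mem -> env = [seq reg s r | r <- ctx] ->
  term (comp ctx d e) s (ecost X e)
    (fun s' => agree d s s' /\ reg s' d = eval n l X inp env mem e).

Lemma comp_correct_later e ctx d d' s s1 mem env : comp_correct e -> 4 <= d -> d <= d' ->
  all (fun r => r < d) ctx -> sim s mem -> env = [seq reg s r | r <- ctx] ->
  agree d s s1 ->
  term (comp ctx d' e) s1 (ecost X e)
    (fun s' => agree d' s1 s' /\ reg s' d' = eval n l X inp env mem e).
Proof.
move=> ce d4 dd cd sm envE ag; apply: ce; first by apply: leq_trans dd.
- exact: all_ltn_le cd.
- exact: agree_sim ag sm.
- by rewrite (agree_map cd ag).
Qed.

Lemma comp_correct_binary a b ctx d s mem env T (p : prog) Q :
  comp_correct a -> comp_correct b -> 4 <= d ->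
  all (fun r => r < d) ctx -> sim s mem -> env = [seq reg s r | r <- ctx] ->
  (forall s2, agree d s s2 -> reg s2 d = eval n l X inp env mem a ->
     reg s2 d.+1 = eval n l X inp env mem b -> term p s2 T Q) ->
  term (Seq (comp ctx d a) (Seq (comp ctx d.+1 b) p)) s (ecost X a + (ecost X b + T)) Q.
Proof.
move=> ca cb d4 cd sm envE H; apply: term_seq.
apply: (term_le (leqnn _)) (ca _ _ _ _ _ d4 cd sm envE) => s1 [ag1 v1].
apply: term_seq; apply: (term_le (leqnn _)) (comp_correct_later cb d4 (leqnSn d) cd sm envE ag1).
move=> s2 [ag2 v2]; apply: H => //; first by apply: agree_trans ag1 ag2.
by rewrite -v1; case: ag2 => _; apply.
Qed.

Lemma term_comp e : comp_correct e.
Proof.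
elim: e => [k|c|||a IHa b IHb|a IHa b IHb|a IHa b IHb|a IHa|A a IHa|a IHa b IHb c IHc
   |a IHa b IHb c IHc|a IHa b IHb c IHc f IHf] ctx d s mem env d4 cd sm envE /=.
- case: ifP => kc.
    have kd : nth 0 ctx k < d by move/(all_nthP 0): cd => /(_ _ kc).
    step; split; first by set_tac.
    by decide_regs; rewrite envE (nth_map 0).
  apply: (@term_leT _ _ (1 + 1)) => //; do 3! step; split; first by set_tac.
  by decide_regs; rewrite envE nth_default // size_map leqNgt kc.
- step; split; first by set_tac.
  by decide_regs.
- step; split; first by set_tac.
  by decide_regs; apply: sim_n sm.
- step; split; first by set_tac.
  by decide_regs; apply: sim_l sm.
- rewrite -addnA; apply: (comp_correct_binary IHa IHb d4 cd sm envE) => s2 ag v1 v2.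
  by step; split; [set_tac|decide_regs; rewrite v1 v2].
- rewrite -addnA; apply: (comp_correct_binary IHa IHb d4 cd sm envE) => s2 ag v1 v2.
  by step; split; [set_tac|decide_regs; rewrite v1 v2].
- rewrite -addnA; apply: (comp_correct_binary IHa IHb d4 cd sm envE) => s2 ag v1 v2.
  have sm2 := agree_sim d4 ag sm.
  rewrite -addn1 in v2.
  apply: (term_le (leqnn _)) (term_mul d4 (sim_X sm2) v1 v2).
  by move=> s3 [ag3 v3]; split; first by apply: agree_trans ag ag3.
- apply: (@term_leT _ _ (ecost X a + (1 + (maxn 1 1).+1))); first by lia.
  step; apply: (term_le (leqnn _)) (IHa _ _ _ _ _ d4 cd sm envE) => s1 [ag1 v1].
  have sm1 := agree_sim d4 ag1 sm.
  step; step; eapply term_if; decide_regs => cond; step; (split; first by set_tac).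
    decide_regs; rewrite -v1 ifT; first by apply: (sim_inp sm1); move: cond; rewrite (sim_nn sm1); lia.
    by move: cond; rewrite (sim_nn sm1); lia.
  by decide_regs; rewrite -v1 ifF //; move: cond; rewrite (sim_nn sm1); lia.
- apply: (@term_leT _ _ (ecost X a + (6 + 1))); first by lia.
  step; apply: (term_le (leqnn _)) (IHa _ _ _ _ _ d4 cd sm envE) => s1 [ag1 v1].
  have sm1 := agree_sim d4 ag1 sm; have ag1' := ag1; case: ag1' => rm1 _.
  step; apply: (term_le (leqnn _)) (term_address A d4 (sim_nn sm1)) => s2 [ag2 v2].
  step; split.
    by apply: agree_set => //; apply: agree_trans ag1 ag2.
  decide_regs; rewrite v2 v1; case: ag2 => -> _.
  by apply: (sim_mem sm1); rewrite ltn_mod.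
- apply: (@term_leT _ _ (ecost X a + (maxn (ecost X b) (ecost X c)).+1)); first by lia.
  step; apply: (term_le (leqnn _)) (IHa _ _ _ _ _ d4 cd sm envE) => s1 [ag1 v1].
  apply: term_if; rewrite v1 => cond.
    rewrite cond; apply: (term_le (leqnn _)) (comp_correct_later IHb d4 (leqnn d) cd sm envE ag1).
    by move=> s2 [ag2 v2]; split; first by apply: agree_trans ag1 ag2.
  rewrite cond; apply: (term_le (leqnn _)) (comp_correct_later IHc d4 (leqnn d) cd sm envE ag1).
  by move=> s2 [ag2 v2]; split; first by apply: agree_trans ag1 ag2.
(* Register d counts down from min(a, X), obtained as a - (a - X), while d + 1 counts up. The
   invariant says that the remaining rounds, run from the current index and accumulator, give the
   final value. *)
- pose N := minn (eval n l X inp env mem a) X; pose z := eval n l X inp env mem b.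
  pose F i acc := eval n l X inp [:: acc, i & env] mem c; rewrite -/z -/N.
  pose I j s' := [/\ agree d s s', reg s' d = j &
    loop F (reg s' d.+1) j (reg s' d.+2) = loop F 0 N z].
  apply: (@term_leT _ _ (ecost X a + (1 + (1 + (ecost X b + (1 +
     ((N * (ecost X c + (2 + (1 + (1 + 1)))).+1).+1 + 2))))))).
    have : N * (ecost X c + (2 + (1 + (1 + 1)))).+1 <= X * (ecost X c + (2 + (1 + (1 + 1)))).+1.
      by rewrite leq_mul2r geq_minr orbT.
    by rewrite (_ : (ecost X c + (2 + (1 + (1 + 1)))).+1 = ecost X c + 6); lia.
  step; apply: (term_le (leqnn _)) (IHa _ _ _ _ _ d4 cd sm envE) => s1 [ag1 v1].
  have sm1 := agree_sim d4 ag1 sm.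
  step; step; step; step; step.
  set s2 := set_reg (set_reg s1 _ _) _ _.
  have ag2 : agree d s s2 by set_tac.
  have r2 : reg s2 d = N.
    by rewrite /s2; decide_regs; rewrite v1 (sim_X sm1) /N minnE.
  apply: (term_le (leqnn _)) (comp_correct_later IHb d4 (leqW (leqnSn d)) cd sm envE ag2).
  move=> s3 [ag3 v3]; have ag3' := ag3; case: ag3' => _ rg3.
  do 3! step; eapply (@term_le _ _ _ _ (I 0)); first exact: leqnn.
    move=> s4 [ag4 _ /= <-]; step; split; first by set_tac.
    by decide_regs.
  apply: term_count.
  + split; decide_regs.
    * set_tac; apply: agree_trans ag2 ag3; lia.
    * by rewrite rg3 //; lia.
    * by rewrite v3.
  + by move=> j s4 [].
  move=> j s4 [ag4 rj it]; step.
  have sm4 := agree_sim d4 ag4 sm.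
  apply: (term_le (leqnn _)) (IHc [:: d.+2, d.+1 & ctx] d.+3 s4 mem
      [:: reg s4 d.+2, reg s4 d.+1 & env] _ _ sm4 _).
  + move=> s5 [ag5 v5]; have ag5' := ag5; case: ag5' => _ rg5.
    do 7! step; split.
    * by set_tac; apply: agree_trans ag4 ag5; lia.
    * by decide_regs; rewrite rg5 ?rj //; lia.
    * have d1 : d.+1 < d.+3 by lia.
      by decide_regs; rewrite -it v5 rg5 // addn1.
  + lia.
  + by rewrite /= ltnSn leqnSn (all_ltn_le _ cd) //; lia.
  + by rewrite envE /= (agree_map cd ag4).
- rewrite -!addnA; apply: (comp_correct_binary IHa IHb d4 cd sm envE) => s2 ag2 v1 v2.
  step; apply: (term_le (leqnn _)) (comp_correct_later IHc d4 (leqW (leqnSn d)) cd sm envE ag2).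
  move=> s3 [ag3 v3]; have sm2 := agree_sim d4 ag2 sm.
  have sm3 := agree_sim (leqW (leqW d4)) ag3 sm2.
  have ag3' := ag3; case: ag3' => _ rg3.
  step; apply: (term_le (leqnn _)) (IHf [:: d; d.+1; d.+2] d.+3 s3 mem
    [:: reg s3 d; reg s3 d.+1; reg s3 d.+2] _ _ sm3 erefl).
  + move=> s4 [ag4 v4]; step; split.
      set_tac; apply: agree_trans (agree_trans _ ag2 ag3) ag4; lia.
    by decide_regs; rewrite v4 v3 !rg3 ?v1 ?v2 //; lia.
  + lia.
  + by rewrite /=; lia.
Qed.

End Correctness.

Local Open Scope nat_scope.

(** * Correctness and cost of compiled statements *)

Section CompileCorrectness.
Variables (n l X : nat) (inp : nat -> nat).

Definition compile_correct p := forall ctx d s mem env, 4 <= d ->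
  all (fun r => r < d) ctx -> sim n l X inp s mem -> env = [seq reg s r | r <- ctx] ->
  term (compile ctx d p) s (scost X p)
    (fun s' => sim n l X inp s' (run n l X inp env mem p) /\
       forall r, r < d -> reg s' r = reg s r).

(** Because A %% 8 < 8, distinct cells have distinct addresses, all of them beyond the input. *)
Lemma sim_put s mem A i v : sim n l X inp s mem ->
  sim n l X inp (set_ram s (n * n + 8 * i + A %% 8) v) (put mem A i v).
Proof.
have A8 : A %% 8 < 8 by rewrite ltn_mod.
case=> h0 h1 h2 h3 h4 h5; split=> //= [k kn|A' i' A'8]; rewrite /upd.
  by rewrite ifF ?h4 //; apply/eqP => E; lia.
rewrite /put -h5 //; congr (if _ then _ else _).
by apply/eqP/andP => [E|[/eqP-> /eqP->]//]; split; apply/eqP; lia.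
Qed.

Lemma term_compile p : compile_correct p.
Proof.
elim: p => [A a b|p IHp q IHq|a p IHp] ctx d s mem env d4 cd sm envE /=.
- apply: (@term_leT _ _ (ecost X a + (6 + (ecost X b + 1)))); first by lia.
  apply: term_seq.
  apply: (term_le (leqnn _)) (@term_comp n l X inp a _ _ _ _ _ d4 cd sm envE) => s1 [ag1 v1].
  have sm1 := agree_sim d4 ag1 sm.
  apply: term_seq; apply: (term_le (leqnn _)) (term_address A d4 (sim_nn sm1)).
  move=> s2 [ag2 v2]; have ag12 := agree_trans (leqnn d) ag1 ag2.
  apply: term_seq; apply: (term_le (leqnn _))
    (comp_correct_later (@term_comp n l X inp b) d4 (leqnSn d) cd sm envE ag12).
  move=> s3 [ag3 v3]; have ag13 := agree_trans (leqnSn d) ag12 ag3.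
  have sm3 := agree_sim d4 ag13 sm; case: (ag13) (ag3) => _ rg13 [_ rg3].
  apply: term_write; rewrite v3 rg3 // v2 v1; split; first exact: sim_put.
  exact: rg13.
- apply: term_seq; apply: (term_le (leqnn _)) (IHp _ _ _ _ _ d4 cd sm envE) => s1 [sm1 rg1].
  have e1 : env = [seq reg s1 r | r <- ctx].
    by rewrite envE; apply/eq_in_map => r /(allP cd) rd; rewrite rg1.
  apply: (term_le (leqnn _)) (IHq _ _ _ _ _ d4 cd sm1 e1) => s2 [sm2 rg2].
  by split => // r rd; rewrite rg2 ?rg1.
- pose N := minn (eval n l X inp env mem a) X.
  pose F i m := run n l X inp (i :: env) m p; rewrite -/N.
  pose I j s' := [/\ reg s' d = j, forall r, r < d -> reg s' r = reg s r &
    exists2 m, sim n l X inp s' m & loop F (reg s' d.+1) j m = loop F 0 N mem].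
  apply: (@term_leT _ _ (ecost X a + (1 + (1 + (1 +
     (N * (scost X p + (1 + (1 + 1))).+1).+1))))).
    have : N * (scost X p + (1 + (1 + 1))).+1 <= X * (scost X p + (1 + (1 + 1))).+1.
      by rewrite leq_mul2r geq_minr orbT.
    by rewrite (_ : (scost X p + (1 + (1 + 1))).+1 = scost X p + 4); lia.
  step; apply: (term_le (leqnn _)) (@term_comp n l X inp a _ _ _ _ _ d4 cd sm envE) => s1 [ag1 v1].
  have sm1 := agree_sim d4 ag1 sm.
  do 6! step; eapply (@term_le _ _ _ _ (I 0)); first exact: leqnn.
    by move=> s2 [_ rg2 [m sm2 /= <-]].
  apply: term_count.
  + have ag2 : agree d s (set_reg (set_reg (set_reg s1 d.+1 (reg s1 d - reg s1 3)) d
       (reg (set_reg s1 d.+1 (reg s1 d - reg s1 3)) d -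
        reg (set_reg s1 d.+1 (reg s1 d - reg s1 3)) d.+1)) d.+1 0) by set_tac.
    split; first by decide_regs; rewrite v1 (sim_X sm1) /N minnE.
      by case: ag2.
    exists mem; first exact: agree_sim ag2 sm.
    by decide_regs.
  + by move=> j s2 [].
  move=> j s2 [rj rg2 [m sm2 it]]; step.
  have rgm : [seq reg s2 r | r <- d.+1 :: ctx] = reg s2 d.+1 :: env.
    by rewrite envE /=; congr (_ :: _); apply/eq_in_map => r /(allP cd); apply: rg2.
  apply: (term_le (leqnn _)) (IHp (d.+1 :: ctx) d.+2 s2 m _ _ _ sm2 (esym rgm)).
  + move=> s3 [sm3 rg3]; do 5! step; split.
    * by decide_regs; rewrite rg3 ?rj //; lia.
    * move=> r rd; decide_regs; rewrite rg3; last by lia.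
      exact: rg2.
    * exists (F (reg s2 d.+1) m).
        by apply: (agree_sim (d := d)) sm3 => //; set_tac.
      have d1 : d.+1 < d.+2 by [].
      by decide_regs; rewrite rg3 // addn1 -it.
  + lia.
  + by rewrite /= ltnSn (all_ltn_le _ cd) //; lia.
Qed.

End CompileCorrectness.

(** * Polynomial cost in X and computation of X itself *)

Definition poly_bounded (f : nat -> nat) := exists c h, forall X, f X <= c * X.+1 ^ h.

Lemma poly_boundedD f g : poly_bounded f -> poly_bounded g ->
  poly_bounded (fun X => f X + g X).
Proof.
move=> [c [h fc]] [c' [h' gc]]; exists (c + c'), (h + h') => X.
rewrite mulnDl leq_add //.
  by apply: leq_trans (fc X) _; rewrite leq_mul2l leq_pexp2l ?leq_addr ?orbT.
by apply: leq_trans (gc X) _; rewrite leq_mul2l leq_pexp2l ?leq_addl ?orbT.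
Qed.

Lemma poly_boundedM f g : poly_bounded f -> poly_bounded g ->
  poly_bounded (fun X => f X * g X).
Proof.
move=> [c [h fc]] [c' [h' gc]]; exists (c * c'), (h + h') => X.
by rewrite expnD mulnACA leq_mul.
Qed.

Lemma poly_bounded_const c : poly_bounded (fun=> c).
Proof. by exists c, 0 => X; rewrite muln1. Qed.

Lemma poly_bounded_id : poly_bounded id.
Proof. by exists 1, 1 => X; rewrite mul1n expn1. Qed.

Ltac poly := repeat first [assumption | apply: poly_boundedD | apply: poly_boundedM
  | apply: poly_bounded_const | apply: poly_bounded_id].

Lemma ecost_poly e : poly_bounded (ecost^~ e).
Proof.
have succ : poly_bounded (fun X => X.+1).
  by exists 1, 1 => X; rewrite mul1n expn1.
by elim: e => /= *; poly.
Qed.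

Lemma scost_poly p : poly_bounded (scost^~ p).
Proof.
elim: p => [A a b|p IHp q IHq|a p IHp] /=; poly; exact: ecost_poly.
Qed.

(** The bit length of [n], except that it is 1 at 0: being positive, it can absorb constants. The
    n-fold iteration is the loop that the machine runs. *)
Definition lg n := iter n (fun l => if n < 2 ^ l then l else l.+1) 1.

Lemma lg_spec n : [/\ 0 < lg n, n < 2 ^ lg n & 2 ^ lg n <= (2 * n).+2].
Proof.
pose F l := if n < 2 ^ l then l else l.+1.
have H k : 0 < iter k F 1 /\ (k < iter k F 1 \/ n < 2 ^ iter k F 1) /\
    2 ^ iter k F 1 <= (2 * n).+2.
  elim: k => [|k [p [lt le]]] /=; first by split; [|split; [left|]].
  move: (iter k F 1) p lt le => t p lt le; rewrite /F; case: (ltnP n (2 ^ t)) => nl; first by split => //; split => //; right.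
  split => //; split; last by rewrite expnS; lia.
  by left; case: lt; lia.
have [p [lt le]] := H n; split=> //; case: lt => // lt.
by apply: ltn_trans lt _; apply: ltn_expl.
Qed.

(** Multiplications are repeated additions and X is built by doubling. Registers 9 and 10 pass
    through the square of the logarithm and [c1] times it; all loop counts are below X, so the cost
    is linear in X. *)
Definition setup c1 : prog :=
  Seq (Const 4 1) (Seq (move_reg 5 0 6) (Seq (Const 1 0)
  (Seq (While 5 (Seq (Add 1 1 0) (Sub 5 5 4)))
  (Seq (move_reg 5 0 6) (Seq (Const 2 1) (Seq (Const 7 2)
  (Seq (While 5 (Seq (Sub 8 7 0)
     (Seq (If 8 (Const 8 0) (Seq (Add 2 2 4) (Add 7 7 7))) (Sub 5 5 4))))
  (Seq (Const 9 0) (Seq (move_reg 5 2 6)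
  (Seq (While 5 (Seq (Add 9 9 2) (Sub 5 5 4)))
  (Seq (Const 5 c1) (Seq (Const 10 0)
  (Seq (While 5 (Seq (Add 10 10 9) (Sub 5 5 4)))
  (Seq (Const 3 1) (While 10 (Seq (Add 3 3 3) (Sub 10 10 4))))))))))))))))).

Definition bound c1 n := 2 ^ (c1 * (lg n * lg n)).

Lemma term_setup c1 n s : 0 < c1 -> reg s 0 = n ->
  term (setup c1) s (60 * (bound c1 n).+1)
    (fun s' => [/\ ram s' = ram s, reg s' 0 = n, reg s' 1 = n * n,
       reg s' 2 = lg n & reg s' 3 = bound c1 n]).
Proof.
move=> c10 r0; have [l0 nl _] := lg_spec n.
have ll : lg n <= c1 * (lg n * lg n) by clear -c10 l0; move: (lg n) l0 => l l0; nia.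
have b1 : c1 * (lg n * lg n) < bound c1 n by apply: ltn_expl.
have b2 : n < bound c1 n by apply: leq_trans nl _; rewrite leq_pexp2l.
have b3 : c1 <= c1 * (lg n * lg n) by rewrite leq_pmulr // muln_gt0 l0.
pose l := lg n; pose F k := if n < 2 ^ k then k else k.+1.
pose I1 j s' := [/\ ram s' = ram s, reg s' 0 = n, reg s' 4 = 1, reg s' 5 = j &
  reg s' 1 + j * n = n * n].
pose I2 j s' := [/\ ram s' = ram s, reg s' 0 = n, reg s' 1 = n * n &
  [/\ reg s' 4 = 1, reg s' 5 = j, reg s' 7 = 2 ^ reg s' 2 & iter j F (reg s' 2) = l]].
pose I3 j s' := [/\ ram s' = ram s, reg s' 0 = n, reg s' 1 = n * n, reg s' 2 = l &
  [/\ reg s' 4 = 1, reg s' 5 = j & reg s' 9 + j * l = l * l]].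
pose I4 j s' := [/\ ram s' = ram s, reg s' 0 = n, reg s' 1 = n * n, reg s' 2 = l &
  [/\ reg s' 4 = 1, reg s' 5 = j, reg s' 9 = l * l & reg s' 10 + j * (l * l) = c1 * (l * l)]].
pose I5 j s' := [/\ ram s' = ram s, reg s' 0 = n, reg s' 1 = n * n, reg s' 2 = l &
  [/\ reg s' 4 = 1, reg s' 10 = j & reg s' 3 * 2 ^ j = bound c1 n]].
apply: (@term_leT _ _ (1 + (2 + (1 + ((n * (1 + 1).+1).+1 + (2 + (1 + (1 +
  ((n * (1 + ((maxn 1 (1 + 1)).+1 + 1)).+1).+1 + (1 + (2 + ((l * (1 + 1).+1).+1 + (1 + (1 +
  ((c1 * (1 + 1).+1).+1 + (1 + (c1 * (l * l) * (1 + 1).+1).+1)))))))))))))))).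
  by rewrite /l; lia.
do 7! step; eapply (@term_le _ _ _ _ (I1 0)); first exact: leqnn; last first.
  apply: term_count; first by split; decide_regs; rewrite ?r0.
  + by move=> j s' [].
  move=> j s' [h1 h2 h3 h4 h5]; do 3! step.
  by split; decide_regs => //; rewrite ?h4 ?h3 ?h2 -?h5; lia.
move=> s1 [h1 h2 h3 h4 h5]; do 7! step.
eapply (@term_le _ _ _ _ (I2 0)); first exact: leqnn; last first.
  apply: term_count.
  + split; decide_regs => //; first by rewrite -h5 addn0.
  + by move=> j s' [_ _ _ [_ r5 _ _]].
  move=> j s' [g1 g2 g3 [g4 g5 g6 g7]]; do 3! step.
  eapply term_if; decide_regs => cond; do !step.
    split; decide_regs => //; split; decide_regs => //; first by rewrite g4 g5; lia.
    rewrite -g7 iterSr /F ifT //; lia.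
  split; decide_regs => //; split; decide_regs => //.
  + by rewrite g4 g5; lia.
  + by rewrite g6 g4 addn1 expnS; lia.
  + by rewrite -g7 iterSr /F g4 addn1 ifF //; lia.
move=> s2 [g1 g2 g3 [g4 g5 g6 /= g7]]; do 5! step.
eapply (@term_le _ _ _ _ (I3 0)); first exact: leqnn; last first.
  apply: term_count.
  + by split; decide_regs => //; split; decide_regs => //; rewrite g7.
  + by move=> j s' [_ _ _ _ []].
  move=> j s' [k1 k2 k3 k4 [k5 k6 k7]]; do 3! step.
  by split; decide_regs => //; split; decide_regs; rewrite ?k6 ?k5 ?k4 -?k7; lia.
move=> s3 [k1 k2 k3 k4 [k5 k6 k7]]; do 5! step.
eapply (@term_le _ _ _ _ (I4 0)); first exact: leqnn; last first.
  apply: term_count.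
  + by split; decide_regs => //; split; decide_regs => //; rewrite -k7; lia.
  + by move=> j s' [_ _ _ _ []].
  move=> j s' [m1 m2 m3 m4 [m5 m6 m7 m8]]; do 3! step.
  by split; decide_regs => //; split; decide_regs => //; rewrite ?m6 ?m5 ?m7 -?m8; lia.
move=> s4 [m1 m2 m3 m4 [m5 m6 m7 m8]]; do 2! step.
eapply (@term_le _ _ _ _ (I5 0)); first exact: leqnn; last first.
  apply: term_count.
  + split; decide_regs => //; split; decide_regs => //; first by rewrite -m8; lia.
    by rewrite mul1n.
  + by move=> j s' [_ _ _ _ []].
  move=> j s' [p1 p2 p3 p4 [p5 p6 p7]]; do 3! step.
  split; decide_regs => //; split; decide_regs => //; first by rewrite p6 p5; lia.
  by rewrite -p7 expnS; lia.
by move=> s5 [p1 p2 p3 p4 [p5 p6 p7]]; split => //; rewrite -p7 muln1.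
Qed.

Local Open Scope nat_scope.

(** The machine and the constants of the cost bound are chosen before [n], so one program serves all
    graphs. The results are moved to registers 0 and 1 only at the very end, because these hold n
    and n^2 until then. *)
Lemma machineP c1 p eN eD : 0 < c1 ->
  exists A c h, forall n (G : bigraph n),
  let X := bound c1 n in
  let mem := run n (lg n) X (ram (input_state G)) [::] (fun _ _ => 0) p in
  exists s t, [/\ exec A (input_state G) t s, t <= c * X.+1 ^ h,
    reg s 0 = eval n (lg n) X (ram (input_state G)) [::] mem eN &
    reg s 1 = eval n (lg n) X (ram (input_state G)) [::] mem eD].
Proof.
move=> c10.
have [c [h cost]] : poly_bounded (fun X => 60 * X.+1 + (scost X p + (ecost X eN + (ecost X eD + 3)))).
  have [? ?] := (ecost_poly eN, ecost_poly eD); have ? := scost_poly p.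
  have succ : poly_bounded (fun X => X.+1).
    by exists 1, 1 => X; rewrite mul1n expn1.
  by poly.
exists (Seq (setup c1) (Seq (compile [::] 4 p) (Seq (comp [::] 4 eN) (Seq (comp [::] 5 eD)
  (Seq (Const 6 0) (Seq (Add 0 4 6) (Add 1 5 6))))))), c, h => n G X mem.
suff: term (Seq (setup c1) (Seq (compile [::] 4 p) (Seq (comp [::] 4 eN) (Seq (comp [::] 5 eD)
  (Seq (Const 6 0) (Seq (Add 0 4 6) (Add 1 5 6))))))) (input_state G) (c * X.+1 ^ h)
  (fun s => reg s 0 = eval n (lg n) X (ram (input_state G)) [::] mem eN /\
    reg s 1 = eval n (lg n) X (ram (input_state G)) [::] mem eD).
  by move=> [s [t [? ? [? ?]]]]; exists s, t; split.
apply: (@term_leT _ _ (60 * X.+1 + (scost X p + (ecost X eN + (ecost X eD + (1 + (1 + 1))))))).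
  exact: cost.
apply: term_seq; apply: (term_le (leqnn _)) (term_setup c10 (erefl : reg (input_state G) 0 = n)).
move=> s1 [r1 h0 h1 h2 h3].
have sm1 : sim n (lg n) X (ram (input_state G)) s1 (fun _ _ => 0).
  split=> // [k _|A i _]; first by rewrite r1.
  rewrite r1 /= nth_default // size_allpairs size_enum_ord -addnA; exact: leq_addr.
apply: term_seq; apply: (term_le (leqnn _)) (term_compile p (leqnn 4) (isT : all _ [::]) sm1 erefl).
move=> s2 [sm2 _]; rewrite -/mem in sm2.
apply: term_seq; apply: (term_le (leqnn _))
  (@term_comp _ _ _ _ eN [::] 4 s2 mem [::] (leqnn 4) (isT : all _ [::]) sm2 erefl).
move=> s3 [ag3 v3].
apply: term_seq; apply: (term_le (leqnn _))
  (comp_correct_later (@term_comp _ _ _ _ eD) (leqnn 4) (leqnSn 4) (isT : all _ [::]) sm2 erefl ag3).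
move=> s4 [[_ rg4] v4]; do 5! step; decide_regs.
by rewrite !addn0 v4 rg4 // v3.
Qed.

(** * Exactness of the truncated multiplication *)

Section Multiplication.
Variable X : nat.

Lemma double_uptoP b : 0 < b -> b < 2 ^ X ->
  let p := iter X (double_upto b) 1 in p <= b < 2 * p.
Proof.
move=> b0 bX /=.
suff H k : iter k (double_upto b) 1 <= b /\
    (2 ^ k <= iter k (double_upto b) 1 \/ b < 2 * iter k (double_upto b) 1).
  by have [-> [le|->]] := H X; rewrite ?andbT //=; lia.
elim: k => [|k [le IH]] /=; first by rewrite expn0; split=> //; left.
move: (iter k _ 1) le IH => p le IH; rewrite /double_upto expnS; case: ifP => pb.
  by split=> //; case: IH => ?; [left|right]; lia.
by split=> //; right; lia.
Qed.

Lemma strip_inv a b k : let st := iter k (strip X a) (b, 0) in st.2 + a * st.1 = a * b.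
Proof.
elim: k => [|k IH] //=; rewrite /strip -{}IH.
by case: ifP => //= le; rewrite -addnA -mulnDr subnKC.
Qed.

(** Each round removes the leading binary digit of what is left of [b], so after k rounds the rest
    times 2 ^ k is still below 2 ^ X; after X rounds it is 0. *)
Lemma mulXE a b : b < 2 ^ X -> mulX X a b = a * b.
Proof.
move=> bX; have := strip_inv a b X; rewrite /mulX /=.
suff -> : (iter X (strip X a) (b, 0)).1 = 0 by rewrite muln0 addn0.
suff H k : (iter k (strip X a) (b, 0)).1 * 2 ^ k < 2 ^ X.
  have := H X; case: (_.1) => // u; rewrite mulSn; lia.
elim: k => [|k IH] /=; first by rewrite muln1.
move: (iter k _ _) IH => [u acc] /= IH; rewrite /strip /=.
have uX : u < 2 ^ X by apply: leq_ltn_trans IH; rewrite leq_pmulr // expn_gt0.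
case: (posnP u) => [->|u0]; first by case: ifP => _ //=; rewrite mul0n expn_gt0.
have /andP[p1 p2] := double_uptoP u0 uX.
rewrite p1 /=; apply: leq_ltn_trans IH; rewrite expnS mulnA leq_mul2r; apply/orP; right; lia.
Qed.

End Multiplication.

Lemma loop_rev S (F : nat -> S -> S) i k a : loop F i k.+1 a = F (i + k) (loop F i k a).
Proof.
elim: k i a => [|k IH] i a; first by rewrite addn0.
by rewrite -addSnnS; apply: IH.
Qed.

Lemma loop_ind S (F : nat -> S -> S) (P : nat -> S -> Prop) N a :
  P 0 a -> (forall i s, i < N -> P i s -> P i.+1 (F i s)) -> P N (loop F 0 N a).
Proof.
move=> P0 PS; suff H k : k <= N -> P k (loop F 0 k a) by apply: H.
elim: k => [//|k IH] kN; rewrite loop_rev; apply: PS => //.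
by apply: IH; apply: ltnW.
Qed.

Lemma loop_sum (F : nat -> nat -> nat) (g : nat -> nat) N : (forall i acc, i < N -> F i acc = acc + g i) ->
  loop F 0 N 0 = \sum_(i < N) g i.
Proof.
move=> E; apply: (loop_ind (P := fun k s => s = \sum_(i < k) g i)); first by rewrite big_ord0.
by move=> i s iN ->; rewrite E // big_ord_recr.
Qed.

Lemma loop_prod (F : nat -> nat -> nat) (g : nat -> nat) N :
  (forall i acc, i < N -> acc = \prod_(j < i) g j -> F i acc = acc * g i) ->
  loop F 0 N 1 = \prod_(i < N) g i.
Proof.
move=> E; apply: (loop_ind (P := fun k s => s = \prod_(i < k) g i)); first by rewrite big_ord0.
by move=> i s iN es; rewrite E // es big_ord_recr.
Qed.

(** * Derived arithmetic expressions *)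

Definition eLe a b := Cond (Minus a b) (Num 0) (Num 1).
Definition eLt a b := eLe (Plus a (Num 1)) b.
Definition eEq a b := Cond (Plus (Minus a b) (Minus b a)) (Num 0) (Num 1).
Definition ePow a b := App a b (Num 0) (Fold (Var 1) (Num 1) (Times (Var 0) (Var 2))).
(** The quotient is the number of i < a with (i + 1) b <= a. Passing the arguments through [App]
    evaluates them outside the loop, so their indices need no shift. *)
Definition eDiv a b := App a b (Num 0)
  (Fold (Var 0) (Num 0) (Plus (Var 0) (eLe (Times (Plus (Var 1) (Num 1)) (Var 3)) (Var 2)))).
Definition eMod a b := App a b (Num 0)
  (Minus (Var 0) (Times (eDiv (Var 0) (Var 1)) (Var 1))).
Definition eM := Plus Size Size.

Section Macros.
Variables (n l X : nat) (inp : nat -> nat).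
Local Notation ev := (eval n l X inp).

Lemma ev_le env mem a b : ev env mem (eLe a b) = (ev env mem a <= ev env mem b) :> nat.
Proof. by rewrite /= -/(_ <= _) /leq; case: eqP. Qed.

Lemma ev_lt env mem a b : ev env mem (eLt a b) = (ev env mem a < ev env mem b) :> nat.
Proof. by rewrite ev_le /= addn1. Qed.

Lemma ev_eq env mem a b : ev env mem (eEq a b) = (ev env mem a == ev env mem b) :> nat.
Proof.
rewrite /=; case: (eqVneq (ev env mem a)) => [->|ne]; first by rewrite subnn.
by rewrite ifT //; move: ne; lia.
Qed.

Lemma ev_pow env mem a b x y : ev env mem a = x -> ev env mem b = y ->
  y <= X -> x < 2 ^ X -> ev env mem (ePow a b) = x ^ y.
Proof.
move=> /= -> -> /minn_idPl -> xX; rewrite (loop_prod (g := fun=> x)) => [|i acc _ _].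
  by rewrite prod_nat_const card_ord.
by rewrite mulXE.
Qed.

Lemma ev_div env mem a b x y : ev env mem a = x -> ev env mem b = y ->
  x <= X -> 0 < y < 2 ^ X -> ev env mem (eDiv a b) = x %/ y.
Proof.
move=> ea eb xX /andP[y0 yX].
have -> : ev env mem (eDiv a b) = \sum_(i < x) ((i.+1 * y <= x) : nat).
  rewrite /eDiv; cbn [eval nth]; rewrite ea eb (minn_idPl xX).
  apply: (loop_sum (g := fun i => (i.+1 * y <= x) : nat)) => i acc _; cbn [eval nth].
  by rewrite ev_le /= mulXE // addn1.
rewrite (eq_bigr (fun i : 'I_x => if i < x %/ y then 1 else 0)) => [|i _]; last first.
  by rewrite -leq_divRL //; case: ltnP.
by rewrite -big_mkcond -(big_ord_widen _ (fun=> 1) (leq_div x y)) sum1_card card_ord.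
Qed.

Lemma ev_mod env mem a b x y : ev env mem a = x -> ev env mem b = y ->
  x <= X -> 0 < y < 2 ^ X -> ev env mem (eMod a b) = x %% y.
Proof.
move=> ea eb xX yX; rewrite /eMod; cbn [eval nth]; rewrite ea eb.
rewrite (@ev_div _ _ _ _ x y) //= mulXE; last by case/andP: yX.
by rewrite {1}(divn_eq x y) addKn.
Qed.

End Macros.

Local Open Scope nat_scope.

(** * The search program *)

Lemma sum_ord_le N (F : 'I_N -> nat) c : (forall i, F i <= c) -> \sum_(i < N) F i <= N * c.
Proof.
move=> FP; apply: leq_trans (_ : \sum_(i < N) c <= _); first exact: leq_sum.
by rewrite sum_nat_const card_ord.
Qed.

Lemma prod_ord_le N (F : 'I_N -> nat) c : (forall i, F i <= c) -> \prod_(i < N) F i <= c ^ N.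
Proof.
move=> FP; apply: leq_trans (_ : \prod_(i < N) c <= _); first exact: leq_prod.
by rewrite prod_nat_const card_ord.
Qed.

Lemma loop_ind2 S S' (F : nat -> S -> S) (F' : nat -> S' -> S') (P : S -> S' -> Prop) N a a' :
  P a a' -> (forall i s s', i < N -> P s s' -> P (F i s) (F' i s')) ->
  P (loop F 0 N a) (loop F' 0 N a').
Proof.
move=> P0 PS; suff H k : k <= N -> P (loop F 0 k a) (loop F' 0 k a') by apply: H.
elim: k => [//|k IH] kN; rewrite !loop_rev; apply: PS => //.
by apply: IH; apply: ltnW.
Qed.

Lemma mod8 A : A < 8 -> A %% 8 = A. Proof. exact: modn_small. Qed.

Fixpoint writes p : seq nat :=
  match p with
  | Put A _ _ => [:: A %% 8]
  | Then p q => writes p ++ writes q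
  | For _ p => writes p
  end.

Lemma run_frame n l X inp env mem p A : A \notin writes p ->
  run n l X inp env mem p A =1 mem A.
Proof.
elim: p env mem => [B a b|p IHp q IHq|a p IHp] env mem /=.
- by rewrite inE => AB i; rewrite /put (negPf AB).
- by rewrite mem_cat negb_or => /andP[Ap Aq] i; rewrite IHq ?IHp.
- move=> Ap; apply: (loop_ind (P := fun _ m => m A =1 mem A)) => // i m _ IH j.
  by rewrite IHp.
Qed.

Section TreeProgram.
Variables (n l X : nat) (inp : nat -> nat).
Local Notation ev := (eval n l X inp).

Variables (D B T H : nat) (eD eB eT eH : expr).
Hypothesis ev_D : forall env mem, ev env mem eD = D.
Hypothesis ev_B : forall env mem, ev env mem eB = B.
Hypothesis ev_T : forall env mem, ev env mem eT = T.
Hypothesis ev_H : forall env mem, ev env mem eH = H.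

Local Notation M := (n + n).

Definition adjn x y :=
  if x < n then if y < n then 0 else inp (x * n + (y - n))
  else if y < n then inp (y * n + (x - n)) else 0.

(** The numerator of (1 + 1 / B)^(tau v) over the common denominator B ^ T; it keeps all weights, as
    [wn] over [wd], in integers. *)
Definition yv (tau : nat -> nat) v := B.+1 ^ tau v * B ^ (T - tau v).
Definition wn tau x :=
  if x < n then B ^ T + \sum_(v < n) yv tau v * adjn x (n + v) else B ^ T.
Definition wd tau x := if x < n then B ^ T * D else yv tau (x - n).

(** A path is listed from its current end back to the root. The bound [i] is there because the ratio
    at vertex i is taken in the graph on the vertices i, i + 1, .... *)
Definition allowed i p x :=
  [&& i <= x, x \notin p & if p is z :: _ then adjn z x != 0 else true].

(* Numerator and denominator of the value of the truncated tree at the vertex x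
   reached along the path p, with h levels left; vertices below i are removed. *)
Fixpoint cell tau h i p x : nat * nat :=
  if h is h'.+1 then
    let ch y := if allowed i (x :: p) y then cell tau h' i (x :: p) y else (0, 1) in
    let Q := \prod_(y < M) (ch y).2 in
    let S := \sum_(y < M) (ch y).1 * \prod_(z < M) (if z == y then 1 else (ch z).2) in
    (Q * wd tau x, Q * wn tau x + S * wd tau x)
  else (wd tau x, wn tau x).

Definition gcell tau h i p x := if allowed i p x then cell tau h i p x else (0, 1).

(* The leading digit 1 makes the code of a path determine its length; the codes of
   its extensions are larger than its own. *)
Definition code (p : seq nat) := foldr (fun y c => c * M + y) 1 p.

(* Array 0 holds the exponents of the current column weights and array 1 those of the
   trial weights, arrays 2 and 3 the cells by path code, 4 and 5 the cells at the
   roots, 6 the numerators and denominators of both estimates, 7 the outcome of the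
   comparison. *)
Definition eAdj x y := App x y (Num 0)
  (Cond (eLt (Var 0) Size)
     (Cond (eLt (Var 1) Size) (Num 0)
        (Input (Plus (Times (Var 0) Size) (Minus (Var 1) Size))))
     (Cond (eLt (Var 1) Size)
        (Input (Plus (Times (Var 1) Size) (Minus (Var 0) Size))) (Num 0))).

Definition eY a v := App v (Num 0) (Num 0)
  (Times (ePow (Plus eB (Num 1)) (Get a (Var 0))) (ePow eB (Minus eT (Get a (Var 0))))).

Definition eWn a x := App x (Num 0) (Num 0)
  (Cond (eLt (Var 0) Size)
     (Plus (ePow eB eT) (Fold Size (Num 0)
        (Plus (Var 0) (Times (eY a (Var 1)) (eAdj (Var 2) (Plus Size (Var 1)))))))
     (ePow eB eT)).

Definition eWd a x := App x (Num 0) (Num 0)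
  (Cond (eLt (Var 0) Size) (Times (ePow eB eT) eD) (eY a (Minus (Var 0) Size))).

Definition eOn c y := App c y (Num 0)
  (Fold eH (Num 0)
    (App (Var 0) (eDiv (Var 2) (ePow eM (Var 1))) (Var 3)
       (Plus (Var 0) (Cond (eLe eM (Var 1)) (eEq (Var 2) (eMod (Var 1) eM)) (Num 0))))).

Definition eAllowed i c := App i (eDiv c eM) (eMod c eM)
  (Cond (eLe (Var 0) (Var 2))
     (Cond (eOn (Var 1) (Var 2)) (Num 0)
        (Cond (eLe eM (Var 1)) (eAdj (eMod (Var 1) eM) (Var 2)) (Num 1)))
     (Num 0)).

Definition eProdQ c := App c (Num 0) (Num 0)
  (Fold eM (Num 1) (Times (Var 0) (Get 3 (Plus (Times (Var 2) eM) (Var 1))))).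

Definition eSumP c := App c (Num 0) (Num 0)
  (Fold eM (Num 0) (Plus (Var 0)
    (Times (Fold eM (Num 1) (Times (Var 0)
              (Cond (eEq (Var 1) (Var 3)) (Num 1)
                 (Get 3 (Plus (Times (Var 4) eM) (Var 1))))))
           (Get 2 (Plus (Times (Var 2) eM) (Var 1)))))).

Definition eCellP a i c := App i c (Num 0)
  (Cond (eAllowed (Var 0) (Var 1))
     (Cond (eLe (ePow eM eH) (Var 1)) (eWd a (eMod (Var 1) eM))
        (Times (eProdQ (Var 1)) (eWd a (eMod (Var 1) eM))))
     (Num 0)).

Definition eCellQ a i c := App i c (Num 0)
  (Cond (eAllowed (Var 0) (Var 1))
     (Cond (eLe (ePow eM eH) (Var 1)) (eWn a (eMod (Var 1) eM))
        (Plus (Times (eProdQ (Var 1)) (eWn a (eMod (Var 1) eM)))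
              (Times (eSumP (Var 1)) (eWd a (eMod (Var 1) eM)))))
     (Num 1)).

Variable b0 : nat.
Hypothesis b0_gt0 : 0 < b0.
Hypothesis b0_big : n.+1 * D.+1 * B.+1 ^ T <= 2 ^ b0.
(** A bound on the bit length of a cell. The larger entry of a cell is a sum of M + 1 terms, each a
    product of at most M + 1 child entries and one weight, whence the factor 2 M + 2 per level. *)
Definition bits h := b0 * (2 * M + 2) ^ h.
Hypothesis X_big : (M + 2) * bits H < X.
Hypothesis H_gt0 : 0 < H.
Hypothesis codes_big : 2 * M ^ H <= X.
Hypothesis T_gt0 : 0 < T.
Hypothesis T_big : T <= X.
Hypothesis inp01 : forall k, inp k <= 1.
Hypothesis B_gt0 : 0 < B.

Lemma bits_le h : h <= H -> bits h <= bits H.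
Proof. by move=> hH; rewrite leq_mul2l leq_pexp2l ?orbT //; lia. Qed.

Lemma b0X : b0 < X.
Proof.
have := bits_le (leq0n H); rewrite {1}/bits muln1 => le.
apply: leq_ltn_trans X_big; apply: leq_trans le _.
by rewrite leq_pmull //; lia.
Qed.

Lemma small_lt2X a : a <= 2 ^ b0 -> a < 2 ^ X.
Proof. by move=> ab; apply: leq_ltn_trans ab _; rewrite ltn_exp2l // b0X. Qed.

Lemma BT_le : B.+1 ^ T <= 2 ^ b0.
Proof. by apply: leq_trans b0_big; rewrite leq_pmull. Qed.

Lemma D_lt : D < 2 ^ X.
Proof.
apply: small_lt2X; apply: leq_trans b0_big; have := expn_gt0 B.+1 T.
by move: (B.+1 ^ T) => /= u; nia.
Qed.

Lemma yv_le tau v : tau v <= T -> yv tau v <= B.+1 ^ T.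
Proof.
move=> tT; rewrite /yv -[X in _ <= _ ^ X](subnKC tT) expnD leq_mul2l; apply/orP; right.
by case: (T - tau v) => // k; rewrite leq_exp2r.
Qed.

Lemma adjn_le1 x y : adjn x y <= 1.
Proof. by rewrite /adjn; do 2!case: ifP. Qed.

Lemma BT_leS : B ^ T <= B.+1 ^ T.
Proof. by case: (T) => // k; rewrite leq_exp2r. Qed.

Lemma wn_le tau x : (forall v, tau v <= T) -> wn tau x <= 2 ^ b0.
Proof.
move=> tT; apply: leq_trans b0_big.
apply: leq_trans (_ : n.+1 * B.+1 ^ T <= _); last by rewrite leq_mul2r leq_pmulr ?orbT.
rewrite /wn mulSn; case: ifP => _; last exact: (leq_trans BT_leS (leq_addr _ _)).
apply: leq_add; first exact: BT_leS.
apply: sum_ord_le => v.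
by apply: leq_trans (leq_mul (yv_le (tT v)) (adjn_le1 _ _)) _; rewrite muln1.
Qed.

Lemma wd_le tau x : (forall v, tau v <= T) -> wd tau x <= 2 ^ b0.
Proof.
move=> tT; apply: leq_trans b0_big; rewrite /wd; case: ifP => _.
  rewrite mulnC leq_mul ?BT_leS //; nia.
by apply: leq_trans (yv_le (tT _)) _; rewrite leq_pmull.
Qed.

Lemma cell_le tau h i p x : (forall v, tau v <= T) ->
  (cell tau h i p x).1 <= 2 ^ bits h /\ (cell tau h i p x).2 <= 2 ^ bits h.
Proof.
move=> tT; elim: h p x => [|h IH] p x /=.
  by rewrite /bits muln1 wn_le ?wd_le.
pose ch (y : nat) := if allowed i (x :: p) y then cell tau h i (x :: p) y else (0, 1).
have ch_le y : (ch y).1 <= 2 ^ bits h /\ (ch y).2 <= 2 ^ bits h.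
  by rewrite /ch; case: ifP => _ //=; rewrite expn_gt0.
have prod_le (F : 'I_M -> nat) : (forall y, F y <= 2 ^ bits h) ->
    \prod_(y < M) F y <= 2 ^ (M * bits h).
  by move=> FP; rewrite mulnC expnM; apply: prod_ord_le.
have le1 : \prod_(y < M) (ch y).2 <= 2 ^ (M * bits h).
  by apply: prod_le => y; case: (ch_le y).
have le2 : \sum_(y < M) (ch y).1 * \prod_(z < M) (if z == y then 1 else (ch z).2)
    <= M * 2 ^ ((M + 1) * bits h).
  apply: sum_ord_le => y.
  rewrite addnC mulnDl mul1n expnD; apply: leq_mul; first by case: (ch_le y).
  by apply: prod_le => z; case: ifP => _; [rewrite expn_gt0|case: (ch_le z)].
have bE : b0 + M + (M + 1) * bits h <= bits h.+1.
  have bh : b0 <= bits h by rewrite /bits leq_pmulr // expn_gt0; lia.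
  rewrite /bits expnSr mulnA -/(bits h); nia.
have le3 : (M + 1) * 2 ^ ((M + 1) * bits h) * 2 ^ b0 <= 2 ^ bits h.+1.
  apply: leq_trans (_ : 2 ^ (b0 + M + (M + 1) * bits h) <= _); last by rewrite leq_pexp2l.
  move: (_ * bits h) => u; rewrite (expnD 2 (b0 + M)) (expnD 2 b0 M) mulnC -mulnA.
  by apply: leq_mul => //; apply: leq_mul => //; rewrite addn1; apply: ltn_expl.
have le4 : 2 ^ (M * bits h) <= 2 ^ ((M + 1) * bits h).
  by rewrite leq_pexp2l // leq_mul2r leq_addr orbT.
rewrite !addn1 in le2 le3 le4; split.
  apply: leq_trans le3; apply: leq_mul; last exact: wd_le.
  by apply: leq_trans le1 _; apply: leq_trans le4 _; rewrite leq_pmull.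
apply: leq_trans le3; rewrite mulSn mulnDl; apply: leq_add; apply: leq_mul.
- exact: leq_trans le1 le4.
- exact: wn_le.
- exact: le2.
- exact: wd_le.
Qed.

Lemma if_nat_of_bool (b : bool) (x y : nat) : (if (b : nat) != 0 then x else y) = if b then x else y.
Proof. by case: b. Qed.

Lemma ev_adj env mem a b x y : ev env mem a = x -> ev env mem b = y -> x < M -> y < M ->
  ev env mem (eAdj a b) = adjn x y.
Proof.
move=> ea eb xM yM; rewrite /eAdj; cbn [eval nth]; rewrite !ev_lt; cbn [eval nth].
rewrite ea eb /adjn.
have nX : n < 2 ^ X.
  by apply: small_lt2X; apply: leq_trans b0_big; have := expn_gt0 B.+1 T; nia.
case: ltnP => xn /=; case: ltnP => yn //=; rewrite ifT ?mulXE //; nia.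
Qed.

Lemma B_lt : B.+1 < 2 ^ X.
Proof.
apply: small_lt2X; apply: leq_trans BT_le.
by case: (T) T_gt0 => // k _; rewrite expnS leq_pmulr // expn_gt0.
Qed.

Lemma ev_BT env mem : ev env mem (ePow eB eT) = B ^ T.
Proof. by apply: ev_pow => //; apply: ltn_trans B_lt. Qed.

Lemma ev_Y env mem a b tau v : a < 8 -> mem a =1 tau -> (forall v, tau v <= T) ->
  ev env mem b = v -> ev env mem (eY a b) = yv tau v.
Proof.
move=> a8 ma tT eb; rewrite /eY; cbn [eval nth]; rewrite eb.
have e1 env' : nth 0 env' 0 = v -> ev env' mem (ePow (Plus eB (Num 1)) (Get a (Var 0))) = B.+1 ^ tau v.
  move=> e0; apply: ev_pow; rewrite /= ?ev_B ?addn1 ?e0 ?modn_small ?ma //.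
    by apply: leq_trans (tT v) _.
  exact: B_lt.
have e2 env' : nth 0 env' 0 = v -> ev env' mem (ePow eB (Minus eT (Get a (Var 0)))) = B ^ (T - tau v).
  move=> e0; apply: ev_pow; rewrite /= ?ev_B ?ev_T ?e0 ?modn_small ?ma //.
    by apply: leq_trans (leq_subr _ _) _.
  exact: ltn_trans B_lt.
rewrite e1 // e2 // mulXE //; apply: leq_ltn_trans (small_lt2X BT_le).
by apply: leq_trans BT_leS; rewrite leq_pexp2l // leq_subr.
Qed.

Lemma n_lt : n < 2 ^ X.
Proof. by apply: small_lt2X; apply: leq_trans b0_big; have := expn_gt0 B.+1 T; nia. Qed.

Lemma nX_le : 0 < n -> M <= X.
Proof.
move=> n0; apply: leq_trans codes_big; rewrite -(prednK H_gt0) expnS mulnCA.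
by rewrite leq_pmulr // muln_gt0 expn_gt0 addn_gt0 n0.
Qed.

Lemma ev_wn env mem a b tau x : a < 8 -> mem a =1 tau -> (forall v, tau v <= T) ->
  ev env mem b = x -> x < M -> ev env mem (eWn a b) = wn tau x.
Proof.
move=> a8 ma tT eb xM; rewrite /eWn; cbn [eval nth]; rewrite ev_lt; cbn [eval nth].
rewrite eb /wn if_nat_of_bool; case: ifP => _; last exact: ev_BT.
rewrite ev_BT (minn_idPl _); last by have := nX_le; lia.
congr (_ + _); apply: (loop_sum (g := fun v => yv tau v * adjn x (n + v))) => v acc vn.
rewrite (@ev_Y _ _ _ _ tau v) // (@ev_adj _ _ _ _ x (n + v)) //; last by lia.
by rewrite mulXE // (leq_ltn_trans (adjn_le1 _ _)) // (leq_trans _ B_lt).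
Qed.

Lemma ev_wd env mem a b tau x : a < 8 -> mem a =1 tau -> (forall v, tau v <= T) ->
  ev env mem b = x -> ev env mem (eWd a b) = wd tau x.
Proof.
move=> a8 ma tT eb; rewrite /eWd; cbn [eval nth]; rewrite ev_lt; cbn [eval nth].
rewrite eb /wd if_nat_of_bool; case: ifP => _.
  by rewrite ev_BT ev_D mulXE // D_lt.
by apply: ev_Y => //=; rewrite eb.
Qed.

Definition good (p : seq nat) := all (fun y => y < M) p.

Lemma code_bounds p : good p -> M ^ size p <= code p < 2 * M ^ size p.
Proof.
elim: p => [|y p IH] //= /andP[yM /IH]; rewrite expnS; move: (M ^ _) (code p) => u c; nia.
Qed.

Lemma code_consE y p : y < M -> code (y :: p) %/ M = code p /\ code (y :: p) %% M = y.
Proof.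
move=> yM /=; have M0 : 0 < M by lia.
by rewrite divnMDl // divn_small // addn0 modnMDl modn_small.
Qed.

Lemma code_big y p : y < M -> good p -> M <= code (y :: p).
Proof.
move=> yM /code_bounds /andP[+ _]; have : 0 < M ^ size p by rewrite expn_gt0; lia.
by rewrite /=; move: (M ^ _) (code p) => u c; nia.
Qed.

Lemma code_drop p j : good p -> j <= size p -> code p %/ M ^ j = code (drop j p).
Proof.
elim: j p => [|j IH] p gp jp; first by rewrite drop0 divn1.
case: p gp jp => // y p /andP[yM gp] jp.
by rewrite expnS divnMA (code_consE p yM).1 IH.
Qed.

Lemma code_lt p : good p -> size p < H -> 1 < M -> code p < M ^ H.
Proof.
move=> gp pH M1; have /andP[_ lt] := code_bounds gp; apply: leq_trans lt _.
apply: leq_trans (_ : M ^ (size p).+1 <= _); last by rewrite leq_pexp2l //; lia.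
by rewrite expnS leq_mul2r M1 orbT.
Qed.

Lemma codeX p : good p -> size p <= H -> 0 < n -> code p < X.
Proof.
move=> gp pH n0; have /andP[_ lt] := code_bounds gp; apply: leq_trans lt _.
by apply: leq_trans codes_big; rewrite leq_mul2l leq_pexp2l //; lia.
Qed.

Lemma MH_lt j : j <= H -> 0 < n -> M ^ j < 2 ^ X.
Proof.
move=> jH n0; apply: leq_ltn_trans (_ : X < _); last exact: ltn_expl.
apply: leq_trans codes_big; apply: leq_trans (_ : M ^ H <= _); last by rewrite leq_pmull.
by rewrite leq_pexp2l //; lia.
Qed.

Lemma M_lt : 0 < n -> 0 < M < 2 ^ X.
Proof. by move=> n0; have := MH_lt H_gt0 n0; rewrite expn1 => ->; rewrite andbT; lia. Qed.

Lemma H_le : H <= X.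
Proof.
apply: leq_trans (ltnW X_big); rewrite /bits.
apply: leq_trans (_ : (2 * M + 2) ^ H <= _); last first.
  by rewrite mulnA leq_pmull // muln_gt0 b0_gt0; lia.
by apply: ltnW; apply: ltn_expl; lia.
Qed.

(** Digit j of the code is examined only while the quotient by M ^ j is at least M; below that only
    the leading 1, or nothing, is left, and it must not be taken for a vertex. *)
Lemma ev_on env mem a b p y : ev env mem a = code p -> ev env mem b = y ->
  good p -> size p <= H -> y < M ->
  (ev env mem (eOn a b) != 0) = (y \in p).
Proof.
move=> ea eb gp pH yM; have n0 : 0 < n by lia.
rewrite /eOn; cbn [eval nth]; rewrite ev_H (minn_idPl H_le).
have evM env' mem' : ev env' mem' eM = M by [].
pose g j := if (M <= code p %/ M ^ j) && (y == code p %/ M ^ j %% M) then 1 else 0.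
rewrite (loop_sum (g := g)) => [|j acc jH]; last first.
  have pj : ev [:: acc, j & [:: ev env mem a; ev env mem b; 0]] mem (ePow eM (Var 1)) = M ^ j.
    apply: ev_pow => //=; first by have := H_le; lia.
    by have /andP[] := M_lt n0.
  have := codeX gp pH n0 => cX.
  have dj : ev [:: acc, j & [:: ev env mem a; ev env mem b; 0]] mem
      (eDiv (Var 2) (ePow eM (Var 1))) = code p %/ M ^ j.
    apply: ev_div pj _ _ => //; first by rewrite ltnW.
    by rewrite expn_gt0 MH_lt ?(ltnW jH) //; lia.
  cbn [eval nth]; rewrite dj ev_le; cbn [eval nth]; rewrite evM /g if_nat_of_bool.
  case: leqP => le; cbv iota; last by rewrite addn0.
  rewrite ev_eq; cbn [eval nth]; rewrite eb (@ev_mod _ _ _ _ _ _ _ _ (code p %/ M ^ j) M) //.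
  - by apply: leq_trans (leq_div _ _) _; rewrite ltnW.
  - exact: M_lt.
rewrite sum_nat_eq0 -(negbK (y \in p)); congr (~~ _).
apply/forallP/idP => [H0|yp j].
  apply/negP => yp; have ip : index y p < H by apply: leq_trans pH; rewrite index_mem.
  have := H0 (Ordinal ip); rewrite /= /g code_drop //; last by rewrite ltnW ?index_mem.
  rewrite (drop_nth 0) ?index_mem // nth_index // (code_consE _ yM).2 eqxx andbT.
  by rewrite code_big //; apply/allP => z /mem_drop; apply: (allP gp).
rewrite /= /g; case: (ltnP j (size p)) => jp; last first.
  rewrite ifF //; apply/negbTE; rewrite negb_and -ltnNge; apply/orP; left.
  rewrite ltn_divLR ?expn_gt0; last by lia.
  have /andP[_ lt] := code_bounds gp; apply: leq_trans lt _.
  by rewrite leq_mul ?leq_pexp2l //; lia.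
rewrite code_drop ?(ltnW jp) // (drop_nth 0) //.
have zM : nth 0 p j < M by apply: (all_nthP 0 gp).
rewrite (code_consE _ zM).2 ifF //; apply/negbTE; rewrite negb_and; apply/orP; right.
by apply: contraNneq yp => ->; apply: mem_nth.
Qed.

Lemma ev_allowed env mem a b i x p : ev env mem a = i -> ev env mem b = code (x :: p) ->
  x < M -> good p -> size p < H ->
  (ev env mem (eAllowed a b) != 0) = allowed i p x.
Proof.
move=> ea eb xM gp pH; have n0 : 0 < n by lia.
have gxp : good (x :: p) by rewrite /= xM.
have cX := codeX gxp pH n0.
have M0X := M_lt n0.
have evM env' : ev env' mem eM = M by [].
have [cd cm] := code_consE p xM.
have e1 : ev env mem (eDiv b eM) = code p by rewrite -cd; apply: ev_div => //; rewrite ltnW.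
have e2 : ev env mem (eMod b eM) = x by rewrite -[in RHS]cm; apply: ev_mod => //; rewrite ltnW.
rewrite /eAllowed; cbn [eval nth]; rewrite e1 e2 ea ev_le; cbn [eval nth]; rewrite /allowed.
rewrite if_nat_of_bool; case: leqP => ix; cbv iota; last by [].
rewrite -(@ev_on [:: i; code p; x] mem (Var 1) (Var 2) p x) //; last exact: ltnW.
case: (ev _ _ (eOn _ _) != 0) => //; cbv iota; rewrite ev_le evM; cbn [eval nth].
rewrite if_nat_of_bool.
case: p gp pH {gxp cX cd cm e1 eb} => [|z p] gp pH.
  by rewrite leqNgt (_ : code [::] < M) //=; lia.
have /andP[zM gp'] : good (z :: p) := gp.
rewrite code_big //; cbv iota; rewrite (@ev_adj _ _ _ _ z x) //.
have [_ cm] := code_consE p zM; rewrite -[in RHS]cm; apply: ev_mod => //.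
by apply: ltnW; apply: codeX gp _ n0; apply: ltnW.
Qed.

(** * Tabulation of the truncated tree by path codes *)

Section Cells.
Variables (tau : nat -> nat) (a i : nat).
Hypothesis a8 : a < 8.
Hypothesis tau_le : forall v, tau v <= T.

Definition cell_at (mem : nat -> nat -> nat) p :=
  if p is x :: p' then
    mem 2 (code p) = (gcell tau (H - size p) i p' x).1 /\
    mem 3 (code p) = (gcell tau (H - size p) i p' x).2
  else True.

Lemma gcell_lt h p x : h <= H ->
  (gcell tau h i p x).1 < 2 ^ X /\ (gcell tau h i p x).2 < 2 ^ X.
Proof.
move=> hH; have : bits h < X.
  apply: leq_ltn_trans X_big; apply: leq_trans (bits_le hH) _.
  by rewrite leq_pmull //; lia.
move=> bX; have lt u : u <= 2 ^ bits h -> u < 2 ^ X.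
  by move=> le; apply: leq_ltn_trans le _; rewrite ltn_exp2l.
have [c1 c2] := @cell_le tau h i p x tau_le; rewrite /gcell.
case: ifP => _; first by split; apply: lt.
by split; rewrite ?expn_gt0 //= -{1}(expn0 2) ltn_exp2l //; lia.
Qed.

(** A path has full length H exactly when its code reaches M ^ H, so the test for a leaf needs only
    the code. Otherwise the children sit at the codes c M + y, assumed to be filled in already. *)
Lemma ev_cell env mem e1 e2 p x : mem a =1 tau ->
  ev env mem e1 = i -> ev env mem e2 = code (x :: p) ->
  good (x :: p) -> size p < H ->
  (size (x :: p) < H -> forall y, y < M -> cell_at mem (y :: x :: p)) ->
  ev env mem (eCellP a e1 e2) = (gcell tau (H - size (x :: p)) i p x).1 /\
  ev env mem (eCellQ a e1 e2) = (gcell tau (H - size (x :: p)) i p x).2.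
Proof.
move=> ma ei ec gxp pH ch; have /andP[xM gp] := gxp; have n0 : 0 < n by lia.
have M0X := M_lt n0; have cX := codeX gxp pH n0.
have [cd cm] := code_consE p xM.
rewrite /eCellP /eCellQ; cbn [eval nth]; rewrite ei ec.
set c := code _ in cX cd cm *.
have al : (ev [:: i; c; 0] mem (eAllowed (Var 0) (Var 1)) != 0) = allowed i p x.
  exact: ev_allowed.
have evx : ev [:: i; c; 0] mem (eMod (Var 1) eM) = x.
  by rewrite -[in RHS]cm; apply: ev_mod => //; apply: ltnW.
have evd : ev [:: i; c; 0] mem (eWd a (eMod (Var 1) eM)) = wd tau x by apply: ev_wd.
have evn : ev [:: i; c; 0] mem (eWn a (eMod (Var 1) eM)) = wn tau x by apply: ev_wn.
have wdX : wd tau x < 2 ^ X by apply/small_lt2X/wd_le.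
have wnX : wn tau x < 2 ^ X by apply/small_lt2X/wn_le.
rewrite al ev_le evd evn; cbn [eval nth]; rewrite /gcell.
have -> : ev [:: i; c; 0] mem (ePow eM eH) = M ^ H.
  by apply: ev_pow => //; [apply: H_le|case/andP: M0X].
case: ifP => // ok; rewrite !if_nat_of_bool.
case: (ltnP (size (x :: p)) H) => szH; last first.
  have E : size (x :: p) = H by apply/eqP; rewrite eqn_leq szH pH.
  have /andP[le _] := code_bounds gxp; rewrite E in le.
  by rewrite E subnn !ifT.
have M1 : 1 < M by lia.
have lt : c < M ^ H := code_lt gxp szH M1; rewrite leqNgt lt [~~ true]/=; cbv iota.
have -> : H - size (x :: p) = (H - (size (x :: p)).+1).+1 by lia.
set h := H - _; cbn [cell fst snd].
have hH : h <= H by apply: leq_subr.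
pose g := gcell tau h i (x :: p).
have chE y : y < M -> mem 2 (c * M + y) = (g y).1 /\ mem 3 (c * M + y) = (g y).2.
  by move=> yM; apply: (ch szH y yM).
have gX y : (g y).1 < 2 ^ X /\ (g y).2 < 2 ^ X by apply: gcell_lt.
have MX := nX_le n0.
have eq1 : ev [:: i; c; 0] mem (eProdQ (Var 1)) = \prod_(y < M) (g y).2.
  rewrite /eProdQ; cbn [eval nth]; rewrite (minn_idPl MX).
  apply: (loop_prod (g := fun y => (g y).2)) => y acc yM _; cbn [eval nth].
  rewrite (mulXE _ (proj2 (andP M0X))) (@mod8 3 isT) (chE y yM).2 mulXE //.
  by case: (gX y).
have eq2 : ev [:: i; c; 0] mem (eSumP (Var 1)) =
    \sum_(y < M) (g y).1 * \prod_(z < M) (if (z : nat) == y then 1 else (g z).2).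
  rewrite /eSumP /eM; cbn [eval nth]; rewrite (minn_idPl MX).
  pose sumP (y : nat) := (g y).1 * \prod_(z < M) (if (z : nat) == y then 1 else (g z).2).
  apply: (loop_sum (g := sumP)) => y acc yM; cbn [eval nth]; congr (_ + _).
  rewrite (mulXE _ (proj2 (andP M0X))) (@mod8 2 isT) (chE y yM).1 mulXE; last by case: (gX y).
  rewrite mulnC; congr (_ * _).
  apply: (loop_prod (g := fun z => if z == y then 1 else (g z).2)) => z acc' zM _.
  cbn [eval nth]; rewrite ev_eq; cbn [eval nth]; rewrite if_nat_of_bool.
  rewrite (@mod8 3 isT) (chE z zM).2 mulXE //.
  by case: ifP => _; [rewrite -{1}(expn0 2) ltn_exp2l //; have := b0X; lia|case: (gX z)].
by rewrite eq1 eq2 !mulXE.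
Qed.

Definition eCodes := Times (Num 2) (ePow eM eH).
(** Codes are visited downwards, so that every extension of a path is tabulated before the path. *)
Definition eCode := Minus (Minus eCodes (Num 1)) (Var 0).

Definition pCells := For eCodes
  (Then (Put 2 eCode (eCellP a (Var 1) eCode)) (Put 3 eCode (eCellQ a (Var 1) eCode))).

Lemma run_cells env mem : 0 < n -> a < 2 -> mem a =1 tau ->
  let mem' := run n l X inp (i :: env) mem pCells in
  forall p, good p -> size p <= H -> cell_at mem' p.
Proof.
move=> n0 a2 ma; rewrite /pCells; cbn [run]; set F := fun j m => _.
have evM env' mem' : ev env' mem' eM = M by [].
have /andP[M0 MX] := M_lt n0.
have evN env' mem' : ev env' mem' eCodes = 2 * M ^ H.
  rewrite /eCodes; cbn [eval]; rewrite (@ev_pow _ _ _ _ _ _ _ _ M H) //; last exact: H_le.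
  by rewrite mulXE // MH_lt.
rewrite evN (minn_idPl codes_big); set N := 2 * M ^ H => p gp pH.
suff H1 : (loop F 0 N mem) a =1 tau /\
    forall p, good p -> size p <= H -> N - N <= code p -> cell_at (loop F 0 N mem) p.
  by apply: (proj2 H1) => //; rewrite subnn.
move: p gp pH => _ _ _.
apply: (loop_ind (P := fun j m => m a =1 tau /\ forall p, good p -> size p <= H ->
   N - j <= code p -> cell_at m p)) => [|j m jN [mt IH]].
  split=> // p gp pH; rewrite subn0 => le; exfalso.
  have /andP[_ lt] := code_bounds gp.
  suff : code p < N by rewrite ltnNge le.
  by apply: leq_trans lt _; rewrite leq_mul2l leq_pexp2l.
pose env1 := [:: j, i & env]; pose c := N - 1 - j.
have evC m' : ev env1 m' eCode = c by rewrite /eCode; cbn [eval nth]; rewrite evN.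
rewrite /F; cbn [run]; rewrite -/env1 !evC.
set v2 := ev env1 m _; set m1 := put m 2 c v2; set v3 := ev env1 m1 _.
have fr A k : (A != 2) && (A != 3) || (k != c) -> put m1 3 c v3 A k = m A k.
  rewrite /m1 /put (@mod8 3 isT) (@mod8 2 isT).
  by case: (A =P 2); case: (A =P 3) => //=; case: (k =P c).
split=> [v|p gp pH le]; first by rewrite fr ?mt //; lia.
have other q : good q -> size q <= H -> c < code q -> cell_at (put m1 3 c v3) q.
  move=> gq qH lt; have le' : N - j <= code q by move: lt; rewrite /c; lia.
  have := IH q gq qH le'; have ne : code q != c by rewrite gtn_eqF.
  case: q gq qH lt le' ne => [//|y q] gq qH lt le' ne; rewrite /cell_at.
  by rewrite !fr ?ne ?orbT.
have [E|ne] := eqVneq (code p) c; last by apply: other => //; move: ne le; rewrite /c; lia.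
case: p gp pH le E => [//|x p] gp pH le E.
(* For c = 0 the child code c M + y need not exceed c; the leading 1 excludes this. *)
have c0 : 0 < c.
  by rewrite -E; have /andP[+ _] := code_bounds gp; apply: leq_trans; rewrite expn_gt0 M0.
have child y : y < M -> c < code [:: y, x & p].
  move=> yM; have -> : code [:: y, x & p] = c * M + y by move: E; rewrite /code /= => ->.
  by move: c0 yM; clear; move: c => u; nia.
have ch : size (x :: p) < H -> forall y, y < M -> cell_at m (y :: x :: p).
  move=> sz y yM; apply: IH => //; first by apply/andP; split.
  by have := child y yM; rewrite /c; lia.
have ch1 : size (x :: p) < H -> forall y, y < M -> cell_at m1 (y :: x :: p).
  move=> sz y yM; have := ch sz y yM; have := child y yM; rewrite /cell_at.
  move: (code _) => k ck; rewrite /m1 /put (@mod8 2 isT) andbC.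
  by rewrite (gtn_eqF ck).
have m1t : m1 a =1 tau.
  by move=> v; rewrite /m1 /put (@mod8 2 isT) ltn_eqF //= mt.
have [v2E _] := @ev_cell env1 m (Var 1) eCode p x mt erefl (etrans (evC m) (esym E)) gp pH ch.
have [_ v3E] := @ev_cell env1 m1 (Var 1) eCode p x m1t erefl (etrans (evC m1) (esym E)) gp pH ch1.
rewrite -/v2 in v2E; rewrite -/v3 in v3E; rewrite /cell_at E v3E /m1 v2E /put (@mod8 3 isT) (@mod8 2 isT).
by rewrite !eqxx.
Qed.
End Cells.

(** The path consisting of the root i alone has code M + i. The tables are refilled for each
    root. *)
Definition pTree a := For eM (Then (pCells a)
  (Then (Put 4 (Var 0) (Get 2 (Plus eM (Var 0)))) (Put 5 (Var 0) (Get 3 (Plus eM (Var 0)))))).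

Lemma run_tree env mem tau a : a < 2 -> mem a =1 tau -> (forall v, tau v <= T) ->
  let mem' := run n l X inp env mem (pTree a) in
  forall i, i < M -> mem' 4 i = (cell tau H.-1 i [::] i).1 /\
                     mem' 5 i = (cell tau H.-1 i [::] i).2.
Proof.
move=> a2 ma tT; rewrite /pTree; cbn [run]; set F := fun j m => _; move=> i iM.
have n0 : 0 < n by lia.
have -> : minn (ev env mem eM) X = M by apply/minn_idPl/nX_le.
suff: loop F 0 M mem a =1 tau /\ forall i, i < M ->
    loop F 0 M mem 4 i = (cell tau H.-1 i [::] i).1 /\
    loop F 0 M mem 5 i = (cell tau H.-1 i [::] i).2 by case=> _; apply.
apply: (loop_ind (P := fun j m => m a =1 tau /\ forall i, i < j ->
    m 4 i = (cell tau H.-1 i [::] i).1 /\ m 5 i = (cell tau H.-1 i [::] i).2)).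
  by split=> //.
move=> j m jM [mt IH]; rewrite /F; cbn [run].
set m1 := run _ _ _ _ _ _ (pCells a).
have fr A : (A != 2) && (A != 3) -> m1 A =1 m A.
  by move=> A23; apply: run_frame; rewrite /= !inE; lia.
have := @run_cells tau a j _ tT env m n0 a2 mt [:: j].
case=> [|//|//|]; [lia|by rewrite /good /= jM|].
rewrite -/m1 /gcell /allowed leqnn subn1 /= mul1n => c2 c3; clearbody m1.
rewrite !(@mod8 2 isT) !(@mod8 3 isT).
split=> [w|k]; rewrite /put /=; first by rewrite !ifF ?fr //; lia.
rewrite ltnS leq_eqVlt => /predU1P[->|kj].
  by rewrite eqxx c2 c3.
by rewrite ltn_eqF // !fr //; apply: IH.
Qed.

(** The matching sum is the product of the inverse ratios, so the denominators of the cells form the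
    numerator. *)
Definition zn tau := \prod_(i < M) (cell tau H.-1 i [::] i).2.
Definition zd tau := \prod_(i < M) (cell tau H.-1 i [::] i).1.

Lemma z_lt tau : (forall v, tau v <= T) -> zn tau < 2 ^ X /\ zd tau < 2 ^ X.
Proof.
move=> tT; have bX : bits H.-1 * M < X.
  apply: leq_ltn_trans X_big; rewrite mulnC leq_mul ?leq_addr ?bits_le //; exact: leq_pred.
have lt u : u <= (2 ^ bits H.-1) ^ M -> u < 2 ^ X.
  by move=> le; apply: leq_ltn_trans le _; rewrite -expnM ltn_exp2l.
by split; apply/lt/prod_ord_le => i; case: (@cell_le tau H.-1 i [::] i tT).
Qed.

Lemma minM : minn M X = M.
Proof. by case: (posnP n) => [->|/nX_le/minn_idPl //]; rewrite min0n. Qed.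

Definition pEval a k := Then (pTree a)
  (Then (Put 6 (Num (2 * k)) (Fold eM (Num 1) (Times (Var 0) (Get 5 (Var 1)))))
        (Put 6 (Num (2 * k).+1) (Fold eM (Num 1) (Times (Var 0) (Get 4 (Var 1)))))).

Lemma run_eval env mem tau a k : a < 2 -> mem a =1 tau -> (forall v, tau v <= T) ->
  let mem' := run n l X inp env mem (pEval a k) in
  [/\ mem' 6 (2 * k) = zn tau, mem' 6 (2 * k).+1 = zd tau &
     forall j, j != 2 * k -> j != (2 * k).+1 -> mem' 6 j = mem 6 j].
Proof.
move=> a2 ma tT mem'; rewrite /mem' /pEval {mem'}; cbn [run].
set m1 := run _ _ _ _ _ _ (pTree a).
have H1 := run_tree env a2 ma tT; rewrite -/m1 in H1.
have fr : m1 6 =1 mem 6 by apply: run_frame.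
clearbody m1.
have -> : ev env m1 (Fold eM (Num 1) (Times (Var 0) (Get 5 (Var 1)))) = zn tau.
  rewrite /eM; cbn [eval nth]; rewrite minM.
  apply: (loop_prod (g := fun i => (cell tau H.-1 i [::] i).2)) => i acc iM _.
  rewrite (@mod8 5 isT) (H1 i iM).2 mulXE //.
  have [_ le] := @cell_le tau H.-1 i [::] i tT; apply: leq_ltn_trans le _.
  rewrite ltn_exp2l //; apply: leq_ltn_trans X_big.
  by apply: leq_trans (bits_le (leq_pred H)) _; rewrite leq_pmull //; lia.
set m2 := put m1 6 (2 * k) (zn tau).
have fr4 j : m2 4 j = m1 4 j by rewrite /m2 /put.
have -> : ev env m2 (Fold eM (Num 1) (Times (Var 0) (Get 4 (Var 1)))) = zd tau.
  rewrite /eM; cbn [eval nth]; rewrite minM.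
  apply: (loop_prod (g := fun i => (cell tau H.-1 i [::] i).1)) => i acc iM _.
  rewrite (@mod8 4 isT) fr4 (H1 i iM).1 mulXE //.
  have [le _] := @cell_le tau H.-1 i [::] i tT; apply: leq_ltn_trans le _.
  rewrite ltn_exp2l //; apply: leq_ltn_trans X_big.
  by apply: leq_trans (bits_le (leq_pred H)) _; rewrite leq_pmull //; lia.
rewrite /m2 /put !(@mod8 6 isT) /=; split.
- by rewrite eqxx (ltn_eqF (ltnSn _)).
- by rewrite eqxx.
by move=> j j1 j2; rewrite (negPf j1) (negPf j2) fr.
Qed.

Lemma run_then env mem p q : run n l X inp env mem (Then p q) =
  run n l X inp env (run n l X inp env mem p) q.
Proof. by []. Qed.

Lemma run_put env mem A e e' : run n l X inp env mem (Put A e e') =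
  put mem A (ev env mem e) (ev env mem e').
Proof. by []. Qed.

Lemma run_map env mem A e (f : nat -> nat) : A < 8 ->
  (forall m w, w < n -> m A w = mem A w -> (forall B, B != A -> m B =1 mem B) ->
     ev (w :: env) m e = f w) ->
  let mem' := run n l X inp env mem (For Size (Put A (Var 0) e)) in
  (forall w, mem' A w = if w < n then f w else mem A w) /\
  (forall B, B != A -> mem' B =1 mem B).
Proof.
move=> A8 fP mem'; rewrite /mem' {mem'}; cbn [run]; set F := fun j m => _.
have -> : minn (ev env mem Size) X = n.
  apply/minn_idPl => /=; case: (posnP n) => [->//|n0]; have := nX_le n0; lia.
apply: (loop_ind (P := fun j m => (forall w, m A w = if w < j then f w else mem A w) /\
  (forall B, B != A -> m B =1 mem B))).
  by split=> // w; rewrite ltn0.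
move=> j m jn [IH1 IH2]; rewrite /F; cbn [run]; rewrite (fP m j) //; last by rewrite IH1 ltnn.
split=> [w|B0 BA w]; rewrite /put modn_small //; last by rewrite (negPf BA) IH2.
by rewrite eqxx /= ltnS leq_eqVlt IH1; case: eqP => [->|].
Qed.

(** * Local search over the grid of weights *)

Variables (K NP : nat) (eK eNP : expr).
Hypothesis ev_K : forall env mem, ev env mem eK = K.
Hypothesis ev_NP : forall env mem, ev env mem eNP = NP.
Hypothesis K_lt : K.+1 < 2 ^ X.
Hypothesis NP_le : NP <= X.

Definition move (tau : nat -> nat) (v d w : nat) : nat :=
  if w == v then
    if d != 0 then tau w - 1 else if tau w < T then tau w + 1 else tau w
  else tau w.

Definition accepts tau tau' := zn tau' * K.+1 * zd tau <= zn tau * K * zd tau'.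

Definition try_move tau v d := if accepts tau (move tau v d) then move tau v d else tau.

Definition pass tau := loop (fun v t => loop (fun d t => try_move t v d) 0 2 t) 0 n tau.

Definition search := loop (fun _ t => pass t) 0 NP (fun=> 0).

Lemma move_le tau v d : (forall v, tau v <= T) -> forall w, move tau v d w <= T.
Proof.
move=> tT w; have := tT w; rewrite /move; clear.
by do ! case: ifP => //; lia.
Qed.

Lemma try_move_le tau v d : (forall v, tau v <= T) -> forall w, try_move tau v d w <= T.
Proof. by move=> tT; rewrite /try_move; case: ifP => // _; apply: move_le. Qed.

Lemma pass_le tau : (forall v, tau v <= T) -> forall w, pass tau w <= T.
Proof.
move=> tT; rewrite /pass; apply: (loop_ind (P := fun _ (t : nat -> nat) => forall w, t w <= T)) => //.
move=> v t _ {}tT; apply: (loop_ind (P := fun _ (t : nat -> nat) => forall w, t w <= T)) => //.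
by move=> d t' _ {}tT; apply: try_move_le.
Qed.

Lemma search_le w : search w <= T.
Proof.
move: w; rewrite /search; apply: (loop_ind (P := fun _ (t : nat -> nat) => forall w, t w <= T)) => //.
by move=> v t _ tT; apply: pass_le.
Qed.

Definition eMove := Cond (eEq (Var 0) (Var 2))
  (Cond (Var 1) (Minus (Get 0 (Var 0)) (Num 1))
     (Cond (eLt (Get 0 (Var 0)) eT) (Plus (Get 0 (Var 0)) (Num 1)) (Get 0 (Var 0))))
  (Get 0 (Var 0)).

Definition eAccept := eLe
  (Times (Times (Get 6 (Num 2)) (Plus eK (Num 1))) (Get 6 (Num 1)))
  (Times (Times (Get 6 (Num 0)) eK) (Get 6 (Num 3))).

Definition pTry :=
  Then (For Size (Put 1 (Var 0) eMove))
  (Then (pEval 0 0) (Then (pEval 1 1) (Then (Put 7 (Num 0) eAccept)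
  (For Size (Put 0 (Var 0) (Cond (Get 7 (Num 0)) (Get 1 (Var 0)) (Get 0 (Var 0)))))))).

(** The last clause makes the arrays agree with the exponent functions everywhere, although the
    program copies only the first n cells. *)
Definition state_ok (mem : nat -> nat -> nat) (tau : nat -> nat) :=
  [/\ mem 0 =1 tau, forall v, tau v <= T & forall w, n <= w -> tau w = 0 /\ mem 1 w = 0].

Lemma run_try v d env mem tau : v < n -> state_ok mem tau ->
  state_ok (run n l X inp [:: d, v & env] mem pTry) (try_move tau v d).
Proof.
move=> vn [m0 tT t0]; rewrite /pTry 4!run_then run_put; set env1 := [:: d, v & env].
have [||] := @run_map env1 mem 1 eMove (move tau v d) _ _.
- by [].
- move=> m w wn mw fr; rewrite /eMove /move; cbn [eval nth]; rewrite ev_eq ev_lt.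
  cbn [eval nth]; rewrite !if_nat_of_bool ev_T !(@mod8 0 isT) !(fr 0) // !m0.
  by [].
set m1 := run _ _ _ _ _ _ (For _ _) => a1 fr1.
clearbody m1; have m1t : m1 1 =1 move tau v d.
  move=> w; rewrite a1; case: ltnP => // nw; have [tw ->] := t0 w nw.
  rewrite /move ifF //; apply/eqP; lia.
have m1t0 : m1 0 =1 tau by move=> w; rewrite fr1.
have [] := @run_eval env1 m1 tau 0 0 _ m1t0 tT; first by [].
set m2 := run _ _ _ _ _ _ (pEval 0 0) => z0 z1 _.
have fr2 A : A < 2 -> m2 A =1 m1 A.
  by move=> A2; apply: run_frame; case: A A2 => [|[|]].
clearbody m2; have m2t : m2 1 =1 move tau v d by move=> w; rewrite fr2.
have [] := @run_eval env1 m2 _ 1 1 _ m2t (move_le v d tT); first by [].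
set m3 := run _ _ _ _ _ _ (pEval 1 1) => z2 z3 frz.
have fr3 A : A < 2 -> m3 A =1 m2 A.
  by move=> A2; apply: run_frame; case: A A2 => [|[|]].
clearbody m3; have [zX zX'] := z_lt tT; have [yX yX'] := z_lt (move_le v d tT).
have acc : ev env1 m3 eAccept = accepts tau (move tau v d).
  rewrite /eAccept ev_le; cbn [eval nth]; rewrite ev_K !(@mod8 6 isT).
  rewrite !(frz 0) // !(frz 1) // z0 z1 z2 z3 addn1.
  by rewrite !mulXE //; apply: ltnW.
rewrite acc [ev env1 m3 (Num 0)]/=; set m4 := put m3 7 _ _.
have m47 : m4 7 0 = accepts tau (move tau v d) by rewrite /m4 /put.
have m4t : m4 0 =1 tau by move=> w; rewrite /m4 /put /= fr3 ?fr2 ?m1t0.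
have m4t1 : m4 1 =1 move tau v d by move=> w; rewrite /m4 /put /= fr3 ?fr2 ?m1t.
have [||] := @run_map env1 m4 0 (Cond (Get 7 (Num 0)) (Get 1 (Var 0)) (Get 0 (Var 0)))
   (try_move tau v d) _ _.
- by [].
- move=> m w wn mw fr; cbn [eval nth].
  rewrite !(@mod8 7 isT) !(@mod8 1 isT) !(@mod8 0 isT).
  rewrite (fr 7) // m47 if_nat_of_bool mw m4t (fr 1) // m4t1 /try_move.
  by case: ifP.
move=> r0 fr5; split.
- move=> w; rewrite r0; case: ltnP => // nw; rewrite m4t /try_move; case: ifP => // _.
  by rewrite /move ifF //; apply/eqP; lia.
- exact: try_move_le.
move=> w nw; have [tw _] := t0 w nw; rewrite fr5 // m4t1.
have -> : move tau v d w = tau w by rewrite /move ifF //; apply/eqP; lia.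
rewrite tw /try_move; case: ifP => // _; split=> //.
by rewrite /move ifF //; apply/eqP; lia.
Qed.

(** The final evaluation is needed because array 6 still describes the point before the last
    attempted move. *)
Definition pSearch := Then (For eNP (For Size (For (Num 2) pTry))) (pEval 0 0).

Lemma run_search : 0 < n ->
  let mem := run n l X inp [::] (fun _ _ => 0) pSearch in
  mem 6 0 = zn search /\ mem 6 1 = zd search.
Proof.
move=> n0; rewrite /pSearch; cbn [run].
have nX := nX_le n0.
set m := loop _ 0 _ _.
suff: state_ok m search.
  by case=> m0 tT _; have [] := @run_eval [::] m search 0 0 isT m0 tT.
rewrite /m ev_NP (minn_idPl NP_le) /search {m}.
apply: loop_ind2 => [|i m t _ mt]; first by split.
rewrite /pass; cbn [run eval]; have -> : minn n X = n by apply/minn_idPl; lia.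
cbv beta; apply: (loop_ind2 (P := state_ok)) => // v m' t' vn mt'; cbv beta; cbn [run eval].
have -> : minn 2 X = 2 by apply/minn_idPl; lia.
by cbn [loop]; apply: run_try => //; apply: run_try.
Qed.

End TreeProgram.

Local Open Scope ring_scope.

(** * Correctness of the search *)

Section RealTree.
Variables (n : nat) (G : bigraph n) (R : realType) (D B T : nat).
Hypotheses (D_gt0 : (0 < D)%N) (B_gt0 : (0 < B)%N).
Local Notation M := (n + n)%N.
Local Notation inp := (ram (input_state G)).
Implicit Type tau : nat -> nat.

Definition column_weight (y : 'I_M -> R) x : R :=
  if gside x then (1 + \sum_(v | gedge G x v) y v) / D%:R else (y x)^-1.

(** Truncated subtraction gives every row the value of column 0. This is harmless: the weights read
    [y] at columns only. *)
Definition yreal tau (x : 'I_M) : R := (yv B T tau (x - n))%:R / (B ^ T)%:R.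

Lemma adjn_gedge (x y : 'I_M) : (adjn n inp x y != 0)%N = gedge G x y.
Proof.
rewrite -(splitK x) -(splitK y) /adjn /gedge.
case: (split x) => i; case: (split y) => j /=;
  rewrite ?split_lshift ?split_rshift ?(ltn_ord i) ?(ltn_ord j) //.
- rewrite ltnNge leq_addr /= addKn.
  have := ram_input_state G i j; rewrite [ram _ _]/= => ->.
  by rewrite mxE; case: (G _ _).
- rewrite (ltnNge (n + i)%N) leq_addr /= addKn.
  have := ram_input_state G j i; rewrite [ram _ _]/= => ->.
  by rewrite mxE; case: (G _ _).
- by rewrite !(ltnNge (n + _)%N) !leq_addr.
Qed.

Lemma inp_le1 k : (inp k <= 1)%N.
Proof.
rewrite /=; set s := [seq _ | _ <- _, _ <- _].
case: (ltnP k (size s)) => ks; last by rewrite nth_default.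
have /allpairsP[[i j] [_ _ ->]] := mem_nth 0%N ks.
by rewrite mxE; case: (G _ _).
Qed.

Lemma adjnE (x y : 'I_M) : adjn n inp x y = gedge G x y.
Proof.
have le1 : (adjn n inp x y <= 1)%N by rewrite /adjn; do 2 case: ifP => // _; apply: inp_le1.
by rewrite -adjn_gedge; case: (adjn _ _ _ _) le1 => [|[|]].
Qed.

Lemma yv_gt0 tau v : (0 < yv B T tau v)%N.
Proof. by rewrite muln_gt0 !expn_gt0 B_gt0. Qed.

Lemma BT_gt0 : (0 < B ^ T)%N. Proof. by rewrite expn_gt0 B_gt0. Qed.

Lemma wd_gt0 tau x : (0 < wd n D B T tau x)%N.
Proof. by rewrite /wd; case: ifP => _; [rewrite muln_gt0 BT_gt0|apply: yv_gt0]. Qed.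

Lemma wn_gt0 tau x : (0 < wn n inp B T tau x)%N.
Proof. by rewrite /wn; case: ifP => _; rewrite ?ltn_addr ?BT_gt0. Qed.

Lemma column_weightE tau (x : 'I_M) :
  column_weight (yreal tau) x = (wn n inp B T tau x)%:R / (wd n D B T tau x)%:R.
Proof.
have b0 : (B ^ T)%:R != 0 :> R by rewrite pnatr_eq0 -lt0n BT_gt0.
have d0 : D%:R != 0 :> R by rewrite pnatr_eq0 -lt0n.
rewrite /column_weight /wn /wd /gside; case: ifP => xn; last by rewrite /yreal invf_div.
rewrite big_mkcond big_split_ord /= big1 ?add0r => [|j _]; last first.
  rewrite -(splitK x) /gedge; case: (split x) (splitK x) => [i|i] /= E.
    by rewrite !split_lshift.
  by move: xn; rewrite -E /= ltnNge leq_addr.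
rewrite natrD natr_sum natrM.
have -> : \sum_(i < n) (if gedge G x (rshift n i) then yreal tau (rshift n i) else 0) =
    (\sum_(v < n) (yv B T tau v * adjn n inp x (n + v)%N)%:R) / (B ^ T)%:R.
  rewrite mulr_suml; apply: eq_bigr => v _.
  rewrite -[(n + v)%N]/(val (rshift n v)) adjnE /yreal /= addKn.
  by case: (gedge _ _ _); rewrite ?muln1 // muln0 mul0r.
by field; rewrite d0 b0.
Qed.

Definition available i (p : seq nat) : {set 'I_M} := [set y : 'I_M | (i <= y)%N && (val y \notin p)].

Lemma availableD1 i p (x : 'I_M) : available i p :\ x = available i (val x :: p).
Proof.
apply/setP => y; rewrite !inE negb_or andbCA; congr (_ && (_ && _)).
Qed.

(** Clearing denominators: with Q the product of the child denominators and S / Q the sum of the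
    children, 1 / (wn / wd + S / Q) = Q wd / (Q wn + S wd). Forbidden children enter as 0 / 1. *)
Lemma cell_tree tau h i p (x : 'I_M) :
  let c := cell n inp D B T tau h i p x in
  [/\ (0 < c.1)%N, (0 < c.2)%N &
    tree (gedge G) (column_weight (yreal tau)) h (available i p) x = c.1%:R / c.2%:R :> R].
Proof.
elim: h p x => [|h IH] p x /=.
  by rewrite wd_gt0 wn_gt0 addr0 column_weightE invf_div.
pose ch (z : nat) := if allowed n inp i (val x :: p) z then cell n inp D B T tau h i (val x :: p) z else (0, 1)%N.
have chq (y : 'I_M) : (0 < (ch y).2)%N.
  by rewrite /ch; case: ifP => // _; case: (IH (val x :: p) y).
have Q0 : (0 < \prod_(y < M) (ch y).2)%N by apply: prodn_gt0.
have chr (y : 'I_M) : ((ch y).1%:R / (ch y).2%:R : R) =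
    if (y \in available i p :\ x) && gedge G x y
    then tree (gedge G) (column_weight (yreal tau)) h (available i (val x :: p)) y else 0.
  rewrite /ch /allowed adjn_gedge availableD1 in_set -andbA; case: ifP => _; last by rewrite mul0r.
  by case: (IH (val x :: p) y) => _ _ ->.
split.
- by rewrite muln_gt0 Q0 wd_gt0.
- by rewrite ltn_addr // muln_gt0 Q0 wn_gt0.
pose Q := (\prod_(y < M) (ch y).2)%N.
pose S := (\sum_(y < M) (ch y).1 * \prod_(z < M) (if z == y then 1 else (ch z).2))%N.
rewrite -/Q in Q0.
have SE : S%:R = (\sum_(y < M) (ch y).1%:R / (ch y).2%:R) * Q%:R :> R.
  rewrite /S natr_sum mulr_suml; apply: eq_bigr => y _; rewrite natrM !natr_prod -mulrA.
  congr (_ * _); rewrite (bigD1 y) //= eqxx mul1r [in RHS](bigD1 y) //= mulrA mulVf; last first.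
    by rewrite pnatr_eq0 -lt0n chq.
  by rewrite mul1r; apply: eq_bigr => z /negPf ->.
rewrite column_weightE big_mkcond.
rewrite (eq_bigr (fun y : 'I_M => (ch y).1%:R / (ch y).2%:R)) => [|y _]; last first.
  by rewrite chr availableD1.
rewrite -[RHS]/((Q * wd n D B T tau x)%N%:R / (Q * wn n inp B T tau x + S * wd n D B T tau x)%N%:R).
rewrite natrD !natrM SE.
have q0 : 0 < Q%:R :> R by rewrite ltr0n.
have d0 : 0 < (wd n D B T tau x)%:R :> R by rewrite ltr0n wd_gt0.
have w0 : 0 < (wn n inp B T tau x)%:R :> R by rewrite ltr0n wn_gt0.
have s0 : 0 <= \sum_(y < M) (ch y).1%:R / (ch y).2%:R :> R.
  by apply: sumr_ge0 => y _; rewrite divr_ge0.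
move: (\sum_(y < M) _) (Q%:R : R) ((wd _ _ _ _ _ _)%:R : R) ((wn _ _ _ _ _ _)%:R : R) s0 q0 d0 w0.
move=> s q d w s0 q0 d0 w0.
have s1 : 0 < w + s * d by rewrite ltr_wpDr ?mulr_ge0 // ltW.
have s2 : 0 < q * w + s * q * d by rewrite ltr_wpDr ?mulr_ge0 ?mulr_gt0 // ltW.
by field; rewrite !gt_eqF //= mulrAC // mulrC.
Qed.

Lemma tree_md_zn tau h :
  tree_md (gedge G) (column_weight (yreal tau)) h =
  (\prod_(i < M) (cell n inp D B T tau h i [::] i).2)%:R /
  (\prod_(i < M) (cell n inp D B T tau h i [::] i).1)%:R.
Proof.
rewrite /tree_md !natr_prod -prodf_div; apply: eq_bigr => i _.
have -> : from M i = available i [::] by apply/setP => x; rewrite !inE andbT.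
by case: (cell_tree tau h i [::] i) => _ _ ->; rewrite invf_div.
Qed.

End RealTree.

Local Open Scope ring_scope.

(** * Elementary exponential inequalities *)

Section Exponential.
Variable R : realType.

Lemma bernoulli (x : R) j : 0 <= x -> 1 + j%:R * x <= (1 + x) ^+ j.
Proof.
move=> x0; elim: j => [|j IH]; first by rewrite mul0r addr0.
rewrite exprS -natr1; apply: le_trans (_ : (1 + x) * (1 + j%:R * x) <= _).
  by rewrite -subr_ge0 [leRHS](_ : _ = j%:R * x * x) ?mulr_ge0 //; ring.
by rewrite ler_pM2l // ltr_pwDl.
Qed.

Lemma expR1_le4 : expR 1 <= 4 :> R.
Proof.
have h : expR (1 / 2) <= 2 :> R by apply: le_trans (expR_le1Dx2 _) _; lra.
have -> : expR 1 = expR (1 / 2) * expR (1 / 2) :> R by rewrite -expRD; congr expR; lra.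
have -> : 4 = 2 * 2 :> R by ring.
by apply: ler_pM; rewrite ?expR_ge0.
Qed.

Lemma exp_half_le d : (0 < d)%N -> 2^-1 ^+ d <= d%:R^-1 :> R.
Proof.
move=> d0; rewrite exprVn lef_pV2 ?posrE ?exprn_gt0 ?ltr0n // -natrX ler_nat.
exact/ltnW/ltn_expl.
Qed.

Lemma expr_nat (x : R) k : expR x ^+ k = expR (k%:R * x).
Proof. by rewrite mulrC expRM_natr. Qed.

End Exponential.

(** * The search ends at a stable point *)

Section SearchStable.
Variables (n : nat) (G : bigraph n) (R : realType) (D B T H K NP : nat).
Hypotheses (D_gt0 : (0 < D)%N) (B_gt0 : (0 < B)%N) (K_gt0 : (0 < K)%N).
Local Notation M := (n + n)%N.
Local Notation inp := (ram (input_state G)).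
Local Notation zn := (zn n inp D B T H).
Local Notation zd := (zd n inp D B T H).
Local Notation accepts := (accepts n inp D B T H K).
Local Notation try_move := (try_move n inp D B T H K).
Local Notation pass := (pass n inp D B T H K).
Local Notation search := (search n inp D B T H K NP).
Local Notation move := (move T).
Implicit Types tau : nat -> nat.

Definition zhat tau : R := (zn tau)%:R / (zd tau)%:R.

Lemma zn_gt0 tau : (0 < zn tau)%N.
Proof. by apply: prodn_gt0 => i; case: (cell_tree G R T D_gt0 B_gt0 tau H.-1 i [::] i). Qed.

Lemma zd_gt0 tau : (0 < zd tau)%N.
Proof. by apply: prodn_gt0 => i; case: (cell_tree G R T D_gt0 B_gt0 tau H.-1 i [::] i). Qed.

Lemma zhat_gt0 tau : 0 < zhat tau.
Proof. by rewrite divr_gt0 // ltr0n ?zn_gt0 ?zd_gt0. Qed.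

Lemma acceptsE tau tau' : accepts tau tau' = (zhat tau' * K.+1%:R <= zhat tau * K%:R).
Proof.
rewrite /zhat mulrAC [leRHS]mulrAC ler_pdivrMr ?ltr0n ?zd_gt0 //.
by rewrite [leRHS]mulrAC ler_pdivlMr ?ltr0n ?zd_gt0 // -!natrM ler_nat.
Qed.

Definition stable tau := forall v d, (v < n)%N -> (d < 2)%N -> ~~ accepts tau (move tau v d).

Definition ratio : R := K%:R / K.+1%:R.

Lemma ratio_gt0 : 0 < ratio. Proof. by rewrite divr_gt0 ?ltr0n. Qed.

Lemma ratio_le1 : ratio <= 1.
Proof. by rewrite ler_pdivrMr ?ltr0n // mul1r ler_nat. Qed.

Lemma try_move_cases tau v d :
  (~~ accepts tau (move tau v d) /\ try_move tau v d = tau) \/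
  zhat (try_move tau v d) <= ratio * zhat tau.
Proof.
rewrite /try_move; case: ifP => acc; last by left.
right; move: acc; rewrite acceptsE -ler_pdivlMr ?ltr0n // => acc.
by apply: le_trans acc _; rewrite /ratio [leRHS]mulrC mulrA.
Qed.

(** A rejected move leaves the point alone and an accepted one gains the factor [ratio]. So either
    nothing was accepted, and then every move was tested at the same [tau], or the gain persists to
    the end of the pass. *)
Lemma pass_cases tau : (stable tau /\ pass tau = tau) \/ zhat (pass tau) <= ratio * zhat tau.
Proof.
have shrink t t' : zhat t' <= ratio * zhat t -> zhat t <= ratio * zhat tau ->
    zhat t' <= ratio * zhat tau.
  move=> h1 h2; apply: le_trans h1 _; apply: le_trans h2.
  by rewrite ler_piMl ?ratio_le1 // ltW ?zhat_gt0.
pose P k t := (t = tau /\ forall v d, (v < k)%N -> (d < 2)%N -> ~~ accepts tau (move tau v d)) \/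
  zhat t <= ratio * zhat tau.
suff: P n (pass tau) by case=> [[-> st]|]; [left|right].
apply: (loop_ind (P := P)); first by left.
move=> v t vn Pt.
pose P' k t := (t = tau /\ forall u d, (u < v)%N && (d < 2)%N || (u == v) && (d < k)%N ->
   ~~ accepts tau (move tau u d)) \/ zhat t <= ratio * zhat tau.
have: P' 2 (loop (fun d t' => try_move t' v d) 0 2 t).
  apply: (loop_ind (P := P')).
    case: Pt => [[-> st]|]; [left; split=> // u d|by right].
    by rewrite ltn0 andbF orbF => /andP[]; apply: st.
  move=> d t' d2 [[-> st]|le]; last first.
    right; case: (try_move_cases t' v d) => [[_ ->] //|le']; exact: shrink le' le.
  case: (try_move_cases tau v d) => [[na ->]|]; [left; split=> // u d'|by right].
  case: (ltngtP u v) => //= uv; first by rewrite orbF => d'2; apply: st; rewrite uv /= d'2.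
  rewrite ltnS leq_eqVlt => /predU1P[->|d'd]; first by rewrite uv.
  by apply: st; rewrite uv eqxx ltnn.
case=> [[-> st]|le]; [left; split=> // u d uv d2|by right].
by apply: st; rewrite d2 !andbT orbC -leq_eqVlt -ltnS.
Qed.

Lemma search_cases :
  stable search \/ zhat search <= ratio ^+ NP * zhat (fun=> 0%N).
Proof.
apply: (loop_ind (P := fun k t => stable t \/ zhat t <= ratio ^+ k * zhat (fun=> 0%N))).
  by right; rewrite expr0 mul1r.
move=> i t _ [st|le]; case: (pass_cases t) => [[st' ->]|le'].
- by left.
- left; have -> : pass t = t.
    apply: (loop_ind (P := fun _ t' => t' = t)) => // v t' vn ->.
    apply: (loop_ind (P := fun _ t' => t' = t)) => // d t'' d2 ->.
    by rewrite /try_move (negPf (st v d vn d2)).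
  exact: st.
- by left.
by right; apply: le_trans le' _; rewrite exprS -mulrA ler_pM2l // ratio_gt0.
Qed.

(** Since (1 + 1 / K)^K >= 2, K gains halve the estimate. *)
Lemma ratio_exp s : ratio ^+ (K * s) <= 2^-1 ^+ s.
Proof.
rewrite exprM lerXn2r ?nnegrE ?exprn_ge0 ?invr_ge0 ?(ltW ratio_gt0) //.
rewrite /ratio -[K%:R / _]invrK invf_div exprVn lef_pV2 ?posrE ?exprn_gt0 ?divr_gt0 ?ltr0n //.
have k0 : K%:R != 0 :> R by rewrite pnatr_eq0 -lt0n.
have -> : K.+1%:R / K%:R = 1 + K%:R^-1 :> R by rewrite -natr1 mulrDl mul1r divff // addrC.
by apply: le_trans (bernoulli _ _); rewrite ?invr_ge0 // divff.
Qed.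

(* NP = K * s + 1 passes suffice when the estimate cannot drop by a factor 2 ^ s. *)
Lemma search_stable s : NP = (K * s).+1 ->
  (forall tau, (forall v, tau v <= T)%N -> zhat (fun=> 0%N) <= 2 ^+ s * zhat tau) ->
  stable search.
Proof.
move=> NPE low; case: search_cases => // le; exfalso.
have sT v : (search v <= T)%N by apply: search_le.
have := low _ sT; apply/negP; rewrite -ltNge.
have z0 := zhat_gt0 (fun=> 0%N).
have lt : ratio ^+ NP < 2^-1 ^+ s.
  rewrite NPE exprSr; apply: lt_le_trans (ratio_exp s).
  rewrite gtr_pMr ?exprn_gt0 ?ratio_gt0 // ltr_pdivrMr ?ltr0n // mul1r ltr_nat.
  exact: ltnSn.
rewrite exprVn in lt.
rewrite -ltr_pdivlMl ?exprn_gt0 //; apply: le_lt_trans le _.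
by rewrite ltr_pM2r.
Qed.

End SearchStable.

Local Open Scope ring_scope.

Lemma md_ge_exp (T : finType) (R : numDomainType) (e : rel T) (w : T -> R) (c : R) (S : {set T}) :
  symmetric e -> 0 <= c -> (forall x, c <= w x) -> c ^+ #|S| <= md e w S.
Proof.
move=> e_sym c0 cw; elim/set_card_ind: S => [|S x xS IH]; first by rewrite md0 cards0.
have w0 y : 0 <= w y by apply: le_trans (cw y).
rewrite (md_rec e_sym _ xS) (cardsD1 x S) xS exprS ler_wpDr //.
  by apply: sumr_ge0 => y _; apply: md_ge0.
by rewrite ler_pM ?exprn_ge0 // IH ?cardsD1_lt.
Qed.

(** * Choice of parameters and quality of a stable point *)

Section Approximation.
Variables (n : nat) (G : bigraph n) (R : realType) (E m : nat).
Hypotheses (n_gt0 : (0 < n)%N) (E_gt0 : (0 < E)%N).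
Local Notation M := (n + n)%N.

(* The column weights are the powers (1 + 1 / B) ^ k with k <= T, which reach up to
   2 ^ (r + 1); a move is accepted when it lowers the estimate by a factor 1 + 1 / K. *)
Definition pD := ((16 * E) ^ 2)%N.
(** With theta = 2^(- r), the first summand cancels the bound 2^(4 n (n + 1)) on the matching sum
    with unit weights; the other two are the precision wanted. *)
Definition pr := (4 * n * n.+1 + 2 * n + 16 * E)%N.
(** Makes the curvature term of the local minimum estimate at most 1 / (32 E); the factor 256 E (n +
    1) in [pK] does the same for the slack of rejected moves. *)
Definition pB := (512 * E * n.+1 ^ 3 * pr.+1)%N.
Definition pT := (pB * pr.+1)%N.
Definition pK := (256 * E * n.+1 * pT)%N.
(** The binary logarithm of the possible drop: from at most 2^(4 n (n + 1)) at the start to the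
    2n-th power of the least weight, with a factor 2 for each of the two estimates. *)
Definition ps := (2 + 4 * n * n.+1 + 2 * n * (pD + 2 * pr.+1))%N.
Definition pNP := (pK * ps).+1.
Definition pH := m.*2.+1.
Local Notation D := pD.
Local Notation B := pB.
Local Notation T := pT.
Local Notation K := pK.

Hypothesis m_big : M%:R * D%:R * (D%:R / (D%:R + 1)) ^+ m <= (2 * M%:R * K%:R)^-1 :> R.

Lemma pD_gt0 : (0 < D)%N. Proof. by rewrite expn_gt0 muln_gt0 E_gt0. Qed.
Lemma pB_gt0 : (0 < B)%N. Proof. by rewrite /pB !(muln_gt0, expn_gt0) E_gt0. Qed.
Lemma pT_gt0 : (0 < T)%N. Proof. by rewrite /pT muln_gt0 pB_gt0. Qed.
Lemma pK_gt0 : (0 < K)%N. Proof. by rewrite /pK muln_gt0 pT_gt0 !muln_gt0 E_gt0. Qed.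

Let KR : 0 < K%:R :> R. Proof. by rewrite ltr0n pK_gt0. Qed.
Let BR : 0 < B%:R :> R. Proof. by rewrite ltr0n pB_gt0. Qed.
Let ER : 0 < E%:R :> R. Proof. by rewrite ltr0n. Qed.
Let DR : 0 < D%:R :> R. Proof. by rewrite ltr0n pD_gt0. Qed.

Definition zreal tau : R := md (gedge G) (column_weight G D (yreal R B T tau)) setT.

Lemma yreal_gt0 tau (x : 'I_M) : 0 < yreal R B T tau x.
Proof. by rewrite divr_gt0 // ltr0n ?yv_gt0 ?pB_gt0 // expn_gt0 pB_gt0. Qed.

Lemma column_weight_gt0 (y : 'I_M -> R) x : (forall v, 0 < y v) -> 0 < column_weight G D y x.
Proof.
move=> y0; rewrite /column_weight; case: ifP => _; last by rewrite invr_gt0.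
by rewrite divr_gt0 // ltr_wpDr // sumr_ge0 // => v _; apply: ltW.
Qed.

Lemma zreal_gt0 tau : 0 < zreal tau.
Proof.
apply: md_gt0; first exact: gedge_sym.
by move=> x; apply: column_weight_gt0 => v; apply: yreal_gt0.
Qed.

(** By the choice of [m] each of the M factors has relative error at most 1 / (2 M K), and (1 + 1 /
    (2 M K))^M <= exp(1 / (2 K)) <= 1 + 1 / K. *)
Lemma zhat_zreal tau :
  zhat G R D B T pH tau <= (1 + K%:R^-1) * zreal tau /\
  zreal tau <= (1 + K%:R^-1) * zhat G R D B T pH tau.
Proof.
pose x : R := (2 * M%:R * K%:R)^-1.
have MR : 0 < M%:R :> R by rewrite ltr0n addn_gt0 n_gt0.
have x0 : 0 <= x by rewrite invr_ge0 !mulr_ge0.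
have xM : (1 + x) ^+ M <= 1 + K%:R^-1.
  have k1 : K%:R^-1 <= 1 :> R by rewrite invf_le1 // ler1n pK_gt0.
  have k0 : 0 < K%:R^-1 :> R by rewrite invr_gt0.
  apply: le_trans (_ : expR (M%:R * x) <= _).
    by rewrite -expr_nat lerXn2r ?nnegrE ?expR_ge0 ?addr_ge0 // expR_ge1Dx.
  have -> : M%:R * x = K%:R^-1 / 2.
    have half (a k : R) : 0 < a -> 0 < k -> a * (2 * a * k)^-1 = k^-1 / 2.
      by move=> a0 k0'; field; rewrite !gt_eqF.
    exact: half.
  apply: le_trans (expR_le1Dx2 _) _; first lra.
  have : K%:R^-1 * K%:R^-1 <= K%:R^-1 * 1 :> R by rewrite ler_pM2l.
  by rewrite expr2; lra.
have w_row u : gside u -> \sum_(v | gedge G u v) (column_weight G D (yreal R B T tau) v)^-1 <=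
    D%:R * column_weight G D (yreal R B T tau) u.
  move=> su; rewrite {2}/column_weight su mulrC divfK ?gt_eqF //.
  apply: le_trans (_ : \sum_(v | gedge G u v) yreal R B T tau v <= _); last by rewrite lerDr.
  apply: ler_sum => v /gedge_side; rewrite su /column_weight.
  by case: (gside v) => // _; rewrite invrK.
have [] := @tree_md_near R M (gedge G) (@gside n) (column_weight G D (yreal R B T tau)) D%:R m x
  (gedge_sym G) (@gedge_side n G) _ _ w_row m_big.
- by move=> u; apply: column_weight_gt0 => v; apply: yreal_gt0.
- by rewrite ler1n pD_gt0.
rewrite (tree_md_zn _ _ _ pD_gt0 pB_gt0) -/(zhat G R D B T pH tau) -/(zreal tau) => l1 l2.
have z0 := zreal_gt0 tau; have h0 := zhat_gt0 G R T pH pD_gt0 pB_gt0 tau.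
split; [apply: le_trans l1 _|apply: le_trans l2 _]; rewrite ler_wpM2r // ltW //.
Qed.

Definition delta : R := ln (1 + B%:R^-1).

Let b_gt1 : 1 < 1 + B%:R^-1 :> R. Proof. by rewrite ltrDl invr_gt0. Qed.

Lemma delta_gt0 : 0 < delta. Proof. exact: ln_gt0. Qed.

Lemma delta_le : delta <= B%:R^-1.
Proof.
rewrite /delta -[leRHS]expRK ler_ln ?posrE ?expR_gt0 ?(lt_trans ltr01 b_gt1) //.
exact: expR_ge1Dx.
Qed.

Lemma expR_delta : expR delta = 1 + B%:R^-1.
Proof. by rewrite lnK // posrE (lt_trans ltr01). Qed.

Lemma yrealE tau (x : 'I_M) : (tau (x - n) <= T)%N ->
  yreal R B T tau x = expR ((tau (x - n)%N)%:R * delta).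
Proof.
move=> tT; rewrite -expr_nat expR_delta /yreal /yv.
have b0 : B%:R != 0 :> R by rewrite gt_eqF.
have -> : 1 + B%:R^-1 = B.+1%:R / B%:R :> R by rewrite -natr1; field.
rewrite natrM !natrX expr_div_n.
have -> : B%:R ^+ T = B%:R ^+ (T - tau (x - n)%N) * B%:R ^+ tau (x - n)%N :> R.
  by rewrite -exprD subnK.
by field; rewrite !expf_neq0.
Qed.

Lemma expR_Tdelta_ge : 2 ^+ pr.+1 <= expR (T%:R * delta).
Proof.
rewrite /pT natrM [B%:R * _]mulrC -mulrA -expr_nat lerXn2r ?nnegrE ?expR_ge0 // -expr_nat expR_delta.
apply: le_trans (bernoulli _ _); last by rewrite invr_ge0 ltW.
by rewrite divff ?gt_eqF.
Qed.

Lemma expR_Tdelta_le : expR (T%:R * delta) <= 4 ^+ pr.+1.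
Proof.
rewrite /pT natrM [B%:R * _]mulrC -mulrA -expr_nat lerXn2r ?nnegrE ?expR_ge0 //.
apply: le_trans (expR1_le4 R); rewrite ler_expR.
by rewrite -ler_pdivlMl // mulr1 delta_le.
Qed.

Definition zexp (t : 'I_M -> R) := md (gedge G) (column_weight G D (fun v => expR (t v))) setT.

Lemma posynomial_zexp : posynomial M%:R zexp.
Proof.
have -> : M%:R = #|[set: 'I_M]|%:R :> R by rewrite cardsT card_ord.
apply: (posynomial_md (w := fun t => column_weight G D (fun v => expR (t v)))).
  exact: gedge_sym.
move=> x; rewrite /column_weight; case: (gside x).
  apply: (@posynomial_le _ _ (1 + 0)); first by rewrite addr0.
  apply: posynomialM; last by apply: posynomial_const; rewrite invr_ge0 ltW.
  apply: posynomialD; first exact: (posynomial_le ler01 (posynomial_const _ ler01)).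
  apply: posynomial_sum => // v _.
  by apply: (eq_posynomial _ (posynomial_exp v (b := 1) _)) => [t|]; rewrite ?mul1r ?normr1.
apply: (eq_posynomial _ (posynomial_exp x (b := -1) _)) => [t|]; rewrite ?normrN1 //.
by rewrite mulN1r expRN.
Qed.

Definition texp tau (x : 'I_M) : R := (tau (x - n)%N)%:R * delta.

Lemma zreal_zexp tau : (forall v, tau v <= T)%N -> zreal tau = zexp (texp tau).
Proof.
move=> tT; apply: eq_in_md => [|x _]; first exact: gedge_sym.
rewrite /column_weight; case: ifP => _; last by rewrite yrealE.
by congr ((1 + _) / _); apply: eq_bigr => v _; rewrite yrealE.
Qed.

Lemma zexp_cols t t' : (forall x, ~~ gside x -> t x = t' x) -> zexp t = zexp t'.
Proof.
move=> tt; apply: eq_in_md => [|x _]; first exact: gedge_sym.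
rewrite /column_weight; case: ifP => sx; last by rewrite tt ?sx.
congr ((1 + _) / _); apply: eq_bigr => v /gedge_side; rewrite sx => sv.
by rewrite tt //; case: (gside v) sv.
Qed.

(** The search compares estimates, not true values: one factor 1 + 1 / K comes from the rejection
    and one from each of the two estimates. Finally (1 + k)^3 (1 - 4 k) <= 1. *)
Lemma stable_near tau v d : (forall v, tau v <= T)%N ->
  ~~ accepts n (ram (input_state G)) D B T pH K tau (move T tau v d) ->
  (1 - 4 / K%:R) * zreal tau <= zreal (move T tau v d).
Proof.
move=> tT; rewrite (acceptsE G R T pH K pD_gt0 pB_gt0) -ltNge => lt.
have [_ l1] := zhat_zreal tau; have [l2 _] := zhat_zreal (move T tau v d).
have k0 : 0 < K%:R^-1 :> R by rewrite invr_gt0.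
set k := K%:R^-1 in k0 l1 l2 *; set z := zreal tau in l1 *; set z' := zreal _ in l2 *.
set h := zhat _ _ _ _ _ _ tau in l1 lt; set h' := zhat _ _ _ _ _ _ _ in l2 lt.
have kk : K%:R * k = 1 by rewrite divff ?gt_eqF.
have lt' : h <= h' * (1 + k).
  rewrite -(ler_pM2r KR); apply: le_trans (ltW lt) _.
  have aux (a b c : R) : b * c = 1 -> a * (b + 1) = a * (1 + c) * b.
    by move=> e; rewrite -mulrA mulrDl mul1r [c * b]mulrC e.
  by rewrite -natr1 (aux _ _ _ kk).
have z0 : 0 < z by apply: zreal_gt0.
have k1 : 0 < 1 + k by rewrite addr_gt0.
have : z <= (1 + k) ^+ 3 * z'.
  apply: le_trans l1 _; rewrite exprS -mulrA ler_pM2l //; apply: le_trans lt' _.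
  by rewrite mulrC exprS -mulrA ler_pM2l // expr1.
move=> zz'; rewrite -(ler_pM2l (exprn_gt0 3 k1)); apply: le_trans zz'.
rewrite mulrA ler_piMl ?(ltW z0) // -subr_ge0.
have -> : 1 - (1 + k) ^+ 3 * (1 - 4 * k) = k + 9 * k ^+ 2 + 11 * k ^+ 3 + 4 * k ^+ 4 by ring.
by rewrite !addr_ge0 ?mulr_ge0 ?exprn_ge0 // ltW.
Qed.

Definition unit_row (x : 'I_M) : R := (1 + \sum_(v | gedge G x v) 1) / D%:R.

Lemma unit_row_ge0 x : 0 <= unit_row x.
Proof. by rewrite divr_ge0 ?addr_ge0 ?sumr_ge0 // ltW. Qed.

Lemma unit_row_le x : unit_row x <= M.+1%:R.
Proof.
have le1 : 1 + \sum_(v | gedge G x v) 1 <= M.+1%:R :> R.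
  rewrite -natr1 addrC lerD2r sumr_const ler_nat.
  by apply: leq_trans (max_card _) _; rewrite card_ord.
apply: le_trans le1; rewrite /unit_row ler_piMr ?addr_ge0 ?sumr_ge0 //.
by rewrite invf_le1 // ler1n pD_gt0.
Qed.

Lemma md_unit_le : md (gedge G) (side_weight (@gside n) unit_row 1) setT <= 2 ^+ (4 * n * n.+1).
Proof.
apply: le_trans (@md_le_exp _ _ _ (gedge_sym G) _ _ (M.+1)%:R M _ _ _) _.
- by rewrite ler1n.
- move=> x; rewrite /side_weight; case: ifP => _; last by rewrite ler01 ler1n.
  by rewrite unit_row_ge0 unit_row_le.
- by rewrite cardsT card_ord.
rewrite cardsT card_ord -natrD; have -> : (4 * n * n.+1 = 2 * n.+1 * M)%N by lia.
rewrite exprM lerXn2r ?nnegrE ?exprn_ge0 // exprM -!natrX ler_nat.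
have : (n.+1 < 2 ^ n.+1)%N by apply: ltn_expl.
have -> : ((2 ^ 2) ^ n.+1 = 2 ^ n.+1 * 2 ^ n.+1)%N by rewrite -expnMn.
have : (2 <= 2 ^ n.+1)%N by rewrite expnS leq_pmulr // expn_gt0.
by clear; move: (2 ^ n.+1)%N => u; nia.
Qed.

(** Rows weigh at least 1 / D >= 2^(- D) and columns at least 4^(- (r + 1)), so leaving all vertices
    free already bounds the sum from below. *)
Lemma zhat_low tau : (forall v, tau v <= T)%N ->
  zhat G R D B T pH (fun=> 0%N) <= 2 ^+ ps * zhat G R D B T pH tau.
Proof.
move=> tT.
have k2 : 1 + K%:R^-1 <= 2 :> R.
  by have : K%:R^-1 <= 1 :> R; [rewrite invf_le1 // ler1n pK_gt0|lra].
have [l0 _] := zhat_zreal (fun=> 0%N); have [_ l1] := zhat_zreal tau.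
have h0 := zhat_gt0 G R T pH pD_gt0 pB_gt0 tau.
have z00 := zreal_gt0 (fun=> 0%N).
have {}l1 : zreal tau <= 2 * zhat G R D B T pH tau.
  by apply: le_trans l1 _; rewrite ler_pM2r.
have {}l0 : zhat G R D B T pH (fun=> 0%N) <= 2 * 2 ^+ (4 * n * n.+1).
  apply: le_trans l0 _; apply: ler_pM => //; [by rewrite addr_ge0 ?invr_ge0 // ltW|exact: ltW|].
  apply: le_trans md_unit_le; rewrite le_eqVlt; apply/predU1P; left.
  have y1 (x : 'I_M) : yreal R B T (fun=> 0%N) x = 1 by rewrite yrealE // mul0r expR0.
  apply: eq_in_md => [|x _]; first exact: gedge_sym.
  rewrite /column_weight /side_weight /unit_row; case: ifP => _; last by rewrite y1 invr1.
  by congr ((1 + _) / _); apply: eq_bigr => v _.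
pose c : R := 2^-1 ^+ (D + 2 * pr.+1).
have c0 : 0 < c by rewrite exprn_gt0 // invr_gt0.
have D2 := exp_half_le R pD_gt0.
have c1 : c <= D%:R^-1.
  rewrite /c exprD; apply: le_trans D2; rewrite ler_piMr ?exprn_ge0 ?invr_ge0 //.
  by rewrite exprn_ile1 ?invr_ge0 // invf_le1 // ler1n.
have low : c ^+ M <= zreal tau.
  rewrite -[in c ^+ M](card_ord M) -cardsT; apply: md_ge_exp; [exact: gedge_sym|exact: ltW|].
  move=> x; rewrite /column_weight; case: ifP => _.
    apply: le_trans c1 _; rewrite ler_peMl ?invr_ge0 ?(ltW DR) // lerDl sumr_ge0 // => v _.
    exact/ltW/yreal_gt0.
  have y4 : yreal R B T tau x <= 4 ^+ pr.+1.
    rewrite yrealE //; apply: le_trans expR_Tdelta_le; rewrite ler_expR ler_pM2r ?delta_gt0 //.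
    by rewrite ler_nat.
  apply: le_trans (_ : (4 ^+ pr.+1)^-1 <= _); last first.
    by rewrite lef_pV2 ?posrE ?exprn_gt0 ?yreal_gt0.
  rewrite /c exprD exprM; have -> : 2^-1 ^+ 2 = 4^-1 :> R by rewrite exprVn; congr (_^-1); ring.
  rewrite [4^-1 ^+ _]exprVn ler_piMl ?invr_ge0 ?exprn_ge0 //.
  by rewrite exprn_ile1 ?invr_ge0 // invf_le1 // ler1n.
apply: le_trans l0 _.
have -> : ps = (1 + 4 * n * n.+1 + (D + 2 * pr.+1) * M).+1 by rewrite /ps; move: pD pr => d u; clear; lia.
rewrite exprSr -mulrA; apply: le_trans (_ : _ * zreal tau <= _); last first.
  by apply: ler_wpM2l l1; rewrite exprn_ge0.
rewrite exprD exprD expr1 -mulrA ler_peMr ?mulr_ge0 ?exprn_ge0 //.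
apply: le_trans (_ : 2 ^+ ((D + 2 * pr.+1) * M) * c ^+ M <= _); last first.
  by rewrite ler_wpM2l // exprn_ge0.
by rewrite /c -exprM exprVn divff ?expf_neq0 ?pnatr_eq0.
Qed.

Definition theta : R := 2^-1 ^+ pr.

Lemma theta_gt0 : 0 < theta. Proof. by rewrite exprn_gt0 // invr_gt0. Qed.

Lemma card_sides (b : bool) : #|[set y in [set: 'I_M] | gside y == b]| = n.
Proof.
rewrite -sum1_card big_mkcond big_split_ord /=.
under eq_bigr do rewrite !inE gside_lshift /=.
under [X in (_ + X)%N]eq_bigr do rewrite !inE gside_rshift /=.
by case: b; rewrite /= !sum_nat_const card_ord ?muln0 ?muln1 ?addn0.
Qed.

Lemma md_start_le : md (gedge G) (mixed_weight (gedge G) (@gside n) D%:R theta (fun=> 1) set0) setT <=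
  (Perm G)%:R + 2^-1 ^+ (2 * n + 16 * E).
Proof.
have -> : md (gedge G) (mixed_weight (gedge G) (@gside n) D%:R theta (fun=> 1) set0) setT =
    md (gedge G) (side_weight (@gside n) unit_row theta) setT.
  by apply: eq_in_md => [|x _]; [exact: gedge_sym|rewrite /mixed_weight inE].
apply: le_trans (@md_side_weight _ _ _ _ (gedge_sym G) unit_row theta setT unit_row_ge0 _) _.
  by rewrite ltW ?theta_gt0 //= exprn_ile1 ?invr_ge0 // invf_le1 // ler1n.
rewrite (@md_perfect _ _ _ _ (gedge_sym G) (@gedge_side n G)) ?card_sides // md_Perm lerD2l.
apply: le_trans (_ : theta * 2 ^+ (4 * n * n.+1) <= _).
  by rewrite ler_pM2l ?theta_gt0 // md_unit_le.
by rewrite /theta /pr -addnA exprD mulrAC -exprMn mulVf ?pnatr_eq0 // expr1n mul1r.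
Qed.

(** Here q = 16 E, and the columns are counted generously as 2n, giving exp(2 / q)^(2 n) = exp(n /
    (4 E)). *)
Lemma capacity : exists y : 'I_M -> R, (forall x, 1 <= y x <= 2 ^+ pr.+1) /\
  md (gedge G) (column_weight G D y) setT <=
  expR (n%:R / (4 * E%:R)) * ((Perm G)%:R + 2^-1 ^+ (2 * n + 16 * E)).
Proof.
pose A := [set x : 'I_M | ~~ gside x].
have q1 : 1 <= (16 * E)%N%:R :> R by rewrite ler1n muln_gt0 E_gt0.
have Dq : D%:R = (16 * E)%N%:R ^+ 2 :> R by rewrite natrX.
have sA : {in A, forall x, ~~ gside x} by move=> x; rewrite inE.
have [y [yb _ yle]] := md_capacity (gedge_sym G) (@gedge_side n G) DR theta_gt0 q1 Dq sA.
exists y; split.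
  move=> x; have /andP[-> /= le] := yb x; apply: le_trans le _.
  rewrite /theta exprVn invrK exprS mulr_natl mulr2n lerD2r.
  by apply: exprn_ege1; rewrite lerDl.
have -> : md (gedge G) (column_weight G D y) setT =
    md (gedge G) (mixed_weight (gedge G) (@gside n) D%:R theta y A) setT.
  apply: eq_in_md => [|x _]; first exact: gedge_sym.
  by rewrite /column_weight /mixed_weight inE; case: (gside x).
apply: le_trans yle _; apply: ler_pM; rewrite ?exprn_ge0 ?expR_ge0 //.
- apply: md_ge0; first exact: gedge_sym.
  by move=> x; apply/ltW/mixed_weight_gt0 => //; exact: theta_gt0.
- rewrite expr_nat ler_expR.
  have -> : n%:R / (4 * E%:R) = (n + n)%N%:R * (2 / (16 * E)%N%:R) :> R.
    by rewrite natrD natrM; field; rewrite gt_eqF.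
  rewrite ler_wpM2r ?divr_ge0 // ler_nat.
  by apply: leq_trans (max_card _) _; rewrite card_ord.
exact: md_start_le.
Qed.

Lemma bracket_le (c : nat) : (c <= M)%N ->
  c%:R * (T%:R * delta) * (4 / K%:R / delta + 2 * delta * M%:R ^+ 2) <= (16 * E%:R)^-1.
Proof.
move=> cM; have d0 := delta_gt0; have dB := delta_le.
have -> : c%:R * (T%:R * delta) * (4 / K%:R / delta + 2 * delta * M%:R ^+ 2) =
   c%:R * (4 * T%:R / K%:R) + c%:R * (2 * T%:R * delta ^+ 2 * M%:R ^+ 2).
  by field; rewrite !gt_eqF.
have cR : c%:R <= M%:R :> R by rewrite ler_nat.
have TR : 0 < T%:R :> R by rewrite ltr0n pT_gt0.
have nR : 1 <= n%:R :> R by rewrite ler1n.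
have h1 : c%:R * (4 * T%:R / K%:R) <= (32 * E%:R)^-1 :> R.
  apply: le_trans (_ : (M%:R : R) * (4 * T%:R / K%:R) <= _).
    by rewrite ler_wpM2r // divr_ge0 ?mulr_ge0 // ltW.
  have -> : K%:R = 256 * E%:R * (n%:R + 1) * T%:R :> R.
    by rewrite /pK; move: pT => t; rewrite !natrM -(natr1 n).
  rewrite natrD; move: TR nR; move: (T%:R : R) (n%:R : R) => t k t0 k1.
  have -> : (k + k) * (4 * t / (256 * E%:R * (k + 1) * t)) = (k / (k + 1)) * (32 * E%:R)^-1.
    by field; rewrite !gt_eqF //; lra.
  rewrite ler_piMl ?invr_ge0 ?mulr_ge0 ?(ltW ER) // ler_pdivrMr; lra.
have h2 : c%:R * (2 * T%:R * delta ^+ 2 * M%:R ^+ 2) <= (32 * E%:R)^-1.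
  apply: le_trans (_ : (M%:R : R) * (2 * T%:R * B%:R^-1 ^+ 2 * M%:R ^+ 2) <= _).
    apply: ler_pM => //; first by rewrite !mulr_ge0 ?exprn_ge0 // ltW.
    rewrite ler_wpM2r ?exprn_ge0 // ler_wpM2l ?mulr_ge0 //.
    by rewrite lerXn2r ?nnegrE ?invr_ge0 // ltW.
  have r0 : 0 < pr.+1%:R :> R by rewrite ltr0n.
  have -> : T%:R = B%:R * pr.+1%:R :> R by rewrite /pT; move: pB pr => ? ?; rewrite natrM.
  have -> : B%:R = 512 * E%:R * (n%:R + 1) ^+ 3 * pr.+1%:R :> R by rewrite /pB; move: pr => r; rewrite natrM natrM natrX natrM -(natr1 n).
  rewrite natrD; move: r0 nR; move: (pr.+1%:R : R) (n%:R : R) => r k r0 k1.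
  have k2 : 0 < k + 1 by lra.
  have -> : (k + k) * (2 * (512 * E%:R * (k + 1) ^+ 3 * r * r) *
      (512 * E%:R * (k + 1) ^+ 3 * r)^-1 ^+ 2 * (k + k) ^+ 2) =
      (k / (k + 1)) ^+ 3 * (32 * E%:R)^-1.
    by field; rewrite !gt_eqF //; lra.
  rewrite ler_piMl ?invr_ge0 ?mulr_ge0 ?(ltW ER) // exprn_ile1 ?divr_ge0 //; try lra.
  by rewrite ler_pdivrMr; lra.
apply: le_trans (lerD h1 h2) _; rewrite le_eqVlt; apply/predU1P; left.
by field; rewrite gt_eqF.
Qed.

Lemma column_sub (x : 'I_M) : ~~ gside x -> (x - n < n)%N.
Proof. by rewrite /gside -leqNgt; have := ltn_ord x; lia. Qed.

(** The stable point is compared with the point of [capacity], both in logarithmic coordinates; [t']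
    keeps the row coordinates of [t], which do not affect [zexp]. The target lies between 0 and T
    delta in each column, so a coordinate that has to move is not at that end of the grid and the
    tested move was a genuine step. *)
Lemma stable_zreal tau : (forall v, tau v <= T)%N ->
  stable G D B T pH K tau ->
  zreal tau * (1 - (16 * E%:R)^-1) <=
  expR (n%:R / (4 * E%:R)) * ((Perm G)%:R + 2^-1 ^+ (2 * n + 16 * E)).
Proof.
move=> tT st; have [y [yb yle]] := capacity; apply: le_trans yle.
have d0 := delta_gt0.
pose t := texp tau.
pose t' x : R := if gside x then t x else ln (y x).
pose C := [set x : 'I_M | ~~ gside x].
have ypos x : 0 < y x by case/andP: (yb x) => y1 _; apply: lt_le_trans y1.
have -> : md (gedge G) (column_weight G D y) setT = zexp t'.
  apply: eq_in_md => [|x _]; first exact: gedge_sym.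
  rewrite /column_weight /t'; case: ifP => sx; last by rewrite lnK ?posrE.
  congr ((1 + _) / _); apply: eq_bigr => v /gedge_side; rewrite sx => sv.
  by case: (gside v) sv => // _; rewrite lnK ?posrE.
have t'b x : ~~ gside x -> 0 <= t' x <= T%:R * delta.
  move=> sx; rewrite /t' (negPf sx); have /andP[y1 y2] := yb x.
  rewrite ln_ge0 //= -ler_expR lnK ?posrE //.
  exact: le_trans y2 expR_Tdelta_ge.
have tb x : 0 <= t x <= T%:R * delta.
  by rewrite /t /texp mulr_ge0 ?(ltW d0) //= ler_pM2r // ler_nat.
have dM : M%:R * delta <= 1 / 2.
  apply: le_trans (_ : (M%:R : R) * B%:R^-1 <= _); first by rewrite ler_wpM2l // delta_le.
  rewrite ler_pdivrMr // mul1r mulrC ler_pdivlMr // -natrM ler_nat /pB.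
  have : (n.+1 <= n.+1 ^ 3)%N by rewrite -{1}(expn1 n.+1) leq_pexp2l.
  by move: (n.+1 ^ 3)%N => u; nia.
have cM : (#|C| <= M)%N by apply: leq_trans (max_card _) _; rewrite card_ord.
have moved (x : 'I_M) d : ~~ gside x -> (d < 2)%N ->
   (1 - 4 / K%:R) * zexp t <= zexp (texp (move T tau (x - n) d)).
  move=> sx d2; rewrite /t -!zreal_zexp //; last exact: move_le.
  by apply: stable_near => //; apply: st => //; exact: column_sub.
apply: le_trans (@posynomial_local_min _ _ M%:R zexp t t' C delta (4 / K%:R) (T%:R * delta)
  posynomial_zexp _ _ d0 dM _ _ _ _).
- rewrite zreal_zexp // ler_wpM2l //; last by rewrite lerB // bracket_le.
  by rewrite -zreal_zexp // ltW // zreal_gt0.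
- by [].
- by rewrite divr_ge0 // ltW.
- by move=> x; rewrite inE negbK /t' => ->.
- move=> x; rewrite /t'; case: ifP => sx; first by rewrite subrr normr0 mulr_ge0 // ltW.
  have := t'b x (negbT sx); rewrite /t' sx; have := tb x.
  move=> /andP[a1 a2] /andP[a3 a4]; rewrite ler_norml; apply/andP; split; lra.
- move=> x lt; have sx : ~~ gside x.
    by apply/negP => sx; move: lt; rewrite /t' sx ltxx.
  have tx : (tau (x - n) < T)%N.
    have := t'b x sx; rewrite /t' in lt *; case/andP => _ le.
    by have := lt_le_trans lt le; rewrite /t /texp ltr_pM2r // ltr_nat.
  apply: (le_trans (moved x 0%N sx isT)); rewrite le_eqVlt; apply/predU1P; left.
  apply: zexp_cols => u su; rewrite /texp /move /shift /t /texp /=.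
  have [->|ux] := eqVneq u x; first by rewrite eqxx tx natrD mulrDl mul1r.
  rewrite ifF //; apply/negbTE; apply: contraNneq ux => e; apply/eqP/val_inj => /=.
  by move: su sx e; rewrite /gside -!leqNgt; lia.
- move=> x lt; have sx : ~~ gside x.
    by apply/negP => sx; move: lt; rewrite /t' sx ltxx.
  have tx : (0 < tau (x - n))%N.
    have := t'b x sx; rewrite /t' in lt *; case/andP => le _.
    by have := le_lt_trans le lt; rewrite /t /texp pmulr_lgt0 // ltr0n.
  apply: (le_trans (moved x 1%N sx isT)); rewrite le_eqVlt; apply/predU1P; left.
  apply: zexp_cols => u su; rewrite /texp /move /shift /t /texp /=.
  have [->|ux] := eqVneq u x; first by rewrite eqxx natrB // mulrBl mul1r.
  rewrite ifF //; apply/negbTE; apply: contraNneq ux => e; apply/eqP/val_inj => /=.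
  by move: su sx e; rewrite /gside -!leqNgt; lia.
Qed.

End Approximation.

Local Open Scope ring_scope.

(** * Rounding the estimate *)

Section Output.
Variables (n : nat) (G : bigraph n) (R : realType) (E m : nat).
Hypotheses (n_gt0 : (0 < n)%N) (E_gt0 : (0 < E)%N).
Local Notation M := (n + n)%N.
Local Notation D := (pD E).
Local Notation B := (pB n E).
Local Notation T := (pT n E).
Local Notation K := (pK n E).
Local Notation NP := (pNP n E).
Local Notation H := (pH m).
Hypothesis m_big : M%:R * D%:R * (D%:R / (D%:R + 1)) ^+ m <= (2 * M%:R * K%:R)^-1 :> R.

Definition found := search n (ram (input_state G)) D B T H K NP.
Definition out_den := zd n (ram (input_state G)) D B T H found.
Definition out_num := let z := zn n (ram (input_state G)) D B T H found in
  if (2 * z < out_den)%N then 0%N else z.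

(** The lower bound is monotonicity in the weights, from 0 upwards. In the upper bound, with x = 1 /
    (16 E), dividing by 1 - x costs exp(2 x) and the estimate exp(x); with n / (4 E) = 4 n x this
    stays below 8 n x = n / (2 E). *)
Lemma found_bounds :
  (Perm G)%:R <= (1 + K%:R^-1) * zhat G R D B T H found /\
  zhat G R D B T H found <= expR (n%:R / (2 * E%:R)) * ((Perm G)%:R + 2^-1 ^+ (2 * n + 16 * E)).
Proof.
have tT v : (found v <= T)%N by apply: search_le.
have st : stable G D B T H K found.
  apply: (@search_stable n G R _ _ _ _ _ _ (pD_gt0 E_gt0) (pB_gt0 n E_gt0) (pK_gt0 n E_gt0) (ps n E)) => // tau tauT.
  exact: zhat_low.
have up := stable_zreal n_gt0 E_gt0 m_big tT st.
have [l1 l2] := zhat_zreal G n_gt0 E_gt0 m_big found.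
have EE : 0 < E%:R :> R by rewrite ltr0n.
have E1 : 1 <= E%:R :> R by rewrite ler1n.
have KE : K%:R^-1 <= (16 * E%:R)^-1 :> R.
  rewrite lef_pV2 ?posrE ?ltr0n ?mulr_gt0 ?pK_gt0 // -natrM ler_nat /pK.
  by have := pT_gt0 n E_gt0; move: (pT n E) => t; nia.
have z0 : 0 < zhat G R D B T H found := zhat_gt0 _ _ _ _ (pD_gt0 E_gt0) (pB_gt0 n E_gt0) _.
split.
  apply: le_trans l2; rewrite -md_Perm; apply: md_le; [exact: gedge_sym|by []|].
  by move=> x; apply/ltW/column_weight_gt0 => // v; apply: yreal_gt0.
set x : R := (16 * E%:R)^-1 in KE up *.
have x0 : 0 < x by rewrite invr_gt0 mulr_gt0.
have x16 : x <= 16^-1.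
  by rewrite /x lef_pV2 ?posrE ?mulr_gt0 //; lra.
set Pe := (Perm G)%:R + _ in up *.
have P0 : 0 <= Pe by rewrite addr_ge0 ?exprn_ge0 ?invr_ge0.
have e2 : 1 <= (1 - x) * expR (2 * x).
  apply: le_trans (_ : (1 - x) * (1 + 2 * x) <= _); last first.
    by rewrite ler_wpM2l ?expR_ge1Dx //; lra.
  have -> : (1 - x) * (1 + 2 * x) = 1 + x * (1 - 2 * x) by ring.
  by rewrite lerDl mulr_ge0 //; lra.
apply: le_trans l1 _.
apply: le_trans (_ : expR x * (zreal G R E found * ((1 - x) * expR (2 * x))) <= _).
  apply: ler_pM; [by rewrite addr_ge0 ?invr_ge0| exact/ltW/zreal_gt0| |].
    by apply: le_trans (expR_ge1Dx _); rewrite lerD2l.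
  by rewrite ler_peMr // ltW // zreal_gt0.
have -> : expR x * (zreal G R E found * ((1 - x) * expR (2 * x))) =
  expR (2 * x) * expR x * (zreal G R E found * (1 - x)) by ring.
apply: le_trans (_ : expR (2 * x) * expR x * (expR (n%:R / (4 * E%:R)) * Pe) <= _).
  by rewrite ler_wpM2l // mulr_ge0 ?expR_ge0.
rewrite mulrA -!expRD ler_wpM2r // ler_expR.
have -> : 2 * x + x + n%:R / (4 * E%:R) = (3 + 4 * n%:R) * x by rewrite /x; field; rewrite gt_eqF.
have -> : n%:R / (2 * E%:R) = 8 * n%:R * x by rewrite /x; field; rewrite gt_eqF.
by rewrite ler_pM2r //; have : 1 <= n%:R :> R; [rewrite ler1n|lra].
Qed.

(** If the permanent is 0, then exp(n / (2 E)) <= 2^(2 n) leaves at most 1 / (16 E) < 1/2 and the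
    output is 0. Otherwise it is at least 1, so the estimate is at least 1/2 and is kept, and the
    additive error is at most Perm(G) / (16 E). *)
Lemma out_bounds :
  expR (- (n%:R / E%:R)) * (Perm G)%:R <= out_num%:R / out_den%:R :> R /\
  out_num%:R / out_den%:R <= expR (n%:R / E%:R) * (Perm G)%:R :> R.
Proof.
have [lo up] := found_bounds.
have EE : 0 < E%:R :> R by rewrite ltr0n.
have nR : 1 <= n%:R :> R by rewrite ler1n.
have d0 : 0 < out_den%:R :> R by rewrite ltr0n (zd_gt0 G R _ _ (pD_gt0 E_gt0) (pB_gt0 n E_gt0)).
have test : (2 * zn n (ram (input_state G)) D B T H found < out_den)%N =
    (zhat G R D B T H found < 2^-1).
  rewrite /zhat ltr_pdivrMr // [2^-1 * _]mulrC ltr_pdivlMr // -natrM ltr_nat mulnC //.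
have K1 : 1 <= K%:R :> R by rewrite ler1n pK_gt0.
have k1 : K%:R^-1 <= 1 :> R by rewrite invf_le1 // (lt_le_trans ltr01).
have k0 : 0 <= K%:R^-1 :> R by rewrite invr_ge0.
have z0 : 0 < zhat G R D B T H found := zhat_gt0 _ _ _ _ (pD_gt0 E_gt0) (pB_gt0 n E_gt0) _.
have half : 2^-1 ^+ (2 * n + 16 * E) <= 2^-1 ^+ (2 * n) * (16 * E%:R)^-1 :> R.
  rewrite exprD ler_wpM2l ?exprn_ge0 ?invr_ge0 // -natrM; apply: exp_half_le.
  by rewrite muln_gt0 E_gt0.
have s1 : 2^-1 ^+ (2 * n) <= 1 :> R by rewrite exprn_ile1 ?invr_ge0 // invf_le1 // ler1n.
have e1 : 0 < (16 * E%:R)^-1 :> R by rewrite invr_gt0 mulr_gt0.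
have e2 : (16 * E%:R)^-1 <= 16^-1 :> R.
  by rewrite lef_pV2 ?posrE ?mulr_gt0 // ler_peMr // ler1n.
rewrite /out_num test; case: (posnP (Perm G)) => [P0|P1].
  rewrite P0 !mulr0; suff -> : zhat G R D B T H found < 2^-1 by rewrite mul0r.
  apply: le_lt_trans up _; rewrite P0 add0r.
  have e4 : expR (n%:R / (2 * E%:R)) <= 2 ^+ (2 * n) :> R.
    rewrite exprM; apply: le_trans (_ : expR (1 : R) ^+ n <= _).
      rewrite expr_nat ler_expR mulr1 ler_pdivrMr ?mulr_gt0 // ler_peMr //.
      have : 1 <= E%:R :> R by rewrite ler1n.
      lra.
    rewrite lerXn2r ?nnegrE ?expR_ge0 ?exprn_ge0 //.
    by apply: le_trans (expR1_le4 R) _; rewrite expr2; lra.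
  apply: le_lt_trans (ler_pM (expR_ge0 _) _ e4 half) _; first by rewrite exprn_ge0 ?invr_ge0.
  rewrite mulrA -exprMn divff ?expr1n ?mul1r ?pnatr_eq0 //.
  by apply: le_lt_trans e2 _; lra.
have PR : 1 <= (Perm G)%:R :> R by rewrite ler1n.
have -> : (zhat G R D B T H found < 2^-1) = false.
  apply/negbTE; rewrite -leNgt; have : 1 <= 2 * zhat G R D B T H found.
    by apply: le_trans PR _; apply: le_trans lo _; rewrite ler_pM2r //; lra.
  lra.
rewrite -/(zhat G R D B T H found); split.
  rewrite expRN mulrC ler_pdivrMr ?expR_gt0 // mulrC; apply: le_trans lo _.
  rewrite ler_pM2r //; apply: le_trans (expR_ge1Dx _); rewrite lerD2l.
  apply: le_trans (_ : E%:R^-1 <= _); last by rewrite ler_peMl // invr_ge0 ltW.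
  have K0 : 0 < K%:R :> R := lt_le_trans ltr01 K1.
  rewrite lef_pV2 ?posrE ?K0 ?EE // ler_nat /pK.
  move: (pT n E) (pT_gt0 n E_gt0) => t t0.
  by rewrite -!mulnA mulnCA leq_pmulr // !muln_gt0 t0.
apply: le_trans up _.
have le1 : (Perm G)%:R + 2^-1 ^+ (2 * n + 16 * E) <= expR ((16 * E%:R)^-1) * (Perm G)%:R :> R.
  apply: le_trans (_ : (1 + (16 * E%:R)^-1) * (Perm G)%:R <= _); last first.
    by rewrite ler_wpM2r ?expR_ge1Dx.
  rewrite mulrDl mul1r lerD2l; apply: le_trans half _.
  by rewrite mulrC ler_pM2l // (le_trans s1 PR).
apply: le_trans (ler_wpM2l (expR_ge0 _) le1) _.
rewrite mulrA -expRD ler_wpM2r // ler_expR.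
have -> : n%:R / (2 * E%:R) + (16 * E%:R)^-1 = (8 * n%:R + 1) * (16 * E%:R)^-1 :> R by field; rewrite gt_eqF.
have -> : n%:R / E%:R = 16 * n%:R * (16 * E%:R)^-1 :> R by field; rewrite gt_eqF.
by rewrite ler_pM2r //; lra.
Qed.

End Output.

Local Open Scope nat_scope.

(** * Size of the parameters and running time *)

Definition poly_lg (f : nat -> nat) := exists c, forall n, f n <= 2 ^ (c * lg n).
Definition quasi_lg (f : nat -> nat) := exists c, forall n, f n <= 2 ^ (c * (lg n * lg n)).

Lemma lg_gt0 n : 0 < lg n. Proof. by case: (lg_spec n). Qed.

Lemma poly_lg_const c : poly_lg (fun=> c).
Proof.
exists c => n; apply: leq_trans (ltnW (ltn_expl c (ltnSn 1))) _.
by rewrite leq_pexp2l // leq_pmulr ?lg_gt0.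
Qed.

Lemma poly_lg_id : poly_lg id.
Proof. by exists 1 => n; rewrite mul1n ltnW //; case: (lg_spec n). Qed.

Lemma poly_lgM f g : poly_lg f -> poly_lg g -> poly_lg (fun n => f n * g n).
Proof.
move=> [c fc] [d gd]; exists (c + d) => n; rewrite mulnDl expnD.
exact: leq_mul.
Qed.

Lemma poly_lgD f g : poly_lg f -> poly_lg g -> poly_lg (fun n => f n + g n).
Proof.
move=> [c fc] [d gd]; exists (1 + c + d) => n.
have a := leq_trans (fc n) (_ : _ <= 2 ^ ((c + d) * lg n)).
have b := leq_trans (gd n) (_ : _ <= 2 ^ ((c + d) * lg n)).
rewrite -addnA mulnDl mul1n expnD.
have : 2 <= 2 ^ lg n by case: (lg n) (lg_gt0 n) => // l _; rewrite expnS leq_pmulr // expn_gt0.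
have {}a : f n <= 2 ^ ((c + d) * lg n) by apply: a; rewrite leq_pexp2l // leq_mul2r leq_addr orbT.
have {}b : g n <= 2 ^ ((c + d) * lg n) by apply: b; rewrite leq_pexp2l // leq_mul2r leq_addl orbT.
move: (2 ^ lg n) (2 ^ _) a b => u v; nia.
Qed.

Lemma poly_lg_exp f k : poly_lg f -> poly_lg (fun n => f n ^ k).
Proof.
move=> fP; elim: k => [|k IH]; first exact: (poly_lg_const 1).
have [c fc] := poly_lgM fP IH; exists c => n; rewrite expnS; exact: fc.
Qed.

Lemma quasi_poly f : poly_lg f -> quasi_lg f.
Proof.
move=> [c fc]; exists c => n; apply: leq_trans (fc n) _.
by rewrite leq_pexp2l // leq_mul2l leq_pmulr ?lg_gt0 // orbT.
Qed.

Lemma quasi_lgM f g : quasi_lg f -> quasi_lg g -> quasi_lg (fun n => f n * g n).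
Proof.
move=> [c fc] [d gd]; exists (c + d) => n; rewrite mulnDl expnD.
exact: leq_mul.
Qed.

Lemma quasi_lgD f g : quasi_lg f -> quasi_lg g -> quasi_lg (fun n => f n + g n).
Proof.
move=> [c fc] [d gd]; exists (1 + c + d) => n.
have l1 : 0 < lg n * lg n by rewrite muln_gt0 lg_gt0.
move: (lg n * lg n) l1 (fc n) (gd n) => l l1 fn gn.
have a : f n <= 2 ^ ((c + d) * l).
  by apply: leq_trans fn _; rewrite leq_pexp2l // leq_mul2r leq_addr orbT.
have b : g n <= 2 ^ ((c + d) * l).
  by apply: leq_trans gn _; rewrite leq_pexp2l // leq_mul2r leq_addl orbT.
rewrite -addnA mulnDl mul1n expnD.
have : 2 <= 2 ^ l by case: l l1 {fn gn a b} => // l _; rewrite expnS leq_pmulr // expn_gt0.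
move: (2 ^ l) (2 ^ _) a b => u v; nia.
Qed.

Lemma quasi_lg_exp f h : poly_lg f -> (exists c, forall n, h n <= c * lg n) ->
  quasi_lg (fun n => f n ^ h n).
Proof.
move=> [c fc] [d hd]; exists (c * d) => n.
apply: leq_trans (_ : (2 ^ (c * lg n)) ^ h n <= _).
  by case: (h n) => // k; rewrite leq_exp2r.
rewrite -expnM leq_pexp2l // -!mulnA leq_mul2l mulnCA leq_mul2l.
by rewrite hd !orbT.
Qed.

Section Params.
Variable E : nat.
Hypothesis E_gt0 : 0 < E.

Local Notation D := (pD E).

Lemma poly_pr : poly_lg (fun n => pr n E).
Proof.
have n1 : poly_lg (fun n => n.+1).
  have [c cP] := poly_lgD (poly_lg_const 1) poly_lg_id; by exists c => n; apply: cP.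
have k a : poly_lg (fun=> a) := poly_lg_const a.
rewrite /pr; apply: poly_lgD (k _); apply: poly_lgD.
  exact: poly_lgM (poly_lgM (k 4) poly_lg_id) n1.
exact: poly_lgM (k 2) poly_lg_id.
Qed.

Lemma poly_lgS f : poly_lg f -> poly_lg (fun n => (f n).+1).
Proof.
move=> fP; have [c cP] := poly_lgD (poly_lg_const 1) fP.
by exists c => n; apply: cP.
Qed.

Lemma poly_pB : poly_lg (fun n => pB n E).
Proof.
apply: poly_lgM (poly_lgS poly_pr); apply: poly_lgM (poly_lg_const _) _.
exact/poly_lg_exp/poly_lgS/poly_lg_id.
Qed.

Lemma poly_pT : poly_lg (fun n => pT n E).
Proof. exact: poly_lgM poly_pB (poly_lgS poly_pr). Qed.

Lemma poly_pK : poly_lg (fun n => pK n E).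
Proof.
by apply: poly_lgM poly_pT; apply: poly_lgM (poly_lg_const _) (poly_lgS poly_lg_id).
Qed.

Lemma poly_ps : poly_lg (fun n => ps n E).
Proof.
have k a : poly_lg (fun=> a) := poly_lg_const a.
apply: poly_lgD.
  apply: poly_lgD (k 2) _; apply: poly_lgM (poly_lgM (k 4) poly_lg_id) (poly_lgS poly_lg_id).
apply: poly_lgM (poly_lgM (k 2) poly_lg_id) _; apply: poly_lgD (k _) _.
exact: poly_lgM (k 2) (poly_lgS poly_pr).
Qed.

Lemma poly_pNP : poly_lg (fun n => pNP n E).
Proof. exact: poly_lgS (poly_lgM poly_pK poly_ps). Qed.

Definition pb0 n := n.+1 + D.+1 + (pB n E).+1 * pT n E.

Lemma pb0_big n : n.+1 * D.+1 * (pB n E).+1 ^ pT n E <= 2 ^ pb0 n.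
Proof.
rewrite /pb0; move: (pB n E) (pT n E) D => b t d; rewrite expnD (expnD _ n.+1) expnM.
apply: leq_mul; first by apply: leq_mul; apply/ltnW/ltn_expl.
by case: t => // t; rewrite leq_exp2r //; apply/ltnW/ltn_expl.
Qed.

Lemma poly_pb0 : poly_lg pb0.
Proof.
apply: poly_lgD; last exact: poly_lgM (poly_lgS poly_pB) poly_pT.
exact: poly_lgD (poly_lgS poly_lg_id) (poly_lg_const _).
Qed.

Lemma exists_levels : exists k, forall n,
  2 * (n + n) ^ 2 * pK n E * D <= 2 ^ (k * lg n).
Proof.
have M : poly_lg (fun n => n + n) := poly_lgD poly_lg_id poly_lg_id.
have [c cP] := poly_lgM (poly_lgM (poly_lgM (poly_lg_const 2) (poly_lg_exp 2 M)) poly_pK)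
  (poly_lg_const D).
by exists c.
Qed.

Variable k : nat.
(** Since (D / (D + 1))^(D + 1) <= 1/2, the error is halved by D + 1 double levels, and k lg n
    halvings are enough. *)
Definition pm n := D.+1 * (k * lg n).

(** The depth is O(lg n), so powers with this exponent and a polynomial base are 2^(O(lg^2 n)); the
    other parameters are polynomial. One constant [c1], independent of n, covers all. *)
Lemma exists_bound : exists2 c1, 0 < c1 & forall n,
  [/\ (n + n + 2) * bits n (pb0 n) (pH (pm n)) < bound c1 n,
      2 * (n + n) ^ pH (pm n) <= bound c1 n,
      pT n E <= bound c1 n, pNP n E <= bound c1 n &
      [/\ (pK n E).+2 <= bound c1 n, (pr n E).+1 <= bound c1 n, ps n E <= bound c1 n & n.+1 <= bound c1 n]].
Proof.
have hH : exists c, forall n, pH (pm n) <= c * lg n.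
  exists (2 * (D.+1 * k)).+1 => n; rewrite /pH /pm -mul2n mulSn !mulnA.
  by have := lg_gt0 n; lia.
have M2 : poly_lg (fun n => 2 * (n + n) + 2).
  apply: poly_lgD (poly_lg_const 2).
  exact: poly_lgM (poly_lg_const 2) (poly_lgD poly_lg_id poly_lg_id).
have M : poly_lg (fun n => n + n) := poly_lgD poly_lg_id poly_lg_id.
have q1 : quasi_lg (fun n => (n + n + 2) * bits n (pb0 n) (pH (pm n))).
  apply: quasi_lgM; first exact/quasi_poly/(poly_lgD M (poly_lg_const 2)).
  exact: quasi_lgM (quasi_poly poly_pb0) (quasi_lg_exp M2 hH).
have q2 : quasi_lg (fun n => 2 * (n + n) ^ pH (pm n)).
  exact: quasi_lgM (quasi_poly (poly_lg_const 2)) (quasi_lg_exp M hH).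
have q3 : quasi_lg (fun n => pT n E + pNP n E + pK n E + pr n E + ps n E + n + 2).
  apply: quasi_poly; apply: poly_lgD (poly_lg_const 2); apply: poly_lgD poly_lg_id.
  apply: poly_lgD poly_ps; apply: poly_lgD poly_pr; apply: poly_lgD poly_pK.
  exact: poly_lgD poly_pT poly_pNP.
have [c cP] := quasi_lgD (quasi_lgD q1 q2) q3; exists c.+1 => // n.
have := cP n; have : 2 ^ (c * (lg n * lg n)) <= bound c.+1 n.
  by rewrite leq_pexp2l // leq_mul2r leqnSn orbT.
move: (2 ^ _) (bound _ _) => u b ub.
move: (_ * bits _ _ _) (2 * _ ^ _) (pT _ _) (pNP _ _) (pK _ _) (pr _ _) (ps _ _) => z1 z2 z3 z4 z5 z6 z7 le.
by do ! split; lia.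
Qed.

(** * The parameters as expressions of the program *)

Definition e_succ := Plus Size (Num 1).
Definition e_pr := Plus (Plus (Times (Times (Num 4) Size) e_succ) (Times (Num 2) Size)) (Num (16 * E)).
Definition e_prS := Plus e_pr (Num 1).
(** Multiplication is exact when the right factor is below 2 ^ X, which decides the order of the
    factors here and below. *)
Definition e_B := Times (Times (Times (Times (Num (512 * E)) e_succ) e_succ) e_succ) e_prS.
Definition e_T := Times e_B e_prS.
Definition e_K := Times (Times (Num (256 * E)) e_succ) e_T.
Definition e_s := Plus (Plus (Num 2) (Times (Times (Num 4) Size) e_succ))
  (Times (Plus (Num D) (Plus e_prS e_prS)) (Plus Size Size)).
Definition e_NP := Plus (Times e_K e_s) (Num 1).
Definition e_H := Plus (Times (Num (2 * (D.+1 * k))) Log) (Num 1).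

Section Evaluation.
Variables (n X : nat) (inp : nat -> nat).
Hypotheses (n_lt : n.+1 <= X) (pr_lt : (pr n E).+1 <= X) (T_lt : pT n E <= X)
  (s_lt : ps n E <= X) (l_lt : lg n <= X).
Local Notation ev := (eval n (lg n) X inp).

Let lt2X a : a <= X -> a < 2 ^ X.
Proof. by move=> aX; apply: leq_ltn_trans aX _; apply: ltn_expl. Qed.

Lemma ev_succ env mem : ev env mem e_succ = n.+1. Proof. by rewrite /= addn1. Qed.

Lemma ev_prS env mem : ev env mem e_prS = (pr n E).+1.
Proof.
have n1 := lt2X n_lt; have n0 := lt2X (ltnW n_lt).
by rewrite /e_prS /e_pr; cbn [eval]; rewrite ev_succ !mulXE // addn1.
Qed.

Lemma ev_pB env mem : ev env mem e_B = pB n E.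
Proof.
rewrite /e_B; cbn [eval]; rewrite ev_succ ev_prS !mulXE ?lt2X //.
by rewrite /pB !expnS expn0 muln1 !mulnA.
Qed.

Lemma ev_pT env mem : ev env mem e_T = pT n E.
Proof. by rewrite /e_T; cbn [eval]; rewrite ev_pB ev_prS mulXE // lt2X. Qed.

Lemma ev_pK env mem : ev env mem e_K = pK n E.
Proof. by rewrite /e_K; cbn [eval]; rewrite ev_pT ev_succ !mulXE // lt2X. Qed.

Lemma ev_ps env mem : ev env mem e_s = ps n E.
Proof.
have n1 := lt2X n_lt; have n0 := lt2X (ltnW n_lt).
have n2 : n + n < 2 ^ X.
  apply: leq_ltn_trans (lt2X pr_lt); rewrite /pr; lia.
rewrite /e_s; cbn [eval]; rewrite ev_succ ev_prS !mulXE //.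
by rewrite /ps; move: (pr n E) D => u d; lia.
Qed.

Lemma ev_pNP env mem : ev env mem e_NP = pNP n E.
Proof. by rewrite /e_NP; cbn [eval]; rewrite ev_pK ev_ps mulXE ?lt2X // addn1. Qed.

Lemma ev_pH env mem : ev env mem e_H = pH (pm n).
Proof.
rewrite /e_H; cbn [eval]; rewrite mulXE ?lt2X // addn1 /pH /pm -mul2n.
by rewrite !mulnA.
Qed.

End Evaluation.

End Params.

Local Open Scope ring_scope.

Lemma levels_enough (R : realType) n E k : (0 < E)%N -> (0 < n)%N ->
  (2 * (n + n) ^ 2 * pK n E * pD E <= 2 ^ (k * lg n))%N ->
  (n + n)%:R * (pD E)%:R * ((pD E)%:R / ((pD E)%:R + 1)) ^+ pm E k n <=
  (2 * (n + n)%:R * (pK n E)%:R)^-1 :> R.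
Proof.
move=> E0 n0; have := pD_gt0 E0; have := pK_gt0 n E0.
rewrite /pm; move: (pD E) (pK n E) => D K K0 D0 le.
have D1 : 0 < D%:R :> R by rewrite ltr0n.
have K1 : 0 < K%:R :> R by rewrite ltr0n.
have M1 : 0 < (n + n)%:R :> R by rewrite ltr0n addn_gt0 n0.
have half : (D%:R / (D%:R + 1)) ^+ D.+1 <= 2^-1 :> R.
  rewrite -[D%:R / _]invrK invf_div exprVn lef_pV2 ?posrE ?exprn_gt0 ?divr_gt0 ?addr_gt0 //.
  have -> : (D%:R + 1) / D%:R = 1 + D%:R^-1 :> R by rewrite mulrDl divff ?gt_eqF // mul1r.
  apply: le_trans (bernoulli _ _); last by rewrite invr_ge0 ltW.
  by rewrite -(natr1 D) mulrDl divff ?gt_eqF // mul1r addrA lerDl invr_ge0 ltW.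
rewrite exprM; apply: le_trans (_ : (n + n)%:R * D%:R * 2^-1 ^+ (k * lg n) <= _).
  rewrite ler_pM2l ?mulr_gt0 // lerXn2r ?nnegrE ?exprn_ge0 ?divr_ge0 ?invr_ge0 //.
  by rewrite addr_ge0.
rewrite exprVn ler_pdivrMr ?exprn_gt0 // [leRHS]mulrC ler_pdivlMr ?mulr_gt0 //.
rewrite -natrX -!natrM ler_nat; apply: leq_trans le.
by apply: eq_leq; rewrite expnS expn1; ring.
Qed.

(** * The algorithm and its running time *)

Section Algorithm.
Variables (R : realType) (E : nat).
Hypothesis E_gt0 : (0 < E)%N.

(** The empty graph, whose permanent is 1, is answered by 1 / 1 without regard to the search. *)
Definition e_num := Cond Size
  (Cond (eLt (Plus (Get 6 (Num 0)) (Get 6 (Num 0))) (Get 6 (Num 1))) (Num 0) (Get 6 (Num 0)))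
  (Num 1).
Definition e_den := Cond Size (Get 6 (Num 1)) (Num 1).

Lemma algorithm : exists A c c1 h, forall n (G : bigraph n), exists t (Z : rat),
  [/\ runs A G t Z,
      expR (- (n%:R / E%:R)) * (Perm G)%:R <= ratr Z :> R,
      ratr Z <= expR (n%:R / E%:R) * (Perm G)%:R :> R &
      (t <= c * (bound c1 n).+1 ^ h)%N].
Proof.
have [k kP] := exists_levels E.
have [c1 c10 c1P] := exists_bound E_gt0 k.
have [A [c [h AP]]] := machineP (pSearch (Num (pD E)) (e_B E) (e_T E) (e_H E k) (e_K E) (e_NP E))
  e_num e_den c10.
exists A, c, c1, h => n G; have [s [t [ex le r0 r1]]] := AP n G.
have [B1 B2 B3 B4 [B5 B6 B7 B8]] := c1P n.
move: le; set X := bound c1 n in ex r0 r1 B1 B2 B3 B4 B5 B6 B7 B8 *; move=> le.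
exists t, ((reg s 0)%:R / (reg s 1)%:R).
have [n0|n0] := posnP n.
  have {}r0 : reg s 0 = 1%N by rewrite r0 /e_num; cbn [eval]; rewrite ifF // n0.
  have {}r1 : reg s 1 = 1%N by rewrite r1 /e_den; cbn [eval]; rewrite ifF // n0.
  have nR : n%:R = 0 :> R by rewrite n0.
  have -> : Perm G = 1%N.
    rewrite /Perm /permanent (eq_bigr (fun=> 1%N)).
      by rewrite sum1_card card_Sn n0.
    by move=> p _; rewrite big1 // => i; have := ltn_ord i; rewrite [X in (_ < X)%N]n0.
  rewrite nR mul0r oppr0 expR0 !mul1r r0 r1 divr1 rmorph_nat.
  by split=> //; exists s; rewrite r0 r1 divr1; split.
have lX a : (a <= X)%N -> (a < 2 ^ X)%N.
  by move=> aX; apply: leq_ltn_trans aX _; apply: ltn_expl.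
have lgX : (lg n <= X)%N.
  rewrite /X /bound; apply: leq_trans (ltnW (ltn_expl (lg n) (ltnSn 1))) _.
  rewrite leq_pexp2l //.
  by rewrite mulnCA leq_pmulr // muln_gt0 c10 lg_gt0.
have T0 := pT_gt0 n E_gt0; have B0 := pB_gt0 n E_gt0.
have inp1 := inp_le1 G.
pose inp := ram (input_state G).
have [z0 z1] := @run_search n (lg n) X inp (pD E) (pB n E) (pT n E) (pH (pm E k n))
  (Num (pD E)) (e_B E) (e_T E) (e_H E k) (fun _ _ => erefl)
  (ev_pB inp B8 B6) (ev_pT inp B8 B6) (ev_pH E k inp lgX) (pb0 E n) isT (pb0_big E n) B1 isT B2 T0 B3
  inp1 B0 (pK n E) (pNP n E) (e_K E) (e_NP E) (ev_pK inp B8 B6 B3) (ev_pNP E_gt0 inp B8 B6 B3 B7 lgX)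
  (lX _ (ltnW B5)) B4 n0.
have m_big := levels_enough R E_gt0 n0 (kP n).
have [lo up] := out_bounds G n0 E_gt0 m_big.
have nn : (n != 0%N) = true by rewrite -lt0n n0.
have eD : reg s 1 = out_den G E (pm E k n).
  by rewrite r1 /e_den; cbn [eval]; rewrite nn; cbv iota; rewrite (@mod8 6 isT) z1.
have eN : reg s 0 = out_num G E (pm E k n).
  rewrite r0 /e_num; cbn [eval]; rewrite nn; cbv iota; rewrite ev_lt; cbn [eval].
  by rewrite (@mod8 6 isT) z0 z1 addnn -mul2n if_nat_of_bool.
have d0 : (0 < reg s 1)%N by rewrite eD (zd_gt0 G R _ _ (pD_gt0 E_gt0) B0).
split; [exists s; split=> //; first by rewrite -lt0n| | |exact: le].
  by rewrite fmorph_div !rmorph_nat eN eD.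
by rewrite fmorph_div !rmorph_nat eN eD.
Qed.

End Algorithm.

(** For n >= 4 one has ln n >= 1, which absorbs constants, and 2^(lg n) <= 2 n + 2 <= n^2, which
    gives lg n <= 4 ln n. *)
Lemma quasi_time (R : realType) (c c1 h : nat) : exists A0 : R, 0 < A0 /\ forall n, (4 <= n)%N ->
  (c * (bound c1 n).+1 ^ h)%:R <= expR (A0 * ln n%:R ^+ 2) :> R.
Proof.
have ln2 : 1 / 2 <= ln 2 :> R.
  rewrite -ler_expR lnK ?posrE //; apply: le_trans (expR_le1Dx2 _) _; lra.
exists (c%:R + h%:R * (1 + 16 * c1%:R) + 1); split.
  by rewrite ltr_wpDl // addr_ge0 ?mulr_ge0 ?addr_ge0 ?mulr_ge0.
move=> n n4; have n0 : 0 < n%:R :> R by rewrite ltr0n; lia.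
have l1 : 1 <= ln n%:R :> R.
  rewrite -ler_expR lnK ?posrE //; apply: le_trans (expR1_le4 R) _; by rewrite ler_nat.
have ll : (lg n)%:R <= 4 * ln n%:R :> R.
  have [_ _ le] := lg_spec n.
  have : 2 ^+ lg n <= n%:R ^+ 2 :> R by rewrite -!natrX ler_nat; nia.
  rewrite -ler_ln ?posrE ?exprn_gt0 // !lnXn // -[ln 2 *+ _]mulr_natr -[ln n%:R *+ 2]mulr_natr.
  have : 1 / 2 * (lg n)%:R <= ln 2 * (lg n)%:R :> R by rewrite ler_wpM2r.
  lra.
have nat_exp (a : nat) : a%:R <= expR a%:R :> R.
  by apply: le_trans (expR_ge1Dx _); rewrite lerDr.
have b_exp : (bound c1 n).+1%:R <= expR (1 + c1%:R * (lg n)%:R ^+ 2) :> R.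
  apply: le_trans (_ : 2 * (bound c1 n)%:R <= _).
    rewrite -natrM ler_nat mul2n -addnn -addn1 leq_add2l.
    by rewrite /bound expn_gt0.
  have e2 : 2 <= expR 1 :> R by apply: le_trans (expR_ge1Dx _); lra.
  rewrite expRD; apply: ler_pM => //; rewrite /bound natrX.
  have -> : c1%:R * (lg n)%:R ^+ 2 = (c1 * (lg n * lg n))%:R * 1 :> R.
    by rewrite mulr1 !natrM expr2.
  by rewrite -expr_nat lerXn2r ?nnegrE ?expR_ge0.
rewrite natrM natrX; apply: le_trans (_ : expR c%:R * expR (1 + c1%:R * (lg n)%:R ^+ 2) ^+ h <= _).
  apply: ler_pM => //; first by rewrite exprn_ge0.
  by rewrite lerXn2r ?nnegrE ?expR_ge0.
rewrite expr_nat -expRD ler_expR.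
set L := ln n%:R in l1 ll *.
have L2 : 1 <= L ^+ 2 by rewrite exprn_ege1.
have g2 : (lg n)%:R ^+ 2 <= 16 * L ^+ 2 :> R.
  apply: le_trans (_ : (4 * L) ^+ 2 <= _); last by rewrite exprMn; lra.
  by rewrite lerXn2r ?nnegrE // mulr_ge0 //; lra.
apply: le_trans (_ : c%:R * L ^+ 2 + h%:R * (L ^+ 2 + c1%:R * (16 * L ^+ 2)) <= _).
  by rewrite lerD ?ler_peMr // ler_wpM2l // lerD // ler_wpM2l.
rewrite -subr_ge0; have -> : (c%:R + h%:R * (1 + 16 * c1%:R) + 1) * L ^+ 2 -
  (c%:R * L ^+ 2 + h%:R * (L ^+ 2 + c1%:R * (16 * L ^+ 2))) = L ^+ 2 by ring.
lra.
Qed.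

Local Open Scope ring_scope.

Theorem theorem3 (R : realType) :
  exists2 C : R, 0 < C &
    forall eps : R, 0 < eps ->
    exists (A : prog) (n0 : nat),
    forall (n : nat) (G : bigraph n),
    exists (t : nat) (Z : rat),
      [/\ runs A G t Z,
          (1 + eps) ^- n * (Perm G)%:R <= ratr Z,
          ratr Z <= (1 + eps) ^+ n * (Perm G)%:R
        & (n0 <= n)%N ->
          t%:R <= expR (C * (eps `^ (- (1 / 2)) * n%:R `^ (2 / 3)
                             * ln n%:R ^+ 3))].
Proof.
exists 1 => // eps eps0.
have e1 : 0 < 1 + eps by rewrite addr_gt0.
have l0 : 0 < ln (1 + eps) by rewrite ln_gt0 // ltrDl.
(* So 1 / E <= ln(1 + eps), and the accuracy exp(n / E) is within (1 + eps)^n. *)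
pose E := Num.bound (ln (1 + eps))^-1.
have lE : (ln (1 + eps))^-1 < E%:R by apply: archi_boundP; rewrite invr_ge0 ltW.
have E0 : (0 < E)%N by rewrite -(ltr0n R) (le_lt_trans _ lE) // invr_ge0 ltW.
have El : E%:R^-1 <= ln (1 + eps).
  by rewrite -[leRHS]invrK lef_pV2 ?posrE ?invr_gt0 ?ltr0n // ltW.
have eE n : expR (n%:R / E%:R) <= (1 + eps) ^+ n.
  rewrite -expr_nat lerXn2r ?nnegrE ?expR_ge0 ?(ltW e1) //.
  by rewrite -[leRHS]lnK ?posrE // ler_expR.
have [A [c [c1 [h AP]]]] := algorithm R E0.
have [A0 [A00 time]] := quasi_time R c c1 h.
(* Beyond this threshold ln n > A0 eps^(1/2), so the spare logarithm absorbs both [A0], which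
   depends on [eps], and the factor eps^(- 1/2); the factor n^(2/3) is only used as being at least
   1. Hence C = 1 works. *)
pose a : R := expR (A0 * expR (1 / 2 * ln eps)).
exists A, (4 + Num.bound a)%N => n G.
have [t [Z [run lo up le]]] := AP n G; exists t, Z; split=> //.
- apply: le_trans lo; rewrite ler_wpM2r // expRN lef_pV2 ?posrE ?expR_gt0 ?exprn_gt0 //.
- by apply: le_trans up _; rewrite ler_wpM2r.
move=> nn0; have n4 : (4 <= n)%N by apply: leq_trans nn0; rewrite leq_addr.
apply: le_trans (_ : (c * (bound c1 n).+1 ^ h)%:R <= _); first by rewrite ler_nat.
apply: le_trans (time n n4) _; rewrite ler_expR mul1r.
have nR : 0 < n%:R :> R by rewrite ltr0n (leq_trans _ n4).
have an : a < n%:R.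
  apply: lt_le_trans (archi_boundP (expR_ge0 _)) _; rewrite ler_nat.
  exact: leq_trans (leq_addl _ _) nn0.
have ln_n : A0 * expR (1 / 2 * ln eps) < ln n%:R.
  by rewrite -ltr_expR lnK ?posrE.
have L0 : 0 <= ln n%:R :> R.
  by apply: le_trans (ltW ln_n); rewrite mulr_ge0 ?expR_ge0 // ltW.
rewrite [_ ^+ 3]exprSr [leRHS]mulrA [leRHS]mulrAC ler_wpM2r ?sqr_ge0 // /powR !gt_eqF //.
apply: le_trans (_ : expR (- (1 / 2) * ln eps) * ln n%:R <= _); last first.
  rewrite ler_wpM2r // ler_peMr ?expR_ge0 //.
  apply: le_trans (expR_ge1Dx _); by rewrite lerDl mulr_ge0 // divr_ge0.
rewrite mulNr expRN mulrC ler_pdivlMr ?expR_gt0 //; exact: ltW.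
Qed.
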